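(* In the standing setting described in the context, there exists an admissible profile $R\in\mathcal M$, and it is unique modulo translation: if $R,\widetilde R\in\mathcal M$ then there is $\xi_0\in\mathbb R$ with $\widetilde R(\xi)=R(\xi-\xi_0)$ for all $\xi\in\mathbb R$. This profile is transonic: there is a unique $\xi_s\in\mathbb R$ (the sonic crossing) with $R(\xi_s)=R_s$. The profile $R$ is strictly increasing on $\mathbb R$, continuous across the sonic crossing, and twice continuously differentiable on $(-\infty,\xi_s)\cup(\xi_s,\infty)$. It uniquely determines $$U(\xi)=c+\frac{m}{R(\xi)},\quad e(\xi)=e(R(\xi)),\quad S(\xi)=\mathcal S(R(\xi)),\quad \mathcal E(\xi)=R(\xi)e(\xi)+\tfrac12R(\xi)U(\xi)^2,$$ and $(R,U,\mathcal E,S)$ is a global weak solution of the traveling-wave system, i.e. in the sense of distributions on $\mathbb R$, $$-c\dot R+\tfrac{d}{d\xi}(RU)=0,\qquad -c\tfrac{d}{d\xi}(RU)+\tfrac{d}{d\xi}\big(RU^2+\tilde p(R,e)+S\big)=0,$$ $$-c\dot{\mathcal E}+\tfrac{d}{d\xi}\big((\mathcal E+\tilde p(R,e)+S)U\big)=0,\qquad R^{-1}S-\alpha\tfrac{d}{d\xi}\big(R^{-1}\dot S\big)-2\alpha\dot U^2=0,$$ where the last equation means $\int_{\mathbb R}\big(R^{-1}S-2\alpha\dot U^2\big)\varphi\,d\xi+\int_{\mathbb R}\alpha R^{-1}\dot S\,\dot\varphi\,d\xi=0$ for all $\varphi\in C_c^\infty(\mathbb R)$.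
   Context: Standing setting. Fix $\alpha>0$, a physical equation of state $\tilde p:(0,\infty)\times\mathbb R\to\mathbb R$, $(\rho,e)\mapsto\tilde p(\rho,e)$, of class $C^2$, real numbers $c,m,q,k$ with $m\neq0$, and end states $R_\pm>0$, $U_\pm,\mathcal E_\pm\in\mathbb R$. Put $e_\pm=\mathcal E_\pm/R_\pm-\frac12U_\pm^2$ and assume the Rankine–Hugoniot relations $R_\pm(U_\pm-c)=m$, $mU_\pm+\tilde p(R_\pm,e_\pm)=q$, $(\mathcal E_\pm+\tilde p(R_\pm,e_\pm))U_\pm-c\,\mathcal E_\pm=k$. For $R>0$ define $$e(R)=e_0+\frac{A}{R}+\frac{m^2}{2R^2},\quad e_0=\frac{k-qc+\frac m2c^2}{m},\quad A=mc-q,$$ the reduced pressure $p(R)=\tilde p(R,e(R))$, and $\mathcal S(R)=q-mc-\frac{m^2}{R}-p(R)$. (Then $e(R_\pm)=e_\pm$ and $\mathcal S(R_\pm)=0$.) Primes denote $d/dR$, dots denote $d/d\xi$. Assume: (1) $R_-<R_+$; (2) Lax inequalities: $U_--\sqrt{p'(R_-)}>c>U_+-\sqrt{p'(R_+)}$ (with $p'(R_\pm)\ge0$); equivalently $m>0$, $\frac{m^2}{R_-^2}-p'(R_-)>0$ and $\frac{m^2}{R_+^2}-p'(R_+)<0$; (3) $p\in C^2((0,\infty))$, and one of the following convexity criteria holds along $(\rho,e)=(R,e(R))$ for $R\in[R_-,R_+]$: (A) the matrix $\begin{pmatrix}\tilde p_{\rho\rho}+\frac{m^2}{R^4}\tilde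 p_e&\tilde p_{\rho e}-\frac1R\tilde p_e\\ \tilde p_{\rho e}-\frac1R\tilde p_e&\tilde p_{ee}\end{pmatrix}$ is positive semidefinite; or (B) $\tilde p_{\rho\rho}\ge0$, $\tilde p_{ee}\ge0$, $\tilde p_e\ge0$, $\tilde p_{\rho e}\ge\frac1R\tilde p_e$, $e'(R)\ge0$. In particular $p''(R)\ge0$, and this inequality is assumed for all $R>0$; (4) $p''$ is Lipschitz in a neighborhood of $R_s$, where the sonic density $R_s\in(R_-,R_+)$ is the unique zero of $\mathcal S'$ in $(0,\infty)$. A weak IGR shock profile is a function $R:\mathbb R\to[R_-,R_+]$ (continuous representative) with $R\in W^{1,2}_{\mathrm{loc}}(\mathbb R)$, $R(\xi)\to R_\pm$ as $\xi\to\pm\infty$, and for every $\varphi\in C_c^\infty(\mathbb R)$ $$\int_{\mathbb R}\alpha\frac{\mathcal S'(R)}{R}\dot R\,\dot\varphi\,d\xi+\int_{\mathbb R}\Big(\frac{\mathcal S(R)}{R}-2\alpha\frac{m^2}{R^4}\dot R^2\Big)\varphi\,d\xi=0.$$ The admissible class $\mathcal M$ is the set of all weak IGR shock profiles that are nondecreasing on $\mathbb R$. *)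

(* Defs.v *)
From HB Require Import structures.
From mathcomp Require Import all_boot all_order all_algebra.
From mathcomp Require Import all_classical all_reals all_analysis.

Set Implicit Arguments.
Unset Strict Implicit.
Unset Printing Implicit Defensive.

Import Order.TTheory GRing.Theory Num.Theory.
Import numFieldNormedType.Exports.

Local Open Scope ring_scope.
Local Open Scope classical_set_scope.

Section Regularity.
Context {K : realType}.
Implicit Types (D : set K) (f g phi : K -> K) (P : K -> K -> K).

(* Meant for open D; continuity of f and of its first derivative on D follows
   from derivability. *)
Definition C2_on D f : Prop :=
  forall x, D x -> [/\ derivable f x 1, derivable f^`() x 1
                     & {for x, continuous f^`()^`()}].

Definition dfst P : K -> K -> K := fun r e => (P^~ e)^`() r.
Definition dsnd P : K -> K -> K := fun r e => (P r)^`() e.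

Definition C1_halfplane P : Prop :=
  forall r e, 0 < r ->
    [/\ derivable (P^~ e) r 1,
        derivable (P r) e 1,
        {for (r, e), continuous (fun x : K * K => dfst P x.1 x.2)}
      & {for (r, e), continuous (fun x : K * K => dsnd P x.1 x.2)}].

(* C^2 on the open half-plane r > 0; the values of P for r <= 0 are irrelevant. *)
Definition C2_halfplane P : Prop :=
  [/\ C1_halfplane P, C1_halfplane (dfst P) & C1_halfplane (dsnd P)].

Definition mx22 (a b c d : K) : 'M[K]_2 :=
  \matrix_(i < 2, j < 2)
    if i == 0 then (if j == 0 then a else b) else (if j == 0 then c else d).

Definition psd n (M : 'M[K]_n) : Prop :=
  M^T = M /\ forall v : 'cV[K]_n, 0 <= (v^T *m M *m v) 0 0.

Definition test_function phi : Prop :=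
  (forall n x, derivable phi^`(n) x 1) /\
  compact (closure [set x | phi x != 0]).

Local Notation mu := (@lebesgue_measure K).

Definition L2_loc f : Prop :=
  measurable_fun [set: K] f /\ locally_integrable [set: K] (fun x => f x ^+ 2).

(* Pairing of the distributional derivative of f with phi. *)
Definition dist_deriv f phi : K := - \int[mu]_x (f x * derive1 phi x).

(* f is in W^{1,2}_loc with weak derivative g; g is determined up to a null set. *)
Definition W12_loc_deriv f g : Prop :=
  [/\ L2_loc f, L2_loc g
    & forall phi, test_function phi ->
        dist_deriv f phi = \int[mu]_x (g x * phi x)].

(* - c f' + g' = 0 in the sense of distributions on the line. *)
Definition dist_balance (c : K) f g : Prop :=
  [/\ locally_integrable [set: K] f, locally_integrable [set: K] g
    & forall phi, test_function phi ->
        - c * dist_deriv f phi + dist_deriv g phi = 0].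

End Regularity.

Section Model.
Context {K : realType}.
Variables (alpha : K) (pt : K -> K -> K) (c m q k : K).
Implicit Types (r : K) (R U e En S : K -> K).

(* The reduced functions below are meaningful for r > 0 only. *)
Definition energy_e r : K :=
  (k - q * c + m / 2 * c ^+ 2) / m + (m * c - q) / r + m ^+ 2 / (2 * r ^+ 2).

Definition pressure_red r : K := pt r (energy_e r).

Definition Sred r : K := q - m * c - m ^+ 2 / r - pressure_red r.

Definition rankine_hugoniot (R0 U0 En0 : K) : Prop :=
  let p0 := pt R0 (En0 / R0 - U0 ^+ 2 / 2) in
  [/\ R0 * (U0 - c) = m,
      m * U0 + p0 = q
    & (En0 + p0) * U0 - c * En0 = k].

Definition convexA r : Prop :=
  let e := energy_e r in
  let pe := dsnd pt r e in
  let off := dsnd (dfst pt) r e - pe / r in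
  psd (mx22 (dfst (dfst pt) r e + m ^+ 2 / r ^+ 4 * pe) off
            off (dsnd (dsnd pt) r e)).

Definition convexB r : Prop :=
  let e := energy_e r in
  let pe := dsnd pt r e in
  [/\ 0 <= dfst (dfst pt) r e, 0 <= dsnd (dsnd pt) r e, 0 <= pe,
      pe / r <= dsnd (dfst pt) r e & 0 <= energy_e^`() r].

Local Notation mu := (@lebesgue_measure K).

Definition weak_profile (Rm Rp : K) R : Prop :=
  [/\ continuous R /\ (forall xi, Rm <= R xi <= Rp),
      R xi @[xi --> -oo] --> Rm,
      R xi @[xi --> +oo] --> Rp
    & exists dR, W12_loc_deriv R dR /\
        forall phi, test_function phi ->
          \int[mu]_xi (alpha * (derive1 Sred (R xi) / R xi) * dR xi * derive1 phi xi)
          + \int[mu]_xi ((Sred (R xi) / R xi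
               - 2 * alpha * (m ^+ 2 / R xi ^+ 4) * dR xi ^+ 2) * phi xi) = 0].

Definition admissible (Rm Rp : K) R : Prop :=
  weak_profile Rm Rp R /\ {homo R : x y / x <= y}.

Definition profile_fields R U e En S : Prop :=
  forall xi,
    [/\ U xi = c + m / R xi,
        e xi = energy_e (R xi),
        S xi = Sred (R xi)
      & En xi = R xi * e xi + R xi * U xi ^+ 2 / 2].

Definition tw_weak_solution R U e En S : Prop :=
  [/\ dist_balance c R (fun xi => R xi * U xi),
      dist_balance c (fun xi => R xi * U xi)
        (fun xi => R xi * U xi ^+ 2 + pt (R xi) (e xi) + S xi),
      dist_balance c En (fun xi => (En xi + pt (R xi) (e xi) + S xi) * U xi)
    & exists dU dS,
        [/\ W12_loc_deriv U dU, W12_loc_deriv S dS,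
            locally_integrable [set: K]
              (fun xi => S xi / R xi - 2 * alpha * dU xi ^+ 2),
            locally_integrable [set: K] (fun xi => alpha * (dS xi / R xi))
          & forall phi, test_function phi ->
              \int[mu]_xi ((S xi / R xi - 2 * alpha * dU xi ^+ 2) * phi xi)
              + \int[mu]_xi (alpha * (dS xi / R xi) * derive1 phi xi) = 0]].

End Model.

(* Main.v *)
(* Put a(r) = alpha S'(r)/r, b(r) = S(r)/r and c(r) = 2 alpha m^2/r^4. The weak equation
   says that the flux w = a(R) R' has the distributional derivative b(R) - c(R) R'^2, so w
   has a continuous representative and R is a classical solution wherever a(R) <> 0, that
   is, away from the sonic density. If G' = 2c/a and F' = 2ab e^G with F = 0 at the end
   state, then w^2 e^{G(R)} - F(R) is constant, and it vanishes at the infinite end. Hence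
   w is a function W(R) of the density, R' = V(R) with V = W/a, and T(R(xi)) - xi is
   constant when T' = 1/V. Convexity of p makes a e^{G/2} nonincreasing up to a harmless
   factor, so T is finite at the sonic density, while T is infinite at the end state
   because V is at most linear there. The supersonic and subsonic halves are exchanged by
   the reflection R(xi) -> -R(-xi). Since W tends to 0 at the sonic density from both
   sides, the two halves match without any further condition, which gives existence, and
   uniqueness up to the position of the crossing. The velocity R' may blow up at the
   crossing, but c(R) R'^2 = b(R) - w' is a nonnegative derivative of a continuous function
   and is therefore integrable. *)

(* Origin of [G] and [F]: as a function of the density, [Z = w^2] satisfies the linear equation
   [dZ/dr = 2 w w'/R' = 2ab - (2c/a) Z], for which [e^G] is an integrating factor. The obstacle is
   that [2c/a] is singular at the sonic density. That [W] vanishes there uses only that [c] is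
   bounded below and that [a] vanishes at least linearly, with [b] bounded. That [T] is finite there
   is subtler: [(a e^(G/2))' = (a' + c) e^(G/2)], so [a' + c <= k a] is wanted. For the coefficients
   of the model the terms [2 alpha m^2/r^4] cancel exactly and [a' + c = - alpha p''/r - a/r]. On
   the left [a > 0], and [k = 0] serves; on the right the last term has the wrong sign, and the
   reflected inequality holds with [k = 1/Rs]. As [R'] has no meaningful value at the crossing, each
   half is posed on an open half-line, and the equation is always written for the flux. *)
Require Import Defs.
From HB Require Import structures.
From mathcomp Require Import all_boot all_order all_algebra.
From mathcomp Require Import all_classical all_reals all_analysis.
From mathcomp Require Import measurable_realfun ring lra.

Import Order.TTheory GRing.Theory Num.Theory.
Import numFieldNormedType.Exports.

Local Open Scope ring_scope.
Local Open Scope classical_set_scope.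

Set Implicit Arguments.
Unset Strict Implicit.
Unset Printing Implicit Defensive.

(** * Pointwise differential calculus *)

Section Calculus.
Context {K : realType}.
Implicit Types (f g F : K -> K) (a b x y l : K).

(* [is_derive] is a type class: behind this alias, premises are never discharged
   by instance search, which would choose the form of the derivative. *)
Definition is_der x f a : Prop := is_derive x 1 f a.

Lemma der_eq f x a b : is_der x f a -> a = b -> is_der x f b.
Proof. by move=> df <-. Qed.

Lemma derD f g x a b : is_der x f a -> is_der x g b ->
  is_der x (fun y => f y + g y) (a + b).
Proof. by move=> df dg; exact: is_deriveD. Qed.

Lemma derN f x a : is_der x f a -> is_der x (fun y => - f y) (- a).
Proof. by move=> df; exact: is_deriveN. Qed.

Lemma derM f g x a b : is_der x f a -> is_der x g b ->
  is_der x (fun y => f y * g y) (a * g x + f x * b).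
Proof.
move=> df dg; apply: (der_eq (is_deriveM df dg)).
by rewrite addrC [g x *: a]mulrC.
Qed.

Lemma derV f x a : f x != 0 -> is_der x f a ->
  is_der x (fun y => (f y)^-1) (- a / f x ^+ 2).
Proof.
move=> fx df; apply: (der_eq (is_deriveV fx df)).
by rewrite [LHS]mulNr [in LHS]mulrC mulNr.
Qed.

Lemma derX f x a n : is_der x f a ->
  is_der x (fun y => f y ^+ n) (n%:R * f x ^+ n.-1 * a).
Proof.
move=> df; have := @is_deriveX _ _ f n x 1 a df.
by rewrite (_ : f ^+ n = fun y => f y ^+ n)//; apply/funext => y; rewrite exprfctE.
Qed.

Lemma der_cst (k : K) x : is_der x (fun=> k) 0.
Proof. exact: is_derive_cst. Qed.

Lemma der_id x : is_der x (fun y : K => y) 1.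
Proof. exact: is_derive_id. Qed.

Lemma der_comp f g x a b : is_der (g x) f a -> is_der x g b ->
  is_der x (fun y => f (g y)) (a * b).
Proof. by move=> df dg; exact: (is_derive1_comp df dg). Qed.

Lemma der_exp f x a : is_der x f a ->
  is_der x (fun y => expR (f y)) (expR (f x) * a).
Proof. by apply: der_comp; exact: is_derive_expR. Qed.

Lemma der_ln f x a : 0 < f x -> is_der x f a ->
  is_der x (fun y => ln (f y)) ((f x)^-1 * a).
Proof. by move=> fx; apply: der_comp; exact: is_derive1_ln. Qed.

Lemma is_der_E f x a : is_der x f a -> f^`() x = a.
Proof. by case=> _ <-; rewrite derive1E. Qed.

Lemma derivable_is_der f x : derivable f x 1 -> is_der x f (derive1 f x).
Proof. by move=> df; rewrite derive1E; apply: DeriveDef. Qed.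

Lemma is_der_cont f x a : is_der x f a -> {for x, continuous f}.
Proof. by case=> /derivable1_diffP df _; exact: differentiable_continuous. Qed.

Lemma is_der_derivable f x a : is_der x f a -> derivable f x 1.
Proof. by case. Qed.

Lemma near_eq_der f g x a : (\forall y \near x, f y = g y) ->
  is_der x f a -> is_der x g a.
Proof. exact: near_eq_is_derive. Qed.

Lemma within_cont f a b : (forall x, a <= x <= b -> {for x, continuous f}) ->
  {within `[a, b], continuous f}.
Proof.
by move=> fc; apply: continuous_in_subspaceT => x /set_mem; rewrite /= in_itv /=; exact: fc.
Qed.

Lemma der_mvt f (df : K -> K) a b : a < b ->
  (forall x, a < x < b -> is_der x f (df x)) ->
  {within `[a, b], continuous f} ->
  exists2 z, a < z < b & f b - f a = df z * (b - a).
Proof.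
move=> ab fd fc; have [z zab zE] := @MVT _ f df a b ab fd fc.
by exists z => //; move: zab; rewrite in_itv.
Qed.

Lemma der_ge0_le f (df : K -> K) a b : a <= b ->
  (forall x, a <= x <= b -> is_der x f (df x)) ->
  (forall x, a <= x <= b -> 0 <= df x) -> f a <= f b.
Proof.
rewrite le_eqVlt => /predU1P[->//|ab] fd df0.
have [||z zab zE] := @der_mvt f df a b ab.
- by move=> x /andP[/ltW ax /ltW xb]; apply: fd; rewrite ax.
- by apply: within_cont => x xab; exact: is_der_cont (fd _ xab).
rewrite -subr_ge0 zE mulr_ge0 ?subr_ge0 ?(ltW ab)// df0//.
by case/andP: zab => /ltW -> /ltW ->.
Qed.

Lemma der_le0_ge f (df : K -> K) a b : a <= b ->
  (forall x, a <= x <= b -> is_der x f (df x)) ->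
  (forall x, a <= x <= b -> df x <= 0) -> f b <= f a.
Proof.
move=> ab fd df0; rewrite -lerN2.
apply: (@der_ge0_le (fun y => - f y) (fun y => - df y)) => // x xab.
  by apply: derN; exact: fd.
by rewrite oppr_ge0 df0.
Qed.

Lemma der_gt0_lt f (df : K -> K) a b : a < b ->
  (forall x, a <= x <= b -> is_der x f (df x)) ->
  (forall x, a < x < b -> 0 < df x) -> f a < f b.
Proof.
move=> ab fd df0; have [||z zab zE] := @der_mvt f df a b ab.
- by move=> x /andP[/ltW ax /ltW xb]; apply: fd; rewrite ax.
- by apply: within_cont => x xab; exact: is_der_cont (fd _ xab).
by rewrite -subr_gt0 zE mulr_gt0 ?subr_gt0 ?df0.
Qed.

Lemma der_eq0_cst f a b : a <= b ->
  (forall x, a <= x <= b -> is_der x f 0) -> f a = f b.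
Proof.
move=> ab fd; apply/le_anti/andP; split.
  by apply: (@der_ge0_le f (fun=> 0)).
exact: (@der_le0_ge f (fun=> 0)).
Qed.

Local Notation mu := (@lebesgue_measure K).

Lemma continuous_itv_integrable f a b :
  (forall x, a <= x <= b -> {for x, continuous f}) ->
  mu.-integrable `[a, b] (EFin \o f).
Proof.
move=> fc; apply: continuous_compact_integrable; first exact: segment_compact.
exact: within_cont.
Qed.

Lemma integrable_itvS f a b x y : a <= x -> y <= b ->
  mu.-integrable `[a, b] (EFin \o f) -> mu.-integrable `[x, y] (EFin \o f).
Proof.
move=> ax yb; apply: integrableS => //; apply: subset_itv; rewrite bnd_simp//.
Qed.

Lemma Rintegral_itvD f a b x y : a <= x -> x <= y -> y <= b ->
  mu.-integrable `[a, b] (EFin \o f) ->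
  \int[mu]_(t in `[a, y]) f t = \int[mu]_(t in `[a, x]) f t + \int[mu]_(t in `[x, y]) f t.
Proof.
move=> ax xy yb fi; apply/eqP; rewrite addrC -subr_eq; apply/eqP.
rewrite Rintegral_itvB ?bnd_simp//; last exact: integrable_itvS fi.
rewrite Rintegral_itv_obnd_cbnd//.
apply: (@integrableS _ _ _ mu `[x, y]) => //.
  by apply: subset_itv; rewrite bnd_simp.
exact: integrable_itvS fi.
Qed.

(** [f] may be unbounded near the ends of [D], so the integral starts at an interior point and
    carries a sign; near a given [x] it differs by a constant from an integral that starts in [D] to
    the left of both [x] and [x0]. *)
Lemma continuous_primitive f (D : set K) x0 : open D -> is_interval D -> D x0 ->
  (forall x, D x -> {for x, continuous f}) ->
  exists F, forall x, D x -> is_der x F (f x).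
Proof.
move=> oD iD Dx0 fc.
exists (fun y => if x0 <= y then \int[mu]_(t in `[x0, y]) f t
                 else - \int[mu]_(t in `[y, x0]) f t) => x Dx.
have nbr y : D y -> exists2 e, 0 < e & (D (y - e) /\ D (y + e)).
  move=> Dy; have /nbhs_ballP[e /= e0 eD] := open_nbhs_nbhs (conj oD Dy).
  exists (e / 2); first by rewrite divr_gt0.
  have e2 : `|e / 2| < e by rewrite gtr0_norm ?divr_gt0// ltr_pdivrMr// ltr_pMr// ltr1n.
  split; apply: eD; rewrite /ball /=; last first.
    by rewrite (_ : y - _ = - (e / 2)) ?normrN//; ring.
  by rewrite (_ : y - _ = e / 2)//; ring.
have [a Da ax] : exists2 a, D a & a < Num.min x x0.
  have [e e0 [De _]] := nbr (Num.min x x0) (ltac:(by case: leP)).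
  by exists (Num.min x x0 - e) => //; rewrite gtrBl.
have [u Du ux] : exists2 u, D u & Num.max x x0 < u.
  have [e e0 [_ De]] := nbr (Num.max x x0) (ltac:(by case: leP)).
  by exists (Num.max x x0 + e) => //; rewrite ltrDl.
move: ax ux; rewrite lt_min gt_max => /andP[ax ax0] /andP[xu x0u].
have fau y z : a <= y -> z <= u -> mu.-integrable `[y, z] (EFin \o f).
  move=> ay zu; apply: continuous_itv_integrable => t /andP[yt tz].
  by apply/fc/(iD a u) => //; rewrite (le_trans ay) ?(le_trans tz).
pose G y := \int[mu]_(t in `[a, y]) f t.
have GB y z : a <= y -> y <= z -> z <= u -> G z - G y = \int[mu]_(t in `[y, z]) f t.
  by move=> ay yz zu; rewrite /G (Rintegral_itvD ay yz zu (fau _ _ (lexx a) (lexx u))) addrC addKr.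
have [dG GE] := @continuous_FTC1_closed _ f a x u xu (fau a u (lexx a) (lexx u)) ax (fc _ Dx).
have dG' : is_der x (fun y => G y - G x0) (f x).
  have := derivable_is_der dG; rewrite GE => dG1.
  by apply: (der_eq (derD dG1 (der_cst _ _))); rewrite addr0.
apply: near_eq_der dG'; near=> y.
have ay : a < y by near: y; exact: lt_nbhsr.
have yu : y < u by near: y; exact: lt_nbhsl.
case: (leP x0 y) => [x0y|yx0].
  by rewrite GB// ?(ltW ay) ?(ltW ax0) ?(ltW yu).
by rewrite -GB ?opprB// ?(ltW ay) ?(ltW yx0) ?(ltW x0u).
Unshelve. all: by end_near. Qed.

End Calculus.

(** Derivatives of opaque functions are taken from the context, so they are introduced there before
    [der] is called. The value obtained is not simplified; [der_eq] followed by [ring] or [field]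
    brings it to the stated form. *)
Ltac der_step := first
  [ eassumption
  | apply: der_cst | apply: der_id
  | apply: derD | apply: derN | apply: derM | apply: derX
  | apply: der_exp | apply: derV | apply: der_ln ].
Ltac der := repeat der_step.

(** * First integral on one side of the sonic density *)

Section HalfProfile.
Context {K : realType}.

(* The subsonic-side half of the problem, [lo] being the end state and [rs] the sonic
   density; [hd_ac] is where the convexity [0 <= p''] enters. *)
Record half_data (a b c : K -> K) (l0 lo rs : K) : Prop := HalfData {
  hd_l0lo : l0 < lo;
  hd_lors : lo < rs;
  hd_a_gt0 : forall r, l0 < r < rs -> 0 < a r;
  hd_a_der : forall r, l0 < r < rs -> derivable a r 1;
  hd_b_cont : forall r, l0 < r < rs -> {for r, continuous b};
  hd_c_cont : forall r, l0 < r < rs -> {for r, continuous c};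
  hd_b_gt0 : forall r, lo < r < rs -> 0 < b r;
  hd_b_lin : exists2 B : K, 0 < B & forall r, lo <= r < rs -> b r <= B * (r - lo);
  hd_c_gt0 : exists2 c0 : K, 0 < c0 & forall r, lo < r < rs -> c0 <= c r;
  hd_a_lin : exists2 A : K, 0 < A & forall r, lo < r < rs -> a r <= A * (rs - r);
  hd_ac : exists2 k : K, 0 <= k & forall r, lo < r < rs -> derive1 a r + c r <= k * a r }.

Section FirstIntegral.
Context (a b c : K -> K) (l0 lo rs : K) (H : half_data a b c l0 lo rs).
Context (G F : K -> K).
Context (dG : forall r, l0 < r < rs -> is_der r G (2 * c r / a r)).
Context (dF : forall r, l0 < r < rs -> is_der r F (2 * a r * b r * expR (G r))).
Context (F_lo : F lo = 0).

Let itvW r : lo < r < rs -> l0 < r < rs.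
Proof. by case/andP=> h ->; rewrite (lt_trans (hd_l0lo H) h). Qed.

Let itvWc r : lo <= r < rs -> l0 < r < rs.
Proof. by case/andP=> h ->; rewrite (lt_le_trans (hd_l0lo H) h). Qed.

Lemma fi_F_gt0 r : lo < r < rs -> 0 < F r.
Proof.
move=> /andP[lor rrs]; rewrite -F_lo.
apply: (@der_gt0_lt _ F (fun r => 2 * a r * b r * expR (G r))) => // x /andP[lx xr].
  by apply/dF/itvWc; rewrite lx (le_lt_trans xr).
have xI : lo < x < rs by rewrite lx (lt_trans xr).
by rewrite !mulr_gt0 ?expR_gt0 ?(hd_b_gt0 H)// (hd_a_gt0 H) ?itvW.
Qed.

Lemma fi_F_le r s : lo < r -> r <= s -> s < rs -> F r <= F s.
Proof.
move=> lor rs' srs.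
apply: (@der_ge0_le _ F (fun r => 2 * a r * b r * expR (G r))) => // x /andP[rx xs];
  have xI : lo < x < rs by rewrite (lt_le_trans lor rx) (le_lt_trans xs srs).
  exact/dF/itvW.
by rewrite ltW// !mulr_gt0 ?expR_gt0 ?(hd_b_gt0 H)// (hd_a_gt0 H) ?itvW.
Qed.

Lemma cont_bound (f : K -> K) (u v : K) : u <= v ->
  (forall r : K, u <= r <= v -> {for r, continuous f}) ->
  exists2 M : K, 0 < M & forall r : K, u <= r <= v -> f r <= M.
Proof.
move=> uv fc; have [m mI fm] := EVT_max uv (within_cont fc).
exists (`|f m| + 1); first by rewrite ltr_wpDl.
move=> r rI; rewrite (le_trans (fm r _)) ?in_itv//.
by rewrite (le_trans (ler_norm _))// lerDl.
Qed.

(** [F'] contains the factor [b], which is at most linear at [lo], and [a e^G] is bounded near [lo]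
    because [l0 < lo] leaves room on the left. *)
Lemma fi_F_quad r1 : lo < r1 < rs ->
  exists2 C : K, 0 < C & forall r, lo <= r <= r1 -> F r <= C * (r - lo) ^+ 2.
Proof.
move=> /andP[lor1 r1rs]; have [B B0 bB] := hd_b_lin H.
have [M M0 MP] : exists2 M : K, 0 < M & forall r, lo <= r <= r1 -> 2 * a r * expR (G r) <= M.
  apply: cont_bound (ltW lor1) _ => r /andP[lr rr1].
  have rI : l0 < r < rs by apply: itvWc; rewrite lr (le_lt_trans rr1).
  have := derM (derM (der_cst 2 r) (derivable_is_der (hd_a_der H rI))) (der_exp (dG rI)).
  exact: is_der_cont.
exists (M * B) => [|r /andP[lr rr1]]; first exact: mulr_gt0.
pose f r := M * B * (r - lo) ^+ 2 - F r.
suff : f lo <= f r by rewrite /f subrr expr0n F_lo mulr0 subr0 subr_ge0.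
apply: (@der_ge0_le _ f
  (fun r => 2 * (M * B) * (r - lo) - 2 * a r * b r * expR (G r)) _ _ lr) => x /andP[lx xr].
  have xI : lo <= x < rs by rewrite lx (le_lt_trans (le_trans xr rr1)).
  have := dF (itvWc xI) => dFx.
  by apply: der_eq; [der|rewrite /=; ring].
have xI : lo <= x < rs by rewrite lx (le_lt_trans (le_trans xr rr1)).
have h1 : 2 * a x * expR (G x) <= M by apply: MP; rewrite lx (le_trans xr).
have h2 := bB _ xI.
have h3 : 0 <= 2 * a x * expR (G x).
  by rewrite ltW// !mulr_gt0 ?expR_gt0// (hd_a_gt0 H) ?itvWc.
have h4 : 0 <= x - lo by rewrite subr_ge0.
have h5 : 0 <= B * (x - lo) by rewrite mulr_ge0 ?(ltW B0).
have : 2 * a x * expR (G x) * b x <= M * (B * (x - lo)).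
  apply: le_trans (_ : 2 * a x * expR (G x) * (B * (x - lo)) <= _).
    by apply: ler_wpM2l.
  by apply: ler_wpM2r.
have : 0 <= M * (B * (x - lo)) by rewrite mulr_ge0 ?(ltW M0).
lra.
Qed.

(* Flux [a(x) x'] of a solution [x], as a function of its value [r = x]. *)
Definition fi_W r := expR ((ln (F r) - G r) / 2).

Lemma fi_W_gt0 r : 0 < fi_W r. Proof. exact: expR_gt0. Qed.

Lemma fi_W2 r : lo < r < rs -> fi_W r ^+ 2 = F r * expR (- G r).
Proof.
move=> rI; rewrite /fi_W expr2 -expRD -splitr expRD lnK// posrE.
exact: fi_F_gt0.
Qed.

(** This is the flux equation [w' = b - c v^2] divided by the velocity [v = W/a]. *)
Lemma fi_W_der r : lo < r < rs ->
  is_der r fi_W (a r * b r / fi_W r - c r * fi_W r / a r).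
Proof.
move=> rI; have rI' := itvW rI.
have := dF rI' => dFr; have := dG rI' => dGr; have F0 := fi_F_gt0 rI.
have a0 := hd_a_gt0 H rI'.
apply: der_eq.
  by apply: der_exp; apply: derM (der_cst _ _); apply: derD (derN dGr); apply: der_ln dFr.
rewrite -/(fi_W r).
(* Eliminating [e^G] in favour of [W^2] leaves a rational identity. *)
have -> : expR (G r) = F r / fi_W r ^+ 2.
  rewrite fi_W2// invfM expRN invrK mulrA mulfV ?mul1r// gt_eqF//.
have := fi_W_gt0 r => W0.
by field; rewrite !gt_eqF.
Qed.

(* Velocity [x'] of a solution, as a function of its value. *)
Definition fi_V r := fi_W r / a r.

Lemma fi_V_gt0 r : lo < r < rs -> 0 < fi_V r.
Proof. by move=> /itvW rI; rewrite divr_gt0 ?fi_W_gt0 ?(hd_a_gt0 H). Qed.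

(** [V^2 = F e^(-G) / a^2], where [F] is quadratically small at [lo] and the other factor is
    bounded, [a] being positive at [lo]. *)
Lemma fi_V_lin r1 : lo < r1 < rs ->
  exists2 L : K, 0 < L & forall r, lo < r <= r1 -> fi_V r <= L * (r - lo).
Proof.
move=> r1I; have [C C0 FC] := fi_F_quad r1I; case/andP: r1I => lor1 r1rs.
have [M M0 MP] : exists2 M : K, 0 < M & forall r, lo <= r <= r1 -> expR (- G r) / a r ^+ 2 <= M.
  apply: cont_bound (ltW lor1) _ => r /andP[lr rr1].
  have rI : l0 < r < rs by apply: itvWc; rewrite lr (le_lt_trans rr1).
  have a0 := hd_a_gt0 H rI.
  have := derM (der_exp (derN (dG rI)))
    (derV (f := fun x => a x ^+ 2) (lt0r_neq0 (exprn_gt0 2 a0))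
      (derX 2 (derivable_is_der (hd_a_der H rI)))).
  exact: is_der_cont.
(* [V^2 <= C M (r - lo)^2], and [C M <= (C M + 1)^2] spares a square root. *)
exists (C * M + 1) => [|r /andP[lr rr1]].
  by rewrite addr_gt0// mulr_gt0.
have rI : lo < r < rs by rewrite lr (le_lt_trans rr1).
have L0 : 0 < C * M by rewrite mulr_gt0.
have h4 : 0 < r - lo by rewrite subr_gt0.
rewrite -ler_sqr ?nnegrE; last 2 first.
  exact/ltW/fi_V_gt0.
  by rewrite mulr_ge0 ?(ltW h4)// addr_ge0// ltW.
rewrite /fi_V expr_div_n fi_W2// exprMn -mulrA.
apply: le_trans (_ : C * (r - lo) ^+ 2 * M <= _).
  apply: ler_pM.
  - exact/ltW/fi_F_gt0.
  - by rewrite divr_ge0 ?expR_ge0 ?sqr_ge0.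
  - by apply: FC; rewrite ltW.
  - by apply: MP; rewrite ltW.
rewrite mulrAC ler_wpM2r ?sqr_ge0//; nra.
Qed.

(* [Z = W^2] satisfies [Z' = 2ab - 2cZ/a]; since [a <= A (rs - r)], the weight
   [(rs - r)^-d] with small [d] absorbs the second term. *)
Lemma fi_W_cvg0 e : 0 < e -> exists2 r2, lo < r2 < rs &
  forall r, r2 < r < rs -> fi_W r < e.
Proof.
move=> e0; have [A A0 aA] := hd_a_lin H; have [B B0 bB] := hd_b_lin H.
have [c0 c00 cc0] := hd_c_gt0 H; have lors := hd_lors H.
(* [d <= 2 c0 / A] gives [d / (rs - r) <= 2 c / a], so the weight absorbs the singular term;
   [d <= 1] keeps [(rs - r)^(1 - d)] below 1 as soon as [rs - r <= 1], which is why [r1] lies within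
   1 of [rs]. *)
pose d := Num.min 1 (2 * c0 / A).
have d0 : 0 < d by rewrite lt_min ltr01 divr_gt0// mulr_gt0.
have d1 : d <= 1 by rewrite ge_min lexx.
have dA : d <= 2 * c0 / A by rewrite ge_min lexx orbT.
pose r1 := Num.max ((lo + rs) / 2) (rs - 1).
have r1I : lo < r1 < rs by rewrite /r1 lt_max gt_max; lra.
have r1l : rs - r1 <= 1 by rewrite lerBlDr -lerBlDl /r1 le_max lexx orbT.
pose K1 := 2 * A * (B * (rs - lo)).
have K10 : 0 < K1 by rewrite !mulr_gt0 ?subr_gt0.
pose P r := fi_W r ^+ 2 * expR (- (d * ln (rs - r))).
have PN r : r1 <= r < rs -> P r <= P r1 + K1.
  (* The weighted [Z] has derivative at most [K1], on an interval of length at most 1. *)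
  move=> /andP[r1r rrs]; pose f x := P x - K1 * x.
  suff : f r <= f r1 by rewrite /f; nra.
  pose Z' x := 2 * fi_W x * (a x * b x / fi_W x - c x * fi_W x / a x).
  apply: (@der_le0_ge _ f (fun x =>
    expR (- (d * ln (rs - x))) * (Z' x + fi_W x ^+ 2 * (d / (rs - x))) - K1) _ _ r1r) => x /andP[r1x xr].
    have xI : lo < x < rs by case/andP: r1I => /lt_le_trans -> //=; rewrite (le_lt_trans xr).
    have u0 : 0 < rs - x by rewrite subr_gt0; case/andP: xI.
    have dW := fi_W_der xI.
    apply: der_eq.
      apply: derD; last by der.
      by apply: derM; der.
    by rewrite /Z' /=; field; rewrite !gt_eqF ?fi_W_gt0 ?(hd_a_gt0 H) ?itvW.
  have xI : lo < x < rs by case/andP: r1I => /lt_le_trans -> //=; rewrite (le_lt_trans xr).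
  have u0 : 0 < rs - x by rewrite subr_gt0; case/andP: xI.
  have W0 := fi_W_gt0 x; have a0 := hd_a_gt0 H (itvW xI).
  have b1 : b x <= B * (rs - lo).
    case/andP: (xI) => /ltW lx xrs; apply: le_trans (bB _ _) _; first by rewrite lx.
    by rewrite ler_pM2l// lerB// ltW.
  have -> : Z' x = 2 * a x * b x - 2 * c x * (fi_W x ^+ 2 / a x).
    by rewrite /Z'; field; rewrite !gt_eqF.
  set Z := fi_W x ^+ 2; have Z0 : 0 < Z by rewrite exprn_gt0.
  have h1 : 2 * a x * b x <= K1 * (rs - x).
    have b0 := hd_b_gt0 H xI.
    have : a x * b x <= (A * (rs - x)) * (B * (rs - lo)).
      by apply: ler_pM => //; rewrite ?aA// ltW.
    by rewrite /K1; nra.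
  have h2 : Z * (d / (rs - x)) <= 2 * c x * (Z / a x).
    rewrite [leRHS](_ : _ = Z * (2 * c x / a x)); last by rewrite mulrCA mulrA mulrA.
    rewrite ler_pM2l// ler_pdivrMr// mulrAC ler_pdivlMr//.
    have := aA _ xI; have := cc0 _ xI; move: dA; rewrite ler_pdivlMr// => dA cx ax.
    apply: le_trans (_ : d * (A * (rs - x)) <= _); first by rewrite ler_pM2l.
    by rewrite mulrA ler_pM2r// (le_trans dA)// ler_pM2l.
  set E := expR _; have E0 : 0 < E by exact: expR_gt0.
  have h3 : E * (rs - x) <= 1.
    rewrite /E -{2}(@lnK _ (rs - x)) ?posrE// -expRD -expR0 ler_expR.
    rewrite -{2}[ln _]mul1r -mulNr -mulrDl.
    have : ln (rs - x) <= 0 by apply: ln_le0; lra.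
    by nra.
  have h4 : 2 * a x * b x - 2 * c x * (Z / a x) + Z * (d / (rs - x)) <= K1 * (rs - x) by lra.
  have : E * (2 * a x * b x - 2 * c x * (Z / a x) + Z * (d / (rs - x))) <= E * (K1 * (rs - x)).
    by rewrite ler_pM2l.
  have : K1 * (E * (rs - x)) <= K1 * 1 by rewrite ler_pM2l.
  by lra.
pose N := P r1 + K1.
have N0 : 0 < N by rewrite addr_gt0// mulr_gt0 ?expR_gt0 ?exprn_gt0 ?fi_W_gt0.
(* [u0] solves [N u0^d = e^2]; the bound [W^2 <= N (rs - r)^d] is below [e^2] for [rs - r < u0]. *)
pose u0 := expR (ln (e ^+ 2 / N) / d).
have q0 : 0 < e ^+ 2 / N by rewrite divr_gt0 ?exprn_gt0.
exists (Num.max r1 (rs - u0)).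
  case/andP: r1I => h1 h2; rewrite lt_max h1/= gt_max h2/=.
  by rewrite gtrBl expR_gt0.
move=> r; rewrite gt_max => /andP[/andP[r1r ur] rrs].
have v0 : 0 < rs - r by rewrite subr_gt0.
have W0 := fi_W_gt0 r.
rewrite -ltr_sqr ?nnegrE ?(ltW e0) ?(ltW W0)//.
have := PN r; rewrite (ltW r1r) rrs => /(_ isT); rewrite -/N /P => PN'.
have h : expR (d * ln (rs - r)) < e ^+ 2 / N.
  rewrite -[ltRHS]lnK ?posrE// ltr_expR mulrC -ltr_pdivlMr//.
  by rewrite -ltr_expR lnK ?posrE//; rewrite -/u0; lra.
have E0 := expR_gt0 (d * ln (rs - r)).
apply: le_lt_trans (_ : N * expR (d * ln (rs - r)) < _).
  by move: PN'; rewrite expRN ler_pdivrMr.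
by rewrite mulrC -ltr_pdivlMr.
Qed.

(* [T] is finite at [rs] because [a e^(G/2) e^(-kr)] is nonincreasing by [hd_ac], and
   infinite at [lo] because [V] is at most linear there. *)
Lemma fi_T : exists T, [/\
  forall r, lo < r < rs -> is_der r T (fi_V r)^-1,
  forall r, lo < r < rs -> T r < 0,
  forall e, 0 < e -> exists2 r, lo < r < rs & - e < T r &
  forall M, exists2 r, lo < r < rs & T r < M].
Proof.
have lors := hd_lors H.
have V_cont r : lo < r < rs -> {for r, continuous (fun r => (fi_V r)^-1)}.
  move=> rI; have dW := fi_W_der rI.
  have da := derivable_is_der (hd_a_der H (itvW rI)).
  have a0 : a r != 0 by rewrite gt_eqF// (hd_a_gt0 H)// itvW.
  have V0 : fi_W r / a r != 0 by have := fi_V_gt0 rI; rewrite /fi_V; case: ltgtP.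
  exact: (is_der_cont (derV (f := fi_V) V0 (derM dW (derV a0 da)))).
pose r0 := (lo + rs) / 2.
have r0I : lo < r0 < rs by rewrite /r0; lra.
have [T dT] : exists T, forall r, lo < r < rs -> is_der r T (fi_V r)^-1.
  have [||||T dT] := @continuous_primitive _ (fun r => (fi_V r)^-1) `]lo, rs[ r0.
  - exact: interval_open.
  - move=> x y; rewrite /= !in_itv/= => /andP[lx _] /andP[_ yr] z /andP[xz zy].
    by rewrite in_itv /= (lt_le_trans lx)// (le_lt_trans zy).
  - by rewrite /= in_itv.
  - by move=> x; rewrite /= in_itv; exact: V_cont.
  by exists T => r rI; apply: dT; rewrite /= in_itv.
have T_lt r s : lo < r -> r < s -> s < rs -> T r < T s.
  move=> lr rs' srs; apply: (@der_gt0_lt _ T (fun r => (fi_V r)^-1)) => // x /andP[rx xs].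
    by apply: dT; rewrite (lt_le_trans lr) ?(le_lt_trans xs).
  by rewrite invr_gt0 fi_V_gt0// (lt_trans lr)//(lt_trans xs).
have T_le r s : lo < r -> r <= s -> s < rs -> T r <= T s.
  by move=> lr; rewrite le_eqVlt => /predU1P[->//|rs'] /(T_lt _ _ lr rs')/ltW.
have [M' M'0 VM] : exists2 M' : K, 0 < M' & forall r, r0 <= r < rs -> (fi_V r)^-1 <= M'.
  have [k k0 ack] := hd_ac H.
  (* Since [a G'/2 = c], the derivative of [Q] has the sign of [a' + c - k a]. *)
  pose Q r := a r * expR (G r / 2) * expR (- (k * r)).
  have Q0 r : lo < r < rs -> 0 < Q r.
    by move=> rI; rewrite !mulr_gt0 ?expR_gt0// (hd_a_gt0 H)// itvW.
  have QQ r : r0 <= r < rs -> Q r <= Q r0.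
    move=> /andP[r0r rrs].
    apply: (@der_le0_ge _ Q (fun x => expR (G x / 2) * expR (- (k * x)) *
        (derive1 a x + c x - k * a x)) _ _ r0r) => x /andP[r0x xr];
      have xI : lo < x < rs by case/andP: r0I => /lt_le_trans -> //=; rewrite (le_lt_trans xr).
      have da := derivable_is_der (hd_a_der H (itvW xI)).
      have dGx := dG (itvW xI); have a0 := hd_a_gt0 H (itvW xI).
      apply: der_eq; first by rewrite /Q; der.
      by rewrite /=; field; rewrite gt_eqF.
    by rewrite mulr_ge0_le0 ?mulr_ge0 ?expR_ge0// subr_le0 ack.
  (* [1/V = Q e^(kr) F^(-1/2)]: to the right of [r0], [Q] and [F^(-1/2)] are at most their values at
     [r0], and [e^(kr)] is at most its value at [rs]. *)
  exists (Q r0 * expR (k * rs) * expR (- (ln (F r0) / 2))).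
    by apply: mulr_gt0; [apply: mulr_gt0; first exact: Q0|]; exact: expR_gt0.
  move=> r rI; have rI' : lo < r < rs.
    by case/andP: rI => r0r rrs; case/andP: r0I => /lt_le_trans -> //=.
  rewrite /fi_V invf_div /fi_W -expRN.
  have -> : - ((ln (F r) - G r) / 2) = G r / 2 + (- (k * r)) + (k * r - ln (F r) / 2).
    by field.
  rewrite !expRD !mulrA -/(Q r) -2!mulrA; apply: ler_pM; [exact/ltW/Q0|by rewrite mulr_ge0 ?expR_ge0|exact: QQ|].
  rewrite -!expRD ler_expR lerD//.
    by case/andP: rI' => _ rrs; rewrite ler_wpM2l// ltW.
  rewrite lerN2 ler_pM2r// ler_ln ?posrE ?fi_F_gt0//.
  by case/andP: rI => r0r rrs; case/andP: r0I => h _; rewrite fi_F_le.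
have T_bd r : lo < r < rs -> T r <= T r0 + M' * (rs - r0).
  move=> /andP[lr rrs]; case/andP: (r0I) => lr0 r0rs.
  have [rr0|r0r] := leP r r0.
    by rewrite (le_trans (T_le _ _ lr rr0 r0rs))// lerDl mulr_ge0 ?subr_ge0 ?ltW.
  have h : T r - M' * r <= T r0 - M' * r0.
    pose f x := T x - M' * x.
    apply: (@der_le0_ge _ f (fun x => (fi_V x)^-1 - M') _ _ (ltW r0r)) => x /andP[r0x xr].
      have := dT x; rewrite (lt_le_trans lr0 r0x) (le_lt_trans xr rrs) => /(_ isT) dTx.
      by rewrite /f; apply: der_eq; [der|rewrite /=; ring].
    by rewrite subr_le0 VM// r0x (le_lt_trans xr).
  have : M' * r <= M' * rs by rewrite ler_pM2l// ltW.
  lra.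
pose E := [set T r | r in [set r | lo < r < rs]].
have supE : has_sup E.
  split; first by exists (T r0), r0.
  by exists (T r0 + M' * (rs - r0)) => _ [r rI <-]; exact: T_bd.
(* Normalization: the sonic density is reached at time 0. *)
exists (fun r => T r - sup E); split.
- by move=> r rI; have dTr := dT _ rI; apply: der_eq; [der|ring].
- move=> r /andP[lr rrs]; rewrite subr_lt0.
  have h : r < (r + rs) / 2 < rs by lra.
  case/andP: h => h1 h2; apply: lt_le_trans (T_lt _ _ lr h1 h2) _.
  by apply: ub_le_sup; [case: supE|exists ((r + rs) / 2) => //=; rewrite (lt_trans lr)].
- move=> e e0; have [_ [r rI <-] h] := sup_adherent e0 supE.
  by exists r => //; rewrite ltrBrDr addrC.
move=> M; have [L L0 VL] := fi_V_lin r0I.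
case/andP: (r0I) => lr0 r0rs.
pose N := T r0 - sup E - M + 1.
(* [1/V >= 1/(L (x - lo))] makes [f] nondecreasing, so [T] diverges at [lo] at least as fast as a
   logarithm. *)
pose f x := T x - L^-1 * ln (x - lo).
have fP r : lo < r -> r <= r0 -> f r <= f r0.
  move=> lr rr0; apply: (@der_ge0_le _ f (fun x => (fi_V x)^-1 - L^-1 / (x - lo)) _ _ rr0).
    move=> x /andP[rx xr0]; have xlo : 0 < x - lo by rewrite subr_gt0 (lt_le_trans lr).
    have dTx : is_der x T (fi_V x)^-1 by apply: dT; lra.
    by rewrite /f; apply: der_eq; [der|rewrite /=; ring].
  move=> x /andP[rx xr0]; have lx := lt_le_trans lr rx.
  have Vx : 0 < fi_V x by apply: fi_V_gt0; rewrite lx (le_lt_trans xr0).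
  have Lx : 0 < L * (x - lo) by rewrite mulr_gt0// subr_gt0.
  by rewrite subr_ge0 -invfM lef_pV2 ?posrE// VL// lx.
(* From [r0 - lo] down to [u] the logarithm drops by [L |N|], hence [T] drops by at least [|N|]. *)
pose u := expR (ln (r0 - lo) - L * (`|N|)).
have u0 : 0 < u by exact: expR_gt0.
have ur : u <= r0 - lo.
  rewrite -[leRHS]lnK ?posrE ?subr_gt0// ler_expR gerBl.
  by apply: mulr_ge0; [exact: ltW|exact: normr_ge0].
exists (lo + u); first by lra.
have := fP (lo + u); rewrite /f ltrDl u0 => /(_ isT).
have -> : lo + u <= r0 by lra.
move=> /(_ isT); rewrite [lo + u - lo]addrC addKr /u expRK.
rewrite mulrBr mulrA mulVf ?gt_eqF// mul1r.
have := ler_norm N; rewrite {1}/N; lra.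
Qed.

End FirstIntegral.
End HalfProfile.

(** * Solutions on one side of the sonic density *)

Section HalfSolution.
Context {K : realType}.

(** The equation is imposed on the flux, the form in which a weak profile satisfies it, and only
    before [t], where [x'] may blow up. The value [lo] is permitted a priori; that it is never taken
    is a consequence. *)
Record half_sol (a b c : K -> K) (lo rs : K) (x : K -> K) (t : K) : Prop := HalfSol {
  hs_itv : forall s, s < t -> lo <= x s < rs;
  hs_der : forall s, s < t -> derivable x s 1;
  hs_ge0 : forall s, s < t -> 0 <= derive1 x s;
  hs_flux : forall s, s < t -> is_der s (fun z => a (x z) * derive1 x z)
    (b (x s) - c (x s) * derive1 x s ^+ 2);
  hs_Ny : x s @[s --> -oo] --> lo;
  hs_left : x s @[s --> t^'-] --> rs }.

Section Uniqueness.
Context (a b c : K -> K) (l0 lo rs : K) (H : half_data a b c l0 lo rs).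
Context (G F : K -> K).
Context (dG : forall r, l0 < r < rs -> is_der r G (2 * c r / a r)).
Context (dF : forall r, l0 < r < rs -> is_der r F (2 * a r * b r * expR (G r))).
Context (F_lo : F lo = 0).
Context (x : K -> K) (t : K) (S : half_sol a b c lo rs x t).

Let V := fi_V a G F.
Let W := fi_W G F.

Let itvWc r : lo <= r < rs -> l0 < r < rs.
Proof. by case/andP=> h ->; rewrite (lt_le_trans (hd_l0lo H) h). Qed.

Let x_der s : s < t -> is_der s x (derive1 x s).
Proof. by move=> /(hs_der S)/derivable_is_der. Qed.

Lemma half_sol_mono s z : s <= z -> z < t -> x s <= x z.
Proof.
move=> sz zt; apply: (@der_ge0_le _ x (derive1 x) _ _ sz) => y /andP[sy yz].
  by apply: x_der; rewrite (le_lt_trans yz).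
by apply: (hs_ge0 S); rewrite (le_lt_trans yz).
Qed.

Lemma half_sol_ge_near r : r < rs -> exists2 s, s < t & forall z, s < z < t -> r < x z.
Proof.
move=> rrs; have := hs_left S => /cvgrPdist_lt /(_ (rs - r)).
rewrite subr_gt0 => /(_ rrs) [e /= e0 He]; exists (t - e); first by rewrite gtrBl.
move=> z /andP[tz zt]; have := He z; rewrite /ball_ /= => /(_ _ zt).
rewrite gtr0_norm ?subr_gt0// ltrBlDr -ltrBlDl => /(_ tz).
by move=> /(le_lt_trans (ler_norm _)) h; lra.
Qed.

Lemma half_sol_le_near r : lo < r -> exists2 s, s < t & forall z, z <= s -> x z < r.
Proof.
move=> lor; have := hs_Ny S => /cvgrPdist_lt /(_ (r - lo)).
rewrite subr_gt0 => /(_ lor) [M [_ HM]]; exists (Num.min (M - 1) (t - 1)).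
  by rewrite gt_min [t - 1 < t]gtrBl ltr01 orbT.
move=> z; rewrite le_min => /andP[zM zt].
have := HM z => /(_ _)/=; rewrite distrC => HMz.
have : `|x z - lo| < r - lo by apply: HMz; lra.
by move=> /(le_lt_trans (ler_norm _)) h; lra.
Qed.

(** The equations for [G] and [F] make the difference of the two sides constant. It is zero because
    [x] tends to [lo] at minus infinity: the mean value theorem on unit intervals far to the left
    gives points where [x - lo] and [x'] are both small. Nothing is divided by [x'], so the identity
    also holds where [x = lo]. *)
Lemma half_sol_first_integral s : s < t ->
  (a (x s) * derive1 x s) ^+ 2 * expR (G (x s)) = F (x s).
Proof.
move=> st; pose E s := (a (x s) * derive1 x s) ^+ 2 * expR (G (x s)) - F (x s).
have EC s1 s2 : s1 <= s2 -> s2 < t -> E s1 = E s2.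
  move=> s12 s2t; apply: (@der_eq0_cst _ E _ _ s12) => y /andP[_ ys2].
  have yt := le_lt_trans ys2 s2t; have xI := itvWc (hs_itv S yt).
  have dx := x_der yt; have dw := hs_flux S yt.
  have dFx := der_comp (dF xI) dx; have dGx := der_comp (dG xI) dx.
  have a0 := hd_a_gt0 H xI.
  rewrite /E; apply: der_eq.
    apply: derD (derM (derX 2 dw) (der_exp dGx)) (derN dFx).
  by rewrite /=; field; rewrite gt_eqF.
have lors := hd_lors H; pose r1 := (lo + rs) / 2; have r1I : lo < r1 < rs by rewrite /r1; lra.
have [C C0 FC] := fi_F_quad H dG dF F_lo r1I.
have [M M0 MP] : exists2 M : K, 0 < M & forall r, lo <= r <= r1 -> a r ^+ 2 * expR (G r) <= M.
  case/andP: r1I => lor1 r1rs.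
  apply: cont_bound (ltW lor1) _ => r /andP[lr rr1].
  have rI : l0 < r < rs by apply: itvWc; rewrite lr (le_lt_trans rr1).
  exact: (is_der_cont (derM (derX 2 (derivable_is_der (hd_a_der H rI))) (der_exp (dG rI)))).
have small e : 0 < e -> `|E s| <= (M + C) * e ^+ 2.
  move=> e0.
  have [|s1 s1t s1P] := @half_sol_le_near (Num.min r1 (lo + e)).
    by rewrite lt_min ltrDl e0 andbT; case/andP: r1I.
  pose s2 := Num.min s1 s.
  have s2s1 : s2 <= s1 by rewrite ge_min lexx.
  have s2s : s2 <= s by rewrite ge_min lexx orbT.
  have s2t : s2 < t by rewrite (le_lt_trans s2s).
  have s21 : s2 - 1 < s2 by rewrite gtrBl.
  have [||z /andP[sz zs] zE] := @der_mvt _ x (derive1 x) (s2 - 1) s2 s21.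
  - by move=> y /andP[_ ys]; apply: x_der; rewrite (lt_trans ys).
  - by apply: within_cont => y /andP[_ ys]; apply: is_der_cont (x_der (le_lt_trans ys s2t)).
  have zt : z < t by rewrite (lt_trans zs).
  rewrite -(EC z s (ltW (lt_le_trans zs s2s)) st) /E.
  have v0 := hs_ge0 S zt.
  have ve : derive1 x z <= e.
    move: zE; rewrite opprB addrCA subrr addr0 mulr1 => <-.
    have := s1P _ s2s1; rewrite lt_min => /andP[_ h].
    by have /andP[] := hs_itv S (lt_trans s21 s2t); lra.
  have := s1P _ (le_trans (ltW zs) s2s1); rewrite lt_min => /andP[xr1 xe].
  have /andP[xlo xrs] := hs_itv S zt.
  have F0 : 0 <= F (x z).
    move: xlo; rewrite le_eqVlt => /predU1P[<-|xlo]; first by rewrite F_lo.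
    by apply/ltW/(fi_F_gt0 H dF F_lo); rewrite xlo.
  have FP : F (x z) <= C * e ^+ 2.
    apply: le_trans (FC _ _) _; first by rewrite xlo ltW.
    by rewrite ler_pM2l// ler_sqr ?nnegrE ?subr_ge0// ?ltW//; lra.
  have AP : a (x z) ^+ 2 * expR (G (x z)) <= M by apply: MP; rewrite xlo ltW.
  have A0 : 0 <= a (x z) ^+ 2 * expR (G (x z)) by rewrite mulr_ge0 ?sqr_ge0 ?expR_ge0.
  have -> : (a (x z) * derive1 x z) ^+ 2 * expR (G (x z)) =
      a (x z) ^+ 2 * expR (G (x z)) * derive1 x z ^+ 2 by ring.
  have P2 : a (x z) ^+ 2 * expR (G (x z)) * derive1 x z ^+ 2 <= M * e ^+ 2.
    by apply: ler_pM; rewrite ?sqr_ge0// ler_sqr ?nnegrE// ltW.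
  have P1 : 0 <= a (x z) ^+ 2 * expR (G (x z)) * derive1 x z ^+ 2.
    by rewrite mulr_ge0 ?sqr_ge0.
  have : 0 <= C * e ^+ 2 by rewrite mulr_ge0 ?sqr_ge0 ?ltW.
  have : 0 <= M * e ^+ 2 by rewrite mulr_ge0 ?sqr_ge0 ?ltW.
  by rewrite ler_norml; lra.
apply/eqP; rewrite -subr_eq0 -/(E s) -normr_eq0 eq_le normr_ge0 andbT.
apply/ler_addgt0Pr => e e0; rewrite add0r.
have N0 : 0 < M + C by rewrite addr_gt0.
have q0 : 0 < e / (M + C) by rewrite divr_gt0.
apply: le_trans (small (Num.sqrt (e / (M + C))) _) _; first by rewrite sqrtr_gt0.
rewrite sqr_sqrtr; last exact: ltW.
by rewrite mulrC divfK// gt_eqF.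
Qed.

(** The signs [a > 0] and [x' >= 0] select the positive root of the first integral. *)
Lemma half_sol_flux s : s < t -> lo < x s -> a (x s) * derive1 x s = W (x s).
Proof.
move=> st xlo; have xI := hs_itv S st.
have a0 := hd_a_gt0 H (itvWc xI).
have v0 := hs_ge0 S st; have W0 := fi_W_gt0 G F (x s).
apply: (@pexpIrn _ 2) => //; rewrite ?nnegrE ?(ltW W0) ?mulr_ge0 ?(ltW a0)//.
rewrite (@fi_W2 _ _ _ _ _ _ _ H _ _ dF F_lo); last by rewrite xlo; case/andP: xI.
by rewrite -half_sol_first_integral// -mulrA -expRD subrr expR0 mulr1.
Qed.

Lemma half_sol_velocity s : s < t -> lo < x s -> derive1 x s = V (x s).
Proof.
move=> st xlo; have a0 := hd_a_gt0 H (itvWc (hs_itv S st)).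
by rewrite /V /fi_V -/W -half_sol_flux// mulrAC mulfV ?mul1r// gt_eqF.
Qed.

(* Gronwall: [V] is at most linear at [lo], so [lo] cannot be left in finite time. *)
Lemma half_sol_gt s : s < t -> lo < x s.
Proof.
move=> st; have lors := hd_lors H.
have /andP[] := hs_itv S st; rewrite le_eqVlt => /predU1P[xlo _|//].
pose r1 := (lo + rs) / 2; have r1I : lo < r1 < rs by rewrite /r1; lra.
have [L L0 VL] := fi_V_lin H dG dF F_lo r1I; case/andP: r1I => lor1 r1rs.
have [s1 s1t s1P] := half_sol_ge_near r1rs.
pose s2 := (Num.max s s1 + t) / 2.
have s2I : Num.max s s1 < s2 < t.
  have : Num.max s s1 < t by rewrite gt_max st.
  by rewrite /s2; lra.
move: s2I; rewrite gt_max => /andP[/andP[ss2 s1s2] s2t].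
have r1x : r1 < x s2 by apply: s1P; rewrite s1s2.
have [||z zI zE] := @IVT _ x s s2 r1 (ltW ss2).
- by apply: within_cont => y /andP[_ ys]; exact: is_der_cont (x_der (le_lt_trans ys s2t)).
- by rewrite -xlo ge_min (ltW lor1)/= le_max (ltW r1x) orbT.
move: zI; rewrite in_itv /= => /andP[sz zs2]; have zt := le_lt_trans zs2 s2t.
pose h y := (x y - lo) * expR (- (L * y)).
have : h z <= h s.
  apply: (@der_le0_ge _ h (fun y => (derive1 x y - L * (x y - lo)) * expR (- (L * y))) _ _ sz) => y /andP[sy yz].
    have dx := x_der (le_lt_trans yz zt).
    by rewrite /h; apply: der_eq; [der|rewrite /=; ring].
  have yt := le_lt_trans yz zt.
  rewrite mulr_le0_ge0 ?expR_ge0// subr_le0.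
  have yr1 : x y <= r1 by rewrite -zE half_sol_mono.
  have /andP[] := hs_itv S yt; rewrite le_eqVlt => /predU1P[ylo _|ylo yrs].
    have := half_sol_first_integral yt; rewrite -ylo F_lo subrr mulr0.
    move/eqP; rewrite mulf_eq0 (gt_eqF (expR_gt0 _)) orbF sqrf_eq0 mulf_eq0.
    have alo : 0 < a lo by rewrite xlo; exact: (hd_a_gt0 H (itvWc (hs_itv S st))).
    by rewrite (gt_eqF alo)/= => /eqP ->.
  by rewrite half_sol_velocity// VL// ylo.
rewrite /h -xlo subrr mul0r zE leNgt mulr_gt0 ?expR_gt0 ?subr_gt0//.
Qed.

(** This one-sided limit is what later makes the flux continuous across the crossing. *)
Lemma half_sol_flux_cvg0 : a (x s) * derive1 x s @[s --> t^'-] --> 0.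
Proof.
apply/cvgrPdist_lt => e e0; have [r2 /andP[lor2 r2rs] r2P] := fi_W_cvg0 H dG dF F_lo e0.
have [s1 s1t s1P] := half_sol_ge_near r2rs.
near=> s; have st : s < t by near: s; exact: nbhs_left_lt.
have s1s : s1 < s by near: s; exact: nbhs_left_gt.
rewrite sub0r normrN half_sol_flux// ?half_sol_gt// gtr0_norm ?fi_W_gt0//.
by apply: r2P; rewrite s1P ?s1s//; case/andP: (hs_itv S st).
Unshelve. all: by end_near. Qed.

(** [T(x(s)) - s] is constant because [x' = V(x)]. A constant above [-t] would make [T] nonnegative
    before time [t]; a constant below [-t] would keep [T] away from 0 although [x] tends to [rs]. *)
Lemma half_sol_T (T : K -> K) :
  (forall r, lo < r < rs -> is_der r T (V r)^-1) ->
  (forall r, lo < r < rs -> T r < 0) ->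
  (forall e, 0 < e -> exists2 r, lo < r < rs & - e < T r) ->
  forall s, s < t -> T (x s) = s - t.
Proof.
move=> dT T0 Te.
have xI s : s < t -> lo < x s < rs.
  by move=> st; rewrite half_sol_gt//; case/andP: (hs_itv S st).
pose h s := T (x s) - s.
have hC s1 s2 : s1 <= s2 -> s2 < t -> h s1 = h s2.
  move=> s12 s2t; apply: (@der_eq0_cst _ h _ _ s12) => y /andP[_ ys2].
  have yt := le_lt_trans ys2 s2t.
  have dTx := der_comp (dT _ (xI _ yt)) (x_der yt).
  rewrite /h; apply: der_eq; first by der.
  by rewrite half_sol_velocity ?half_sol_gt// mulVf ?subrr// gt_eqF// (fi_V_gt0 H)// xI.
have T_le r s : lo < r -> r <= s -> s < rs -> T r <= T s.
  move=> lr rs' srs; apply: (@der_ge0_le _ T (fun r => (V r)^-1) _ _ rs') => y /andP[ry ys].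
    by apply: dT; rewrite (lt_le_trans lr) ?(le_lt_trans ys).
  by rewrite invr_ge0 ltW// (fi_V_gt0 H)// (lt_le_trans lr)// (le_lt_trans ys).
move=> s st; apply/eqP; rewrite -subr_eq0 opprB addrA.
have -> : T (x s) + t - s = h s + t by rewrite /h; ring.
have hlt z : z < t -> h s = h z.
  by move=> zt; case: (leP s z) => [/hC->//|/ltW/hC <-].
apply/eqP/le_anti/andP; split; rewrite leNgt; apply/negP => h0.
  pose z := Num.max s (- h s); have zt : z < t by rewrite gt_max st; lra.
  have := T0 _ (xI _ zt); have : - h s <= z by rewrite le_max lexx orbT.
  by rewrite (hlt _ zt) /h; lra.
have [|r /andP[lor rrs] rT] := Te (- (h s + t)); first by rewrite oppr_gt0.
have [s1 s1t s1P] := half_sol_ge_near rrs.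
pose z := (s1 + t) / 2; have zI : s1 < z < t by rewrite /z; lra.
have zt : z < t by case/andP: zI.
have := T_le _ _ lor (ltW (s1P _ zI)); case/andP: (xI _ zt) => _ -> /(_ isT).
by move: rT; rewrite opprK (hlt _ zt) /h; lra.
Qed.

End Uniqueness.

Lemma half_data_primitives (a b c : K -> K) (l0 lo rs : K) :
  half_data a b c l0 lo rs -> exists G F,
  [/\ forall r, l0 < r < rs -> is_der r G (2 * c r / a r),
      forall r, l0 < r < rs -> is_der r F (2 * a r * b r * expR (G r)) & F lo = 0].
Proof.
move=> H.
have prim f : (forall r : K, l0 < r < rs -> {for r, continuous f}) ->
    exists P, forall r : K, l0 < r < rs -> is_der r P (f r).
  move=> fc; have [||||P dP] := @continuous_primitive _ f `]l0, rs[ lo.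
  - exact: interval_open.
  - move=> x y; rewrite /= !in_itv/= => /andP[lx _] /andP[_ yr] z /andP[xz zy].
    by rewrite in_itv /= (lt_le_trans lx)// (le_lt_trans zy).
  - by rewrite /= in_itv /= (hd_l0lo H) (hd_lors H).
  - by move=> x; rewrite /= in_itv; exact: fc.
  by exists P => r rI; apply: dP; rewrite /= in_itv.
have ac r : l0 < r < rs -> {for r, continuous a}.
  by move=> /(hd_a_der H)/derivable_is_der/is_der_cont.
have [G dG] : exists G, forall r, l0 < r < rs -> is_der r G (2 * c r / a r).
  apply: prim => r rI; apply: cvgM.
    by apply: cvgM; [exact: cvg_cst|exact: (hd_c_cont H)].
  by apply: cvgV; [rewrite gt_eqF// (hd_a_gt0 H)|exact: ac].
have [F dF] : exists F, forall r, l0 < r < rs -> is_der r F (2 * a r * b r * expR (G r)).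
  apply: prim => r rI; apply: cvgM; last exact: (is_der_cont (der_exp (dG _ rI))).
  by apply: cvgM; [apply: cvgM; [exact: cvg_cst|exact: ac]|exact: (hd_b_cont H)].
exists G, (fun r => F r - F lo); split => //; last by rewrite subrr.
by move=> r rI; have dFr := dF _ rI; apply: der_eq; [der|ring].
Qed.

(** [T] depends on the coefficients alone: two half solutions with the same [t] have the same
    [T(x(s))] and hence, [T] being injective, the same values. *)
Theorem half_sol_unique (a b c : K -> K) (l0 lo rs : K) : half_data a b c l0 lo rs ->
  exists T : K -> K, (forall r s, lo < r -> r < s -> s < rs -> T r < T s) /\
    forall x t, half_sol a b c lo rs x t ->
      (forall s, s < t -> [/\ lo < x s, 0 < derive1 x s & T (x s) = s - t]) /\
      a (x s) * derive1 x s @[s --> t^'-] --> 0.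
Proof.
move=> H; have [G [F [dG dF F_lo]]] := half_data_primitives H.
have [T [dT T0 Te _]] := fi_T H dG dF F_lo.
exists T; split.
  move=> r s lr rs' srs; apply: (@der_gt0_lt _ T (fun r => (fi_V a G F r)^-1) _ _ rs').
    by move=> y /andP[ry ys]; apply: dT; rewrite (lt_le_trans lr) ?(le_lt_trans ys).
  by move=> y /andP[ry ys]; rewrite invr_gt0 (fi_V_gt0 H)// (lt_trans lr)//(lt_trans ys).
move=> x t S; split; last exact: (half_sol_flux_cvg0 H dG dF F_lo S).
move=> s st; have xs := half_sol_gt H dG dF F_lo S st.
split => //; last exact: (half_sol_T H dG dF F_lo S dT T0 Te).
rewrite (half_sol_velocity H dG dF F_lo S st xs) (fi_V_gt0 H)// xs.
by case/andP: (hs_itv S st).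
Qed.

(** The solution is the inverse of [T], which maps []lo, rs[] onto []-oo, 0[] and has derivative
    [1/V]; its values at [s >= 0] are arbitrary. *)
Theorem half_sol_exists (a b c : K -> K) (l0 lo rs : K) : half_data a b c l0 lo rs ->
  exists x, half_sol a b c lo rs x 0.
Proof.
move=> H; have [G [F [dG dF F_lo]]] := half_data_primitives H.
have [T [dT T0 Te TNy]] := fi_T H dG dF F_lo.
have lors := hd_lors H.
have T_lt r s : lo < r -> r < s -> s < rs -> T r < T s.
  move=> lr rs' srs; apply: (@der_gt0_lt _ T (fun r => (fi_V a G F r)^-1) _ _ rs').
    by move=> y /andP[ry ys]; apply: dT; rewrite (lt_le_trans lr) ?(le_lt_trans ys).
  by move=> y /andP[ry ys]; rewrite invr_gt0 (fi_V_gt0 H)// (lt_trans lr)//(lt_trans ys).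
have T_lt_inv r s : lo < r < rs -> lo < s < rs -> T r < T s -> r < s.
  move=> /andP[lr rrs] /andP[ls srs]; rewrite !ltNge; apply: contra.
  by rewrite le_eqVlt => /predU1P[->//|/(T_lt _ _ ls)/(_ rrs)/ltW].
have [X XP] : {X : K -> K & forall s, s < 0 -> lo < X s < rs /\ T (X s) = s}.
  apply: (@choice _ _ (fun s r => s < 0 -> lo < r < rs /\ T r = s)) => s.
  have [s0|s0] := ltP s 0; last by exists 0.
  have [r1 r1I r1T] := TNy s; have [|r2 r2I r2T] := Te (- s); first by rewrite oppr_gt0.
  rewrite opprK in r2T.
  have r12 : r1 < r2 by apply: T_lt_inv => //; exact: lt_trans r2T.
  case/andP: (r1I) => lr1 r1rs; case/andP: (r2I) => lr2 r2rs.
  have [||r rI rE] := @IVT _ T r1 r2 s (ltW r12).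
  - apply: within_cont => y /andP[ry yr]; apply: is_der_cont (dT _ _).
    by rewrite (lt_le_trans lr1) ?(le_lt_trans yr).
  - by rewrite ge_min (ltW r1T)/= le_max (ltW r2T) orbT.
  exists r => _; split => //; move: rI; rewrite in_itv /= => /andP[ry yr].
  by rewrite (lt_le_trans lr1) ?(le_lt_trans yr).
have XI s : s < 0 -> lo < X s < rs by case/XP.
have TX s : s < 0 -> T (X s) = s by case/XP.
have XT r : lo < r < rs -> X (T r) = r.
  move=> rI; have Tr0 := T0 _ rI; have Xr := XI _ Tr0.
  case: (ltgtP (X (T r)) r) => // h; exfalso.
    by have := T_lt _ _ (andP Xr).1 h (andP rI).2; rewrite TX// ltxx.
  by have := T_lt _ _ (andP rI).1 h (andP Xr).2; rewrite TX// ltxx.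
have dX s : s < 0 -> is_der s X (fi_V a G F (X s)).
  move=> s0; have Xs := XI _ s0; case/andP: (Xs) => lX Xrs.
  have V0 := fi_V_gt0 H G F Xs.
  have := @is_derive_inverse _ T X (fi_V a G F (X s))^-1 (X s).
  rewrite TX// invrK; apply.
  - near=> r; apply: XT; apply/andP; split; near: r; [exact: lt_nbhsr|exact: lt_nbhsl].
  - near=> r; apply: is_der_cont (dT _ _).
    by apply/andP; split; near: r; [exact: lt_nbhsr|exact: lt_nbhsl].
  - exact: dT.
  - by rewrite invr_eq0 gt_eqF.
exists X; split.
- by move=> s /XI/andP[/ltW -> ->].
- by move=> s /dX/is_der_derivable.
- by move=> s s0; rewrite (is_der_E (dX _ s0)) ltW// (fi_V_gt0 H)// XI.
- move=> s s0; rewrite (is_der_E (dX _ s0)).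
  have Xs := XI _ s0; have dXs := dX _ s0.
  have a0 : 0 < a (X s) by rewrite (hd_a_gt0 H)//; case/andP: Xs => h ->; rewrite (lt_trans (hd_l0lo H)).
  have W0 := fi_W_gt0 G F (X s).
  apply: (@near_eq_der _ (fun z => fi_W G F (X z))).
    near=> z; have z0 : z < 0 by near: z; exact: lt_nbhsl.
    rewrite (is_der_E (dX _ z0)) /fi_V mulrCA mulfV ?mulr1// gt_eqF// (hd_a_gt0 H)//.
    by case/andP: (XI _ z0) => h ->; rewrite (lt_trans (hd_l0lo H)).
  apply: der_eq; first by apply: der_comp dXs; exact: (fi_W_der H dG dF F_lo).
  by rewrite /fi_V; field; rewrite !gt_eqF.
- apply/cvgrPdist_lt => e e0.
  pose r := Num.min (lo + e) ((lo + rs) / 2).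
  have rI : lo < r < rs by rewrite lt_min gt_min; lra.
  near=> s; have sT : s < T r by near: s; apply: nbhs_ninfty_lt; exact: num_real.
  have s0 : s < 0 by rewrite (lt_trans sT)// T0.
  have Xs := XI _ s0.
  have : X s < r by apply: T_lt_inv => //; rewrite TX.
  rewrite /r lt_min => /andP[h _].
  by rewrite distrC gtr0_norm ?subr_gt0 ?ltrBlDl//; case/andP: Xs.
apply/cvgrPdist_lt => e e0.
pose r := Num.max (rs - e) ((lo + rs) / 2).
have rI : lo < r < rs by rewrite lt_max gt_max; lra.
near=> s; have s0 : s < 0 by near: s; exact: nbhs_left_lt.
have Ts : T r < s by near: s; apply: nbhs_left_gt; exact: T0.
have Xs := XI _ s0.
have : r < X s by apply: T_lt_inv => //; rewrite TX.
rewrite /r gt_max => /andP[h _].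
rewrite gtr0_norm ?subr_gt0; last by case/andP: Xs.
lra.
Unshelve. all: by end_near. Qed.

End HalfSolution.

(** * Test functions *)

Section TestFunctions.
Context {K : realType}.
Implicit Types (f g phi : K -> K).

(** Carrying the derivative as a witness gives closure under sums and products by induction on the
    order, without formulas for iterated derivatives. *)
Fixpoint differentiable_upto n f : Prop :=
  if n is m.+1 then exists2 f', (forall x, is_der x f (f' x)) & differentiable_upto m f'
  else True.

Lemma derive1n_derivable f : (forall n, differentiable_upto n f) ->
  forall n x, derivable (derive1n n f) x 1.
Proof.
move=> fs n; have {fs} := fs n.+1; elim: n f => [|n IH] f [f' df sf'] x.
  by rewrite derive1n0; exact: is_der_derivable (df x).
rewrite derive1Sn (_ : derive1 f = f'); first exact: IH.
by apply/funext => y; exact: is_der_E.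
Qed.

Lemma differentiable_uptoW n f : differentiable_upto n.+1 f -> differentiable_upto n f.
Proof.
elim: n f => [//|n IH] f [f' df sf']; exists f' => //; exact: IH.
Qed.

Lemma differentiable_uptoD n f g : differentiable_upto n f -> differentiable_upto n g ->
  differentiable_upto n (fun x => f x + g x).
Proof.
elim: n f g => [//|n IH] f g [f' df sf'] [g' dg sg'].
exists (fun x => f' x + g' x); last exact: IH.
by move=> x; have := df x; have := dg x => dgx dfx; der.
Qed.

Lemma differentiable_uptoM n f g : differentiable_upto n f -> differentiable_upto n g ->
  differentiable_upto n (fun x => f x * g x).
Proof.
elim: n f g => [//|n IH] f g sf sg; have sf1 := differentiable_uptoW sf.
have sg1 := differentiable_uptoW sg; case: sf sg => [f' df sf'] [g' dg sg'].
exists (fun x => f' x * g x + f x * g' x).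
  by move=> x; have := df x; have := dg x => dgx dfx; der.
by apply: differentiable_uptoD; exact: IH.
Qed.

Lemma differentiable_upto_cst n (k : K) : differentiable_upto n (fun=> k).
Proof. by elim: n k => [//|n IH] k; exists (fun=> 0) => // x; der. Qed.

Lemma differentiable_upto_affine n f (k l : K) : differentiable_upto n f ->
  differentiable_upto n (fun x => f (k * x + l)).
Proof.
elim: n f => [//|n IH] f [f' df sf'].
exists (fun x => f' (k * x + l) * k).
  move=> x; apply: der_eq.
    by apply: der_comp (df _) _; apply: derD (der_cst _ _); apply: derM (der_cst _ _) (der_id _).
  by rewrite /=; ring.
by apply: differentiable_uptoM; [exact: IH|exact: differentiable_upto_cst].
Qed.

(** The classical [e^(-1/x)] extended by 0; the powers of [1/x] make the family stable under
    differentiation up to linear combinations. *)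
Definition flat m (x : K) : K := if 0 < x then x^-1 ^+ m * expR (- x^-1) else 0.

Lemma flat_ge0 m x : 0 <= flat m x.
Proof.
rewrite /flat; case: ifPn => // x0.
by rewrite mulr_ge0 ?expR_ge0 ?exprn_ge0 ?invr_ge0 ?ltW.
Qed.

(** With [y = 1/x], a single term of the exponential series gives [y^n / n! <= e^y]. *)
Lemma flat_bound m x : flat m.+1 x <= m.+1`!%:R.
Proof.
rewrite /flat; case: ifPn => [x0|_]; last exact: ler0n.
have y0 : 0 <= x^-1 by rewrite invr_ge0 ltW.
have := expR_ge1Dxn m y0; set y := x^-1 in y0 *.
rewrite expRN ler_pdivrMr ?expR_gt0// => h.
have f0 : 0 < (m.+1)`!%:R :> K by rewrite ltr0n fact_gt0.
by rewrite mulrC -ler_pdivrMr//; lra.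
Qed.

Lemma flat_der m x : is_der x (flat m) (flat m.+2 x - m%:R * flat m.+1 x).
Proof.
case: (ltgtP x 0) => [x0|x0|->].
- rewrite /flat !ltNge !(ltW x0)/= mulr0 subrr.
  apply: near_eq_der (der_cst 0 x); near=> y.
  by rewrite ltNge ltW//; near: y; exact: lt_nbhsl.
- rewrite /flat x0; apply: (@near_eq_der _ (fun y => y^-1 ^+ m * expR (- y^-1))).
    by near=> y; rewrite ifT//; near: y; exact: lt_nbhsr.
  have xn0 : x != 0 by rewrite gt_eqF.
  have dV : is_der x (fun y => y^-1) (- 1 / x ^+ 2) by apply: derV; [|exact: der_id].
  apply: der_eq; first by der.
  rewrite /=; case: m => [|m]; first by rewrite /= !expr0 !expr1; field.
  by rewrite /= !exprS; field.
- have E m' : flat m' 0 = 0 by rewrite /flat ltxx.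
  rewrite !E mulr0 subrr.
  apply/is_derive1_caratheodory.
  (* The difference quotient at 0 is [flat m.+1 y]; writing it as [y * flat m.+2 y], with the second
     factor bounded, shows that it tends to 0. *)
  exists (fun y => y * flat m.+2 y); split; last by rewrite mul0r.
    move=> y; rewrite E !subr0 /flat; case: ifPn => [y0|_]; last by rewrite mulr0 mul0r.
    by rewrite !exprS; field; rewrite gt_eqF.
  apply/cvgrPdist_lt => e e0 /=; rewrite mul0r.
  have N0 : 0 < (m.+2)`!%:R :> K by rewrite ltr0n fact_gt0.
  near=> y; rewrite sub0r normrN normrM [`|flat _ _|]ger0_norm ?flat_ge0//.
  apply: le_lt_trans (_ : `|y| * (m.+2)`!%:R < _).
    by rewrite ler_wpM2l// flat_bound.
  rewrite -ltr_pdivlMr//; near: y.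
  by exists (e / (m.+2)`!%:R) => [|y]; rewrite /= ?divr_gt0// sub0r normrN.
Unshelve. all: by end_near. Qed.

Lemma flat_differentiable n m : differentiable_upto n (flat m).
Proof.
elim: n m => [//|n IH] m; exists (fun x => flat m.+2 x + (- m%:R) * flat m.+1 x).
  by move=> x; rewrite mulNr; exact: flat_der.
apply: differentiable_uptoD => //; apply: differentiable_uptoM => //.
exact: differentiable_upto_cst.
Qed.

(** The product of [e^(-1/x)] and [e^(-1/(1-x))], supported in [[0, 1]], divided by its total mass,
    and the primitive of the quotient. The support lies on one side of 0, so the rescaled kernels
    are one-sided. *)
Lemma smooth_step : exists rho Theta : K -> K,
  [/\ forall n, differentiable_upto n rho, forall x, is_der x Theta (rho x),
      exists2 M, 0 < M & forall x, 0 <= rho x <= M,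
      forall x, x <= 0 -> Theta x = 0 /\ rho x = 0 &
      (forall x, 1 <= x -> Theta x = 1 /\ rho x = 0) /\ forall x, 0 <= Theta x <= 1].
Proof.
pose r x := flat 0 x * flat 0 (- 1 * x + 1).
have rs n : differentiable_upto n r.
  apply: differentiable_uptoM; first exact: flat_differentiable.
  exact/differentiable_upto_affine/flat_differentiable.
have flat01 x : 0 <= flat 0 x <= 1.
  rewrite flat_ge0 /flat; case: ifPn => [x0|_]; last exact: ler01.
  by rewrite expr0 mul1r -expR0 ler_expR oppr_le0 invr_ge0 ltW.
have r01 : forall y, 0 <= r y <= 1.
  move=> y; have /andP[h1 h2] := flat01 y; have /andP[h3 h4] := flat01 (- 1 * y + 1).
  by rewrite mulr_ge0//= -[1](mulr1 1) ler_pM.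
have [||||P dP0] := @continuous_primitive _ r setT 0 => //.
- exact: openT.
- by move=> x _; have [r' dr _] := rs 1%N; exact: is_der_cont (dr x).
have dP y : is_der y P (r y) by exact: dP0.
have r0 x : x <= 0 -> r x = 0 by move=> x0; rewrite /r /flat ltNge x0 mul0r.
have r1 x : 1 <= x -> r x = 0.
  by move=> x1; rewrite /r /flat [X in _ * (if X then _ else _)]ltNge mulN1r addrC subr_le0 x1 mulr0.
have P01 : P 0 < P 1.
  apply: (@der_gt0_lt _ P r _ _ ltr01) => x; first by move=> _; exact: dP.
  move=> /andP[x0 x1]; rewrite /r /flat x0 mulN1r addrC subr_gt0 x1.
  by rewrite !mulr_gt0 ?expR_gt0 ?exprn_gt0 ?invr_gt0 ?subr_gt0.
have P_le x y : x <= y -> P x <= P y.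
  move=> xy; apply: (@der_ge0_le _ P r _ _ xy) => z _; first exact: dP.
  by case/andP: (r01 z).
have P0 x : x <= 0 -> P x = P 0.
  move=> x0; apply: (@der_eq0_cst _ P _ _ x0) => z /andP[_ /r0 <-]; exact: dP.
have P1 x : 1 <= x -> P x = P 1.
  move=> x1; apply/esym; apply: (@der_eq0_cst _ P _ _ x1) => z /andP[/r1 <- _]; exact: dP.
pose k := P 1 - P 0; have k0 : 0 < k by rewrite subr_gt0.
exists (fun x => r x * k^-1), (fun x => (P x - P 0) * k^-1); split.
- move=> n; apply: differentiable_uptoM => //; exact: differentiable_upto_cst.
- by move=> x; have := dP x => dPx; apply: der_eq; [der|rewrite /=; ring].
- exists k^-1 => [|x]; first by rewrite invr_gt0.
  case/andP: (r01 x) => h1 h2; rewrite mulr_ge0 ?invr_ge0 ?(ltW k0)//=.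
  by rewrite ler_piMl// invr_ge0 ltW.
- by move=> x x0; rewrite P0// subrr r0// !mul0r.
- split=> x; first by move=> x1; rewrite P1// r1// mul0r mulfV ?gt_eqF.
  have [x0|x0] := leP x 0; first by rewrite P0// subrr mul0r lexx ler01.
  rewrite mulr_ge0 ?invr_ge0 ?(ltW k0) ?subr_ge0 ?P_le ?(ltW x0)//=.
  rewrite ler_pdivrMr// mul1r lerB//.
  by have [x1|/ltW x1] := leP 1 x; [rewrite P1|exact: P_le].
Qed.

(** Each of the two ramps starts at its base point and has width [1/n], hence the support and a
    derivative made of one kernel at [k] and one at [l]. *)
Lemma step_test_function rho Theta (n k l : K) : 0 < n -> k < l ->
  (forall m, differentiable_upto m rho) -> (forall x, is_der x Theta (rho x)) ->
  (forall x, x <= 0 -> Theta x = 0 /\ rho x = 0) ->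
  (forall x, 1 <= x -> Theta x = 1 /\ rho x = 0) ->
  let phi := fun x => Theta (n * (x - k)) - Theta (n * (x - l)) in
  [/\ test_function phi,
      forall x, derive1 phi x = n * rho (n * (x - k)) - n * rho (n * (x - l)) &
      forall x, ~~ (k < x < l + n^-1) -> phi x = 0].
Proof.
move=> n0 kl srho dT T0 T1 phi.
have T'0 x a : x <= a -> Theta (n * (x - a)) = 0.
  by move=> xa; apply: (T0 _ _).1; rewrite pmulr_rle0// subr_le0.
have T'1 x a : a + n^-1 <= x -> Theta (n * (x - a)) = 1.
  move=> xa; apply: (T1 _ _).1; rewrite mulrC -ler_pdivrMr// mul1r; lra.
have phi0 x : ~~ (k < x < l + n^-1) -> phi x = 0.
  rewrite negb_and -!leNgt => /orP[xk|lx].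
    by rewrite /phi !T'0 ?subrr// (le_trans xk)// ltW.
  by rewrite /phi !T'1 ?subrr//; lra.
have sT m : differentiable_upto m Theta.
  by case: m => [//|m]; exists rho.
have affE a : (fun x => Theta (n * (x - a))) = (fun x => Theta (n * x + (- (n * a)))).
  by apply/funext => x; rewrite mulrBr.
split=> //.
  split.
    apply: derive1n_derivable => m.
    rewrite /phi; apply: differentiable_uptoD.
      by rewrite affE; exact: differentiable_upto_affine.
    rewrite (_ : (fun x => - Theta _) = fun x => - 1 * Theta (n * (x - l))); last first.
      by apply/funext => x; rewrite mulN1r.
    apply: differentiable_uptoM; first exact: differentiable_upto_cst.
    by rewrite affE; exact: differentiable_upto_affine.
  apply: (@subclosed_compact _ _ `[k, l + n^-1]).
  - exact: closed_closure.
  - exact: segment_compact.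
  - have /closure_id cE : closed (`[k, l + n^-1] : set K) by exact: itv_closed.
    rewrite [X in _ `<=` X]cE.
    apply: closure_subset => x /=; apply: contra_neqP => xI.
    apply: phi0; apply/negP => /andP[/ltW h1 /ltW h2]; apply: xI.
    by rewrite in_itv /= h1.
move=> x; apply: is_der_E; rewrite /phi.
have dTc a : is_der x (fun x => Theta (n * (x - a))) (n * rho (n * (x - a))).
  apply: der_eq; first by apply: der_comp (dT _) _; der.
  by rewrite /=; ring.
by have d1 := dTc k; have d2 := dTc l; der.
Qed.

Lemma test_function_support phi : test_function phi ->
  exists2 N, 0 < N & forall x, N <= `|x| -> phi x = 0 /\ derive1 phi x = 0.
Proof.
move=> [_ /compact_bounded[M [_ HM]]]; pose N := `|M| + 1.
have N0 : 0 < N by rewrite ltr_wpDl.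
have phi0 x : N < `|x| -> phi x = 0.
  apply: contra_ltP => /eqP p0; apply: (HM N); last exact: subset_closure.
  by rewrite /N (le_lt_trans (ler_norm _))// ltrDl.
(* The extra unit makes [phi] vanish in a whole neighbourhood of [x], hence its derivative too. *)
exists (N + 1) => [|x xN]; first by rewrite addr_gt0.
have Nx : N < `|x| by rewrite (lt_le_trans _ xN)// ltrDl.
split; first exact: phi0.
apply: is_der_E; apply: near_eq_der (der_cst 0 x); near=> y.
apply/esym/phi0; have : `|x| - `|y| <= `|x - y|.
  by rewrite lerBlDr -{1}(subrK y x) ler_normD.
have : `|x - y| < 1 by near: y; exact: (@nbhsx_ballx _ K x 1 ltr01).
lra.
Unshelve. all: by end_near. Qed.

Lemma test_function_der phi : test_function phi ->
  [/\ forall x, is_der x phi (derive1 phi x), continuous phi & continuous (derive1 phi)].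
Proof.
move=> [d _]; have d0 x : is_der x phi (derive1 phi x) by exact: derivable_is_der (d 0%N x).
split=> // x; first exact: is_der_cont (d0 x).
by apply: is_der_cont (derivable_is_der _); exact: (d 1%N x).
Qed.

End TestFunctions.

(** * Locally integrable functions and the fundamental theorem of calculus *)

Section Integration.
Context {K : realType}.
Implicit Types (f g F phi : K -> K).
Local Notation mu := (@lebesgue_measure K).

Lemma locally_integrable_itv f a b : locally_integrable setT f ->
  mu.-integrable `[a, b] (EFin \o f).
Proof.
move=> [mf _ fi]; apply/integrableP; split.
  by apply/measurable_EFinP; exact: measurable_funTS.
by apply: fi => //; exact: segment_compact.
Qed.

Lemma itv_locally_integrable f : measurable_fun setT f ->
  (forall N, 0 < N -> mu.-integrable `[- N, N] (EFin \o f)) -> locally_integrable setT f.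
Proof.
move=> mf fi; split => //; first exact: openT.
move=> A _ cA; have /compact_bounded [M [_ HM]] := cA.
pose N := `|M| + 1; have N0 : 0 < N by rewrite ltr_wpDl.
have AN : A `<=` `[- N, N].
  move=> x Ax; rewrite /= in_itv /= -ler_norml; apply: (HM N) => //.
  by rewrite /N (le_lt_trans (ler_norm _))// ltrDl.
have /integrableP[_] := fi N N0; apply: le_lt_trans.
apply: ge0_subset_integral => //; first exact: compact_measurable.
apply/measurable_EFinP; apply: measurableT_comp => //; exact: measurable_funTS.
Qed.

Lemma continuous_locally_integrable f : continuous f -> locally_integrable setT f.
Proof.
move=> fc; apply: itv_locally_integrable; first exact: continuous_measurable_fun.
by move=> N N0; apply: continuous_itv_integrable => x _; exact: fc.
Qed.

Lemma locally_integrable_bounded f g : measurable_fun setT f ->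
  locally_integrable setT g -> (forall x, `|f x| <= g x) -> locally_integrable setT f.
Proof.
move=> mf gi fg; apply: itv_locally_integrable => // N N0.
apply: (le_integrable _ _ _ (locally_integrable_itv (- N) N gi)) => //.
  by apply/measurable_EFinP; exact: measurable_funTS.
by move=> x _ /=; rewrite lee_fin (le_trans (fg x))// ler_norm.
Qed.

Lemma itv_integrableMr f g a b : mu.-integrable `[a, b] (EFin \o f) -> continuous g ->
  mu.-integrable `[a, b] (EFin \o (fun x => f x * g x)).
Proof.
move=> fi gc; apply: (@integrableMl _ _ _ mu `[a, b] _ (EFin \o f) g) => //.
  by apply: measurable_funTS; exact: continuous_measurable_fun gc.
have [M MP] : exists M, forall x, a <= x <= b -> `|g x| <= M.
  have [ab|ba] := leP a b; last first.
    by exists 0 => x /andP[ax xb]; move: ba; rewrite ltNge (le_trans ax xb).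
  have [M _ MP] := @cont_bound _ (fun x => `|g x|) a b ab
    (fun x _ => continuous_comp (gc x) (@norm_continuous _ K _)).
  by exists M.
exists M; split; first exact: num_real.
by move=> B MB x /=; rewrite in_itv /= => /MP /le_trans; apply; exact: ltW.
Qed.

Lemma locally_integrableMr f g : locally_integrable setT f -> continuous g ->
  locally_integrable setT (fun x => f x * g x).
Proof.
move=> fi gc; apply: itv_locally_integrable.
  by apply: measurable_funM; [case: fi|exact: continuous_measurable_fun].
by move=> N N0; apply: itv_integrableMr => //; exact: locally_integrable_itv.
Qed.

(** [|y| <= 1 + y^2]. *)
Lemma locally_integrable_sqr f : measurable_fun setT f ->
  locally_integrable setT (fun x => f x ^+ 2) -> locally_integrable setT f.
Proof.
move=> mf f2.
have h := locally_integrableD (continuous_locally_integrable (@cst_continuous K K (1 : K))) f2.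
apply: (locally_integrable_bounded mf h) => x /=.
rewrite -[f x ^+ 2]real_normK ?num_real//; set y := `|f x|.
have y0 : 0 <= y by exact: normr_ge0.
nra.
Qed.

Lemma restrict_support f N : (forall x, N <= `|x| -> f x = 0) ->
  f \_ `[- N, N] = f.
Proof.
move=> f0; apply/funext => x; rewrite patchE; case: ifPn => // /negP xN.
rewrite f0// leNgt; apply/negP => h; apply: xN; apply/mem_set.
by rewrite /= in_itv /= -ler_norml ltW.
Qed.

Lemma integrable_support f N : (forall x, N <= `|x| -> f x = 0) ->
  mu.-integrable `[- N, N] (EFin \o f) -> mu.-integrable setT (EFin \o f).
Proof.
move=> f0; rewrite integrable_mkcond// restrict_EFin.
by rewrite restrict_support.
Qed.

Lemma integrable_test f phi N : locally_integrable setT f -> continuous phi ->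
  (forall x, N <= `|x| -> phi x = 0) ->
  mu.-integrable setT (EFin \o (fun x => f x * phi x)).
Proof.
move=> fi pc p0; apply: (@integrable_support _ N).
  by move=> x /p0 ->; rewrite mulr0.
by apply: itv_integrableMr => //; exact: locally_integrable_itv.
Qed.

(** [f] may be unbounded at the ends, as happens at the crossing; the primitive of the integrable
    [f] and [F] are continuous up to the ends and have the same derivative inside. *)
Lemma FTC2_integrable f F a b : a < b -> {within `[a, b], continuous F} ->
  (forall x, a < x < b -> is_der x F (f x)) ->
  (forall x, a < x < b -> {for x, continuous f}) ->
  mu.-integrable `[a, b] (EFin \o f) ->
  \int[mu]_(x in `[a, b]) f x = F b - F a.
Proof.
move=> ab Fc dF fc fi.
pose P x := \int[mu]_(t in `[a, x]) f t.
have Pc : {within `[a, b], continuous P}.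
  exact: (parameterized_integral_continuous (ltW ab) fi).
have dP x : a < x < b -> is_der x P (f x).
  move=> xI; case/andP: (xI) => ax xb.
  have [d E] := @continuous_FTC1_closed _ f a x b xb fi ax (fc _ xI).
  by have := derivable_is_der d; rewrite E.
have [||z zI] := @der_mvt _ (fun x => P x - F x) (fun=> 0) a b ab.
- move=> x xI; have := dP x xI; have := dF x xI => dFx dPx.
  by apply: der_eq; [der|rewrite /= subrr].
- by move=> x; apply: cvgB; [exact: Pc|exact: Fc].
rewrite mul0r => /eqP; rewrite subr_eq0 {1 2}/P set_itv1 Rintegral_set1 sub0r => /eqP.
by move=> E; rewrite addrC -E subrK.
Qed.

(** Monotone convergence along compact subintervals that exhaust []a, b[]: there the integrals are
    increments of the nondecreasing [F], hence at most [F b - F a]. *)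
Lemma ge0_derivative_integrable f F a b : a < b -> {within `[a, b], continuous F} ->
  (forall x, a < x < b -> is_der x F (f x)) ->
  (forall x, a < x < b -> {for x, continuous f}) ->
  (forall x, a < x < b -> 0 <= f x) ->
  mu.-integrable `[a, b] (EFin \o f).
Proof.
move=> ab Fc dF fc f0.
have F_le x y : a <= x -> x <= y -> y <= b -> F x <= F y.
  move=> ax; rewrite le_eqVlt => /predU1P[->//|xy] yb.
  have [|| z /andP[xz zy] zE] := @der_mvt _ F f x y xy.
  - by move=> z /andP[xz zy]; apply: dF; rewrite (le_lt_trans ax) ?(lt_le_trans zy).
  - by apply: continuous_subspaceW Fc; apply: subset_itv; rewrite bnd_simp.
  rewrite -subr_ge0 zE mulr_ge0 ?subr_ge0 ?(ltW xy)// f0//.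
  by rewrite (le_lt_trans ax) ?(lt_le_trans zy).
have mf : measurable_fun `]a, b[ f.
  apply: open_continuous_measurable_fun; first exact: interval_open.
  by move=> x; rewrite inE /= in_itv => /fc.
have d0 : 0 < b - a by rewrite subr_gt0.
(* Starting at a third of the length keeps every [[a + d n, b - d n]] nondegenerate. *)
pose d n : K := (b - a) / (n.+3)%:R.
have dn0 n : 0 < d n by rewrite divr_gt0 ?ltr0n.
have dn n : d n <= (b - a) / 3.
  by rewrite ler_pM2l// lef_pV2 ?posrE ?ltr0n// ler_nat.
have dle n m : (n <= m)%N -> d m <= d n.
  by move=> nm; rewrite ler_pM2l// lef_pV2 ?posrE ?ltr0n// ler_nat !ltnS.
pose S n : set K := `[a + d n, b - d n].
have Sab n x : S n x -> a < x < b.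
  rewrite /S /= in_itv /= => /andP[h1 h2]; have := dn0 n; lra.
have bigS : \bigcup_i S i = `]a, b[.
  apply/seteqP; split => x.
    by case=> n _ /Sab; rewrite /= in_itv.
  rewrite /= in_itv /= => /andP[ax xb].
  pose e := Num.min (x - a) (b - x).
  have e0 : 0 < e by rewrite lt_min !subr_gt0 ax.
  have [n _ nP] : exists2 n, True & (b - a) / e < n%:R.
    exists (Num.bound ((b - a) / e)) => //.
    by apply: archi_boundP; rewrite ltW// divr_gt0.
  exists n => //; rewrite /S /= in_itv /=.
  have : d n <= e.
    rewrite ler_pdivrMr ?ltr0n// mulrC -ler_pdivrMr//.
    by rewrite (le_trans (ltW nP))// ler_nat leqW// leqW// leqW.
  by rewrite /e le_min => /andP[]; lra.
have SE n : (\int[mu]_(x in S n) (f x)%:E = (F (b - d n) - F (a + d n))%:E)%E.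
  have abn : a + d n < b - d n by have := dn n; lra.
  have fin : mu.-integrable (S n) (EFin \o f).
    by apply: continuous_itv_integrable => x xS; apply: fc; apply: (Sab n); rewrite /S /= in_itv.
  rewrite -(@FTC2_integrable f F _ _ abn) //.
  - rewrite /Rintegral fineK//; apply: integrable_fin_num => //.
  - apply: continuous_subspaceW Fc; apply: subset_itv; rewrite bnd_simp; have := dn0 n; lra.
  - by move=> x /andP[h1 h2]; apply: dF; have := dn0 n; lra.
  - by move=> x /andP[h1 h2]; apply: fc; have := dn0 n; lra.
have cv : (\int[mu]_(x in S i) (f x)%:E @[i --> \oo] --> \int[mu]_(x in `]a, b[) (f x)%:E)%E.
  rewrite -bigS; apply: ge0_nondecreasing_set_cvg_integral.
  - move=> n m nm; apply/subsetPset; apply: subset_itv; rewrite bnd_simp; have := dle _ _ nm; lra.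
  - by move=> i; exact: measurable_itv.
  - move=> i; apply/measurable_EFinP; apply: measurable_funS mf => // x /Sab.
    by rewrite /= in_itv.
  - by move=> i x /Sab /f0; rewrite /= lee_fin.
have bd : (\int[mu]_(x in `]a, b[) (f x)%:E <= (F b - F a)%:E)%E.
  apply: (cvge_to_le cv); near=> n; rewrite SE lee_fin.
  have := dn0 n; have := dn n => h1 h2.
  have : F (b - d n) <= F b by apply: F_le; lra.
  have : F a <= F (a + d n) by apply: F_le; lra.
  lra.
have intoo : mu.-integrable `]a, b[ (EFin \o f).
  apply/integrableP; split; first exact/measurable_EFinP.
  apply: le_lt_trans (ltry (F b - F a)); apply: le_trans bd.
  rewrite le_eqVlt; apply/orP; left; apply/eqP.
  apply: eq_integral => x; rewrite inE /= in_itv => /f0 fx0.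
  by rewrite ger0_norm.
apply/integrableP; split.
  apply/measurable_EFinP.
  exact: (@measurable_fun_itv_cc _ a b false true f mf).
case/integrableP: intoo => _ intoo.
rewrite integral_itv_bndoo//.
by apply/measurable_EFinP; apply: measurableT_comp.
Unshelve. all: by end_near. Qed.

End Integration.

(** * Weak derivatives *)

Section WeakDerivative.
Context {K : realType}.
Implicit Types (f g u phi rho Theta : K -> K).
Local Notation mu := (@lebesgue_measure K).

Lemma Rintegral_itv_support f a b : (forall x, ~~ (a <= x <= b) -> f x = 0) ->
  \int[mu]_x f x = \int[mu]_(x in `[a, b]) f x.
Proof.
move=> f0; rewrite [RHS]Rintegral_mkcond; apply: eq_Rintegral => x _.
rewrite patchE; case: ifPn => // /negP xN; apply: f0; apply/negP => h; apply: xN.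
by apply/mem_set; rewrite /= in_itv.
Qed.

(** The exceptional point [x0] is meant for the crossing: [f phi] is continuous there, so the
    boundary terms of the two sides cancel. *)
Lemma integration_by_parts_test f g phi x0 : continuous f ->
  (forall x, x != x0 -> is_der x f (g x)) ->
  (forall x, x != x0 -> {for x, continuous g}) ->
  locally_integrable setT g -> test_function phi ->
  dist_deriv f phi = \int[mu]_x (g x * phi x).
Proof.
move=> fc df gc gi tphi; have [dphi phic dphic] := test_function_der tphi.
have [N0 N00 HN0] := test_function_support tphi.
(* [[-N, N]] contains the support of [phi] and has [x0] in its interior. *)
pose N := Num.max N0 (`|x0| + 1).
have NN0 : N0 <= N by rewrite le_max lexx.
have Nx0 : `|x0| < N.
  by rewrite /N lt_max ltrDl ltr01 orbT.
have HN x : N <= `|x| -> phi x = 0 /\ derive1 phi x = 0 by move=> /(le_trans NN0)/HN0.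
have fi := continuous_locally_integrable fc.
have i1 : mu.-integrable setT (EFin \o (fun x => g x * phi x)).
  by apply: (integrable_test gi phic (N := N)) => x /HN[].
have i2 : mu.-integrable setT (EFin \o (fun x => f x * derive1 phi x)).
  by apply: (integrable_test fi dphic (N := N)) => x /HN[].
pose h' x := g x * phi x + f x * derive1 phi x.
pose h x := f x * phi x.
suff : \int[mu]_x h' x = 0.
  rewrite /h' RintegralD// /dist_deriv => /eqP; rewrite addr_eq0 => /eqP ->.
  by [].
rewrite (@Rintegral_itv_support _ (- N) N); last first.
  move=> x; rewrite -ler_norml -ltNge => /ltW/HN[p0 p1].
  by rewrite /h' p0 p1 !mulr0 addr0.
have hi : mu.-integrable `[- N, N] (EFin \o h').
  apply: locally_integrable_itv; apply: locally_integrableD.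
    exact: locally_integrableMr.
  exact: locally_integrableMr.
have dh x : x != x0 -> is_der x h (h' x).
  by move=> xx0; have dfx := df x xx0; have dpx := dphi x; rewrite /h /h'; der.
have hc x : {for x, continuous h} by apply: cvgM; [exact: fc|exact: phic].
have h'c x : x != x0 -> {for x, continuous h'}.
  move=> xx0; apply: cvgD; apply: cvgM; [exact: gc|exact: phic|exact: fc|exact: dphic].
move: (Nx0); rewrite ltr_norml => /andP[Nx0l Nx0r].
rewrite (Rintegral_itvD (ltW Nx0l) (ltW Nx0r) (lexx N) hi).
rewrite (@FTC2_integrable _ h' h (- N) x0) //; first last.
- by apply: integrable_itvS hi => //; exact: ltW.
- by move=> x /andP[_ xx0]; apply: h'c; rewrite lt_eqF.
- by move=> x /andP[_ xx0]; apply: dh; rewrite lt_eqF.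
- by apply: within_cont => x _; exact: hc.
rewrite (@FTC2_integrable _ h' h x0 N) //; first last.
- by apply: integrable_itvS hi => //; exact: ltW.
- by move=> x /andP[xx0 _]; apply: h'c; rewrite gt_eqF.
- by move=> x /andP[xx0 _]; apply: dh; rewrite gt_eqF.
- by apply: within_cont => x _; exact: hc.
have N0' : 0 <= N by rewrite (le_trans _ (ltW Nx0)).
rewrite /h (HN N _).1 ?ger0_norm// (HN (- N) _).1 ?normrN ?ger0_norm//.
by rewrite !mulr0; ring.
Qed.

Lemma increment_locally_integrable u (k : K) : locally_integrable setT u ->
  locally_integrable setT (fun x => u x - k).
Proof.
by move=> ui; exact: (locally_integrableB ui (continuous_locally_integrable (@cst_continuous K K k))).
Qed.

Lemma norm_itv_integrable u a b : mu.-integrable `[a, b] (EFin \o u) ->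
  mu.-integrable `[a, b] (EFin \o (fun x => `|u x|)).
Proof. by move/integrable_abse. Qed.

(** Lebesgue points are defined by centered balls: [[a, a + h]] lies in the ball of radius [2 h], of
    measure [4 h], whence the factor [1/4] in the proof. *)
Lemma lebesgue_pt_itv u a e : locally_integrable setT u -> lebesgue_pt u a -> 0 < e ->
  \forall h \near 0^'+, \int[mu]_(x in `[a, a + h]) `|u x - u a| <= e * h.
Proof.
move=> ui ua e0; have e4 : 0 < e / 4 by rewrite divr_gt0.
have davg_lt : \forall r \near 0^'+, (davg u a r < (e / 4)%:E)%E.
  move/fine_cvgP: ua => [fin /cvgrPdist_lt /(_ _ e4) cv]; near=> r.
  have fr : davg u a r \is a fin_num by near: r.
  rewrite -(fineK fr) lte_fin; apply: le_lt_trans (ler_norm _) _.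
  by rewrite -normrN -sub0r; near: r.
have [d /= d0 Hd] := davg_lt.
near=> h; have h0 : 0 < h by near: h; exact: nbhs_right_gt.
have hd : h < d / 2 by near: h; apply: nbhs_right_lt; rewrite divr_gt0.
have h2 : 0 < 2 * h by rewrite mulr_gt0.
have := Hd (2 * h); rewrite /ball_ /= sub0r normrN gtr0_norm// => /(_ _ h2).
have -> : 2 * h < d by lra.
move=> /(_ isT); rewrite /davg /iavg lebesgue_measure_ball ?(ltW h2)//.
rewrite inver mulrn_eq0 /= gt_eqF// lte_pdivrMl ?mulrn_wgt0// => Ilt.
have di := increment_locally_integrable (u a) ui.
have ni := norm_itv_integrable (locally_integrable_itv a (a + h) di).
rewrite -lee_fin /Rintegral fineK; last exact: integrable_fin_num ni.
apply: (@le_trans _ _ ((2 * h *+ 2)%:E * (e / 4)%:E)%E); last first.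
  by rewrite -EFinM lee_fin -mulr_natr; lra.
apply: (le_trans _ (ltW Ilt)); apply: ge0_subset_integral => //.
- exact: measurable_ball.
- apply/measurable_EFinP; apply: measurableT_comp => //.
  by case: di => mdi _ _; exact: measurable_funTS mdi.
- move=> x; rewrite /= in_itv /= => /andP[ax xh].
  by rewrite /ball /= distrC ger0_norm ?subr_ge0//; lra.
Unshelve. all: by end_near. Qed.

(** The kernel has mass 1, is at most [M N] and lives on [[a, a + 1/N]], so the error is at most [M]
    times the mean of [|u - u a|] over that interval. *)
Lemma lebesgue_pt_kernel u a rho Theta M : locally_integrable setT u -> lebesgue_pt u a ->
  (forall x, is_der x Theta (rho x)) -> continuous rho ->
  (forall x, 0 <= rho x <= M) -> 0 < M ->
  (forall x, x <= 0 -> Theta x = 0 /\ rho x = 0) ->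
  (forall x, 1 <= x -> Theta x = 1 /\ rho x = 0) ->
  \int[mu]_x (u x * (n.+1%:R * rho (n.+1%:R * (x - a)))) @[n --> \oo] --> u a.
Proof.
move=> ui ua dT rhoc rhoM M0 T0 T1; apply/cvgrPdist_le => e e0.
have eM : 0 < e / M by rewrite divr_gt0.
have cvi : (n.+1%:R^-1 : K) @[n --> \oo] --> (0 : K)^'+.
  move=> P [d /= d0 HP]; suff : \forall n \near \oo, P n.+1%:R^-1 by [].
  near=> n.
  have Ni : 0 < (n.+1%:R : K)^-1 by rewrite invr_gt0 ltr0n.
  apply: (HP _ _ Ni); rewrite /ball_ /= sub0r normrN gtr0_norm ?invr_gt0 ?ltr0n//.
  by near: n; exact: (near_infty_natSinv_lt (PosNum d0)).
have HN := cvi _ (lebesgue_pt_itv ui ua eM).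
near=> n.
have : \int[mu]_(x in `[a, a + n.+1%:R^-1]) `|u x - u a| <= e / M * n.+1%:R^-1.
  by near: n; exact: HN.
set N : K := n.+1%:R => HI; have N0 : 0 < N by rewrite ltr0n.
have Ni0 : 0 < N^-1 by rewrite invr_gt0.
pose k x := N * rho (N * (x - a)).
have kc : continuous k.
  move=> x; apply: cvgM; first exact: cvg_cst.
  apply: continuous_comp; last exact: rhoc.
  by apply: cvgM; [exact: cvg_cst|apply: cvgB; [exact: cvg_id|exact: cvg_cst]].
have k0 x : ~~ (a <= x <= a + N^-1) -> k x = 0.
  rewrite negb_and -!ltNge /k => /orP[xa|ax].
    by rewrite (T0 _ _).2 ?mulr0// pmulr_rle0// subr_le0 ltW.
  by rewrite (T1 _ _).2 ?mulr0// mulrC -ler_pdivrMr// mul1r lerBrDl ltW.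
have ia : a < a + N^-1 by rewrite ltrDl.
have uk : mu.-integrable `[a, a + N^-1] (EFin \o (fun x => u x * k x)).
  by apply: itv_integrableMr => //; exact: locally_integrable_itv.
have ki : mu.-integrable `[a, a + N^-1] (EFin \o k).
  by apply: continuous_itv_integrable => x _; exact: kc.
have k1 : \int[mu]_(x in `[a, a + N^-1]) k x = 1.
  rewrite (@FTC2_integrable _ k (fun x => Theta (N * (x - a))) _ _ ia)//.
  - have -> : N * (a + N^-1 - a) = 1 by rewrite addrAC subrr add0r mulfV ?gt_eqF.
    by rewrite (T1 _ _).1// subrr mulr0 (T0 _ _).1// subr0.
  - apply: within_cont => x _; apply: continuous_comp; last exact: is_der_cont (dT _).
    by apply: cvgM; [exact: cvg_cst|apply: cvgB; [exact: cvg_id|exact: cvg_cst]].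
  - move=> x _; apply: der_eq; first by apply: der_comp (dT _) _; der.
    by rewrite /k /=; ring.
  - by move=> x _; exact: kc.
rewrite (@Rintegral_itv_support _ a (a + N^-1)); last by move=> x /k0; rewrite -/(k x) => ->; rewrite mulr0.
have -> : u a = \int[mu]_(x in `[a, a + N^-1]) (u a * k x).
  by rewrite RintegralZl// k1 mulr1.
have uak : mu.-integrable `[a, a + N^-1] (EFin \o (fun x => u a * k x)).
  by apply: continuous_itv_integrable => x _; apply: cvgM; [exact: cvg_cst|exact: kc].
rewrite -RintegralB//.
have di : mu.-integrable `[a, a + N^-1] (EFin \o (fun x => u a * k x - u x * k x)).
  by apply: (integrableB _ uak uk).
apply: le_trans (le_normr_Rintegral _ di) _ => //.
have ni : mu.-integrable `[a, a + N^-1] (EFin \o (fun x => `|u x - u a|)).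
  exact/norm_itv_integrable/locally_integrable_itv/increment_locally_integrable.
apply: (@le_trans _ _ (\int[mu]_(x in `[a, a + N^-1]) (M * N * `|u x - u a|))).
  apply: le_Rintegral => //.
  - exact: (norm_itv_integrable di).
  - by apply: (integrableZl _ (M * N) ni).
  - move=> x _ /=; rewrite -mulrBl normrM distrC mulrC.
    have /andP[r0 rM] := rhoM (N * (x - a)).
    rewrite ler_wpM2r// /k ger0_norm; last by rewrite mulr_ge0// ltW.
    by rewrite mulrC ler_wpM2r// ltW.
rewrite RintegralZl//.
apply: le_trans (_ : M * N * (e / M * N^-1) <= _).
  by rewrite ler_pM2l// mulr_gt0.
rewrite le_eqVlt; apply/orP; left; apply/eqP; field.
by rewrite !gt_eqF.
Unshelve. all: by end_near. Qed.

(* Test against a smoothed indicator function of [[a, b]], whose derivative is a difference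
   of two approximate identities at [a] and [b]. *)
Lemma weak_derivative_increment u g a b :
  locally_integrable setT u -> locally_integrable setT g ->
  (forall phi, test_function phi ->
     \int[mu]_x (u x * derive1 phi x) + \int[mu]_x (g x * phi x) = 0) ->
  a < b -> lebesgue_pt u a -> lebesgue_pt u b ->
  u b - u a = \int[mu]_(x in `[a, b]) g x.
Proof.
move=> ui gi ug ab ua ub.
case: (@smooth_step K) => rho [] Theta [srho dT [M M0 rhoM] T0 [T1 T01]].
have rhoc : continuous rho.
  by move=> x; have [r' dr _] := srho 1%N; exact: is_der_cont (dr x).
pose phi n x : K := Theta (n.+1%:R * (x - a)) - Theta (n.+1%:R * (x - b)).
pose k c n x : K := n.+1%:R * rho (n.+1%:R * (x - c)).
have phiP n : [/\ test_function (phi n),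
    forall x, derive1 (phi n) x = k a n x - k b n x &
    forall x, ~~ (a < x < b + n.+1%:R^-1) -> phi n x = 0].
  by apply: step_test_function => //; rewrite ltr0n.
have kc c n : continuous (k c n).
  move=> x; apply: cvgM; first exact: cvg_cst.
  apply: continuous_comp; last exact: rhoc.
  by apply: cvgM; [exact: cvg_cst|apply: cvgB; [exact: cvg_id|exact: cvg_cst]].
have kn n : 1 <= (n.+1%:R : K) by rewrite ler1n.
have k0 c n x : `|c| + 1 <= `|x| -> k c n x = 0.
  move=> cx; have n1 := kn n; have n0 : 0 < (n.+1%:R : K) by rewrite ltr0n.
  have [xc|cx'] := leP x c.
    by rewrite /k (T0 _ _).2 ?mulr0// pmulr_rle0// subr_le0.
  rewrite /k (T1 _ _).2 ?mulr0//.
  have : 1 <= x - c.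
    have [x0|x0] := leP 0 x; first by move: cx; rewrite (ger0_norm x0); have := ler_norm c; lra.
    move: cx; rewrite (ltr0_norm x0); have := ler_norm (- c); rewrite normrN; lra.
  by move=> xc1; rewrite (le_trans n1)// ler_peMr// ltW.
have cvu c : lebesgue_pt u c -> \int[mu]_x (u x * k c n x) @[n --> \oo] --> u c.
  by move=> uc; exact: (lebesgue_pt_kernel ui uc dT rhoc rhoM M0 T0 T1).
have cvk : \int[mu]_x (g x * phi n x) @[n --> \oo] --> u b - u a.
  have -> : (fun n => \int[mu]_x (g x * phi n x)) =
      (fun n => \int[mu]_x (u x * k b n x) - \int[mu]_x (u x * k a n x)).
    apply/funext => n; have [tphi dphi _] := phiP n.
    have ik c : mu.-integrable setT (EFin \o (fun x => u x * k c n x)).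
      by apply: (integrable_test ui (kc c n)) => x; exact: k0.
    have := ug _ tphi.
    have -> : \int[mu]_x (u x * derive1 (phi n) x) =
        \int[mu]_x (u x * k a n x) - \int[mu]_x (u x * k b n x).
      by rewrite -RintegralB//; apply: eq_Rintegral => x _; rewrite dphi mulrBr.
    lra.
  by apply: cvgB; exact: cvu.
suff cvg2 : \int[mu]_x (g x * phi n x) @[n --> \oo] --> \int[mu]_(x in `[a, b]) g x.
  exact: (cvg_unique _ cvk cvg2).
(* [D] contains every support, as [1/(n+1) <= 1]. The pointwise limit is the indicator of the
   half-open [A]: each [phi n] vanishes at [a], while at [b] it is eventually 1. *)
pose D : set K := `[a, b + 1]; pose A : set K := `]a, b].
have mD : measurable D by exact: measurable_itv.
have mA : measurable A by exact: measurable_itv.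
have phic n : continuous (phi n) by case: (phiP n) => /test_function_der[].
have mg : measurable_fun D g by case: gi => h _ _; exact: measurable_funTS.
have phi_left n x : x <= a -> phi n x = 0.
  by move=> xa; case: (phiP n) => _ _; apply; rewrite ltNge xa.
have pw x : D x -> (fun n => (g x * phi n x)%:E) @ \oo --> (g x * \1_A x)%:E.
  rewrite /D /= in_itv /= => /andP[ax xb1].
  have large (y : K) : 0 < y -> \forall n \near \oo, 1 <= n.+1%:R * y.
    move=> y0; near=> n; rewrite mulrC -ler_pdivrMr ?ltr0n// mul1r ltW//.
    by near: n; exact: (near_infty_natSinv_lt (PosNum y0)).
  apply: cvg_near_cst.
  have [xb|bx] := leP x b.
    have E2 n : Theta (n.+1%:R * (x - b)) = 0.
      by apply: (T0 _ _).1; rewrite pmulr_rle0 ?ltr0n// subr_le0.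
    move: ax; rewrite le_eqVlt => /predU1P[xa|ax].
      near=> n; rewrite phi_left ?xa// indicE memNset; first by rewrite !mulr0.
      by rewrite /A /= in_itv /= -xa ltxx.
    have xa : 0 < x - a by rewrite subr_gt0.
    near=> n; rewrite /phi E2 (T1 _ _).1 ?subr0; last by near: n; exact: large.
    by rewrite indicE mem_set// /A /= in_itv /= ax.
  have xb : 0 < x - b by rewrite subr_gt0.
  have xa : 0 < x - a by lra.
  near=> n; rewrite /phi (T1 _ _).1; last by near: n; exact: large.
  rewrite (T1 _ _).1; last by near: n; exact: large.
  rewrite subrr indicE memNset; first by rewrite !mulr0.
  by rewrite /A /= in_itv /= leNgt bx andbF.
have phi1 n x : `|phi n x| <= 1.
  have := T01 (n.+1%:R * (x - a)); have := T01 (n.+1%:R * (x - b)).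
  by rewrite /phi ler_norml => /andP[? ?] /andP[? ?]; lra.
have mf n : measurable_fun D (EFin \o (fun x => g x * phi n x)).
  apply/measurable_EFinP; apply: measurable_funM => //.
  by apply: measurable_funTS; exact: continuous_measurable_fun (phic n).
have mlim : measurable_fun D (EFin \o (fun x => g x * \1_A x)).
  by apply/measurable_EFinP; apply: measurable_funM => //; exact: measurable_indic.
have [||| lim_int _ cv] := @dominated_convergence _ _ _ mu D mD
  (fun n => EFin \o (fun x => g x * phi n x)) (EFin \o (fun x => g x * \1_A x))
  (EFin \o (fun x => `|g x|)) mf mlim.
- by apply: aeW => x; exact: pw.
- exact: (norm_itv_integrable (locally_integrable_itv a (b + 1) gi)).
- by apply: aeW => x n _; rewrite /= lee_fin normrM ler_piMr.
have fE n : \int[mu]_x (g x * phi n x) = fine (\int[mu]_(x in D) (g x * phi n x)%:E)%E.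
  rewrite (@Rintegral_itv_support _ a (b + 1))//.
  move=> x xab; have [_ _ p0] := phiP n; rewrite p0 ?mulr0//.
  apply: contra xab => /andP[/ltW -> /=] xb; rewrite ltW// (lt_le_trans xb)// lerD2l.
  by rewrite invf_le1 ?ltr0n.
under eq_fun do rewrite fE.
have -> : \int[mu]_(x in `[a, b]) g x = \int[mu]_(x in D) (g x * \1_A x).
  rewrite (@eq_Rintegral _ _ _ mu D (g \_ A) (fun x => g x * \1_A x)); last first.
    by move=> x _; rewrite patch_indic.
  rewrite -Rintegral_mkcondr (_ : D `&` A = A); last first.
    by apply: setIidr; apply: subset_itv; rewrite bnd_simp// lerDl.
  rewrite Rintegral_itv_obnd_cbnd//.
  apply: integrableS (locally_integrable_itv a b gi) => //.
  by apply: subset_itv; rewrite bnd_simp.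
apply: fine_cvg; rewrite /Rintegral fineK//; exact: integrable_fin_num lim_int.
Unshelve. all: by end_near. Qed.

End WeakDerivative.

(** * From identities almost everywhere to classical derivatives *)

Section WeakToClassical.
Context {K : realType}.
Implicit Types (f g u v : K -> K).
Local Notation mu := (@lebesgue_measure K).

Lemma locally_integrable_primitive g : locally_integrable setT g ->
  exists2 P : K -> K, continuous P &
    forall x y, x <= y -> P y - P x = \int[mu]_(t in `[x, y]) g t.
Proof.
move=> gi; pose P y := if 0 <= y then \int[mu]_(t in `[0, y]) g t
                       else - \int[mu]_(t in `[y, 0]) g t.
have gI a b : mu.-integrable `[a, b] (EFin \o g) by exact: locally_integrable_itv.
have PB x y : x <= y -> P y - P x = \int[mu]_(t in `[x, y]) g t.
  move=> xy; rewrite /P; have [x0|x0] := leP 0 x.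
    rewrite (le_trans x0 xy) (Rintegral_itvD x0 xy (lexx y) (gI _ _)).
    by rewrite addrC addKr.
  have [y0|y0] := leP 0 y.
    by rewrite (Rintegral_itvD (ltW x0) y0 (lexx y) (gI _ _)); ring.
  by rewrite (Rintegral_itvD xy (ltW y0) (lexx 0) (gI _ _)); ring.
exists P => // z.
have zz : z - 1 < z + 1 by lra.
have Pc := parameterized_integral_continuous (ltW zz) (gI (z - 1) (z + 1)).
have zI : z \in `]z - 1, z + 1[%R by rewrite in_itv /=; lra.
have [Qc _ _] := (continuous_within_itvP _ zz).1 Pc.
have {}Qc := Qc _ zI.
pose Q y := P (z - 1) + parameterized_integral mu (z - 1) y g.
have QP y : z - 1 <= y -> Q y = P y.
  by move=> zy; rewrite /Q /parameterized_integral -PB//; ring.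
have : {for z, continuous Q} by apply: cvgD; [exact: cvg_cst|exact: Qc].
rewrite /prop_for /continuous_at QP; last by lra.
apply: cvg_trans; apply: near_eq_cvg; near=> y.
by apply: QP; apply: ltW; near: y; apply: lt_nbhsr; lra.
Unshelve. all: by end_near. Qed.

(** Integrals do not see null sets, so the increments of [f] are integrals of the continuous [v]. *)
Lemma increment_is_der f g v (l r z : K) : locally_integrable setT g ->
  (forall x y, l < x -> x <= y -> y < r -> f y - f x = \int[mu]_(t in `[x, y]) g t) ->
  (forall x, l < x < r -> {for x, continuous v}) ->
  {ae mu, forall x, l < x < r -> g x = v x} ->
  l < z < r -> is_der z f (v z).
Proof.
move=> gi fg vc gv /andP[lz zr].
pose x := (l + z) / 2; pose y := (z + r) / 2.
have [lx xz zy yr] : [/\ l < x, x < z, z < y & y < r] by rewrite /x /y; split; lra.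
have vi : mu.-integrable `[x, y] (EFin \o v).
  by apply: continuous_itv_integrable => s /andP[xs sy]; apply: vc; lra.
have vz : {for z, continuous v} by apply: vc; lra.
have [dV VE] := @continuous_FTC1_closed _ v x z y zy vi xz vz.
have := derivable_is_der dV; rewrite VE => dV1.
pose V s := \int[mu]_(t in `[x, s]) v t.
apply: (@near_eq_der _ (fun s => f x + V s)); last first.
  by apply: der_eq; [exact: derD (der_cst _ _) dV1|rewrite add0r].
near=> s; have xs : x < s by near: s; exact: lt_nbhsr.
have sy : s < y by near: s; exact: lt_nbhsl.
have -> : V s = \int[mu]_(t in `[x, s]) g t.
  rewrite /V /Rintegral; congr fine; apply: ae_eq_integral => //.
  - apply: (measurable_int mu); apply: continuous_itv_integrable => w /andP[xw ws].
    by apply: vc; lra.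
  - by apply/measurable_EFinP; case: gi => h _ _; exact: measurable_funTS.
  - move: gv; apply: filterS; first exact: (ae_filter_ringOfSetsType mu).
    move=> w gvw; rewrite /= in_itv /= => /andP[xw ws].
    by rewrite gvw//; lra.
by rewrite -fg ?(ltW xs)//; [ring|exact: lt_trans yr].
Unshelve. all: by end_near. Qed.

(** Otherwise a null set would contain [[0, 1]]. *)
Lemma ae_lebesgue_pt_exists u : locally_integrable setT u -> exists x, lebesgue_pt u x.
Proof.
move=> /lebesgue_differentiation ul.
apply: contrapT => /forallNP nl; case: ul => A [mA A0 sA].
have : (mu [set` `[0%R, 1%R]%R] <= mu A)%E.
  apply: le_measure; rewrite ?inE//.
  by move=> x _; apply: sA => /=; exact: nl.
by rewrite A0 lebesgue_measure_itv /= lte_fin ltr01 -EFinD subr0 lee_fin leNgt ltr01.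
Qed.

(** At a Lebesgue point [g] is the derivative of its primitive, which is locally constant here. *)
Lemma zero_increment_ae0 g (l r : K) : locally_integrable setT g ->
  (forall x y, l < x -> x <= y -> y < r -> \int[mu]_(t in `[x, y]) g t = 0) ->
  {ae mu, forall x, l < x < r -> g x = 0}.
Proof.
move=> gi g0; have := lebesgue_differentiation gi.
apply: filterS; first exact: (ae_filter_ringOfSetsType mu).
move=> z gz /andP[lz zr].
pose x := (l + z) / 2; pose y := (z + r) / 2.
have [lx xz zy yr] : [/\ l < x, x < z, z < y & y < r] by rewrite /x /y; split; lra.
have [dF FE] := FTC1_lebesgue_pt zy (locally_integrable_itv x y gi) xz gz.
rewrite -FE; apply: is_der_E; apply: near_eq_der (der_cst 0 z); near=> s.
have xs : x < s by near: s; exact: lt_nbhsr.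
have sy : s < y by near: s; exact: lt_nbhsl.
by rewrite g0// ?(ltW xs)//; exact: lt_trans yr.
Unshelve. all: by end_near. Qed.

End WeakToClassical.

(** * Weak profiles are classical away from the sonic crossing *)

Section TransonicProfiles.
Context {K : realType}.
Local Notation mu := (@lebesgue_measure K).

(* [sd_right] is the problem on the right of the sonic density, seen through the reflection
   [R(xi) |-> - R(- xi)], which preserves the form of the equation. *)
Record sonic_data (a b c : K -> K) (Rm Rs Rp : K) : Prop := SonicData {
  sd_left : exists l0, half_data a b c l0 Rm Rs;
  sd_right : exists l1,
    half_data (fun r => - a (- r)) (fun r => b (- r)) (fun r => c (- r)) l1 (- Rp) (- Rs);
  sd_a0 : a Rs = 0;
  sd_a_cont : forall r, Rm <= r <= Rp -> {for r, continuous a};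
  sd_b_cont : forall r, Rm <= r <= Rp -> {for r, continuous b};
  sd_c_cont : forall r, Rm <= r <= Rp -> {for r, continuous c};
  sd_b_gt0 : 0 < b Rs;
  sd_c_gt0 : forall r, Rm <= r <= Rp -> 0 < c r }.

(* At [t] the derivative may be infinite, and [derive1 R t] is then a junk value. *)
Record transonic (a b c : K -> K) (Rm Rs Rp : K) (R : K -> K) (t : K) : Prop := Transonic {
  ts_cont : continuous R;
  ts_itv : forall s, Rm <= R s <= Rp;
  ts_sonic : R t = Rs;
  ts_lt : forall s, s < t -> R s < Rs;
  ts_gt : forall s, t < s -> Rs < R s;
  ts_der : forall s, s != t -> derivable R s 1;
  ts_ge0 : forall s, s != t -> 0 <= derive1 R s;
  ts_flux : forall s, s != t -> is_der s (fun z => a (R z) * derive1 R z)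
    (b (R s) - c (R s) * derive1 R s ^+ 2);
  ts_Ny : R s @[s --> -oo] --> Rm;
  ts_y : R s @[s --> +oo] --> Rp }.

Context (a b c : K -> K) (Rm Rs Rp : K) (SD : sonic_data a b c Rm Rs Rp).

Lemma sd_lt : Rm < Rs < Rp.
Proof.
have [l0 Hl] := sd_left SD; have [l1 Hr] := sd_right SD.
by rewrite (hd_lors Hl); have := hd_lors Hr; rewrite ltrN2.
Qed.

Lemma sd_a_neq0 r : Rm <= r <= Rp -> r != Rs -> a r != 0.
Proof.
have [l0 Hl] := sd_left SD; have [l1 Hr] := sd_right SD.
move=> /andP[mr rp]; case: ltgtP => // rs _.
  by rewrite gt_eqF// (hd_a_gt0 Hl)// rs (lt_le_trans (hd_l0lo Hl)).
have := @hd_a_gt0 _ _ _ _ _ _ _ Hr (- r); rewrite opprK oppr_gt0 ltrN2 rs andbT => h.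
by rewrite lt_eqF// h// (lt_le_trans (hd_l0lo Hr))// lerN2.
Qed.

Lemma nondecreasing_der_ge0 (f : K -> K) x d : {homo f : y z / y <= z} -> is_der x f d -> 0 <= d.
Proof.
move=> fh /is_derive1_caratheodory[g [fg gc <-]].
rewrite leNgt; apply/negP => gx0.
have /nbhs_ballP[e /= e0 He] : \forall y \near x, g y < 0 by exact: (cvgr_lt _ gc).
have xe : ball x e (x + e / 2).
  rewrite /ball /= opprD addrA subrr add0r normrN gtr0_norm ?divr_gt0//; lra.
have := fg (x + e / 2); rewrite addrAC subrr add0r => fE.
have : 0 <= f (x + e / 2) - f x by rewrite subr_ge0 fh// lerDl divr_ge0// ltW.
by rewrite fE leNgt pmulr_llt0 ?divr_gt0// He.
Qed.

Section WeakTransonic.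
Context (R dR : K -> K) (Rc : continuous R) (RI : forall s, Rm <= R s <= Rp).
Context (RNy : R s @[s --> -oo] --> Rm) (Ry : R s @[s --> +oo] --> Rp).
Context (Rh : {homo R : x y / x <= y}) (dRP : W12_loc_deriv R dR).
Context (weak : forall phi, test_function phi ->
  \int[mu]_x (a (R x) * dR x * derive1 phi x)
  + \int[mu]_x ((b (R x) - c (R x) * dR x ^+ 2) * phi x) = 0).

Let comp_cont (h : K -> K) : (forall r, Rm <= r <= Rp -> {for r, continuous h}) ->
  continuous (fun x => h (R x)).
Proof. by move=> hc x; apply: continuous_comp; [exact: Rc|exact: hc]. Qed.

Let u x := a (R x) * dR x.
Let g x := b (R x) - c (R x) * dR x ^+ 2.

Let dRi : locally_integrable setT dR.
Proof. by case: dRP => _ [m i] _; exact: locally_integrable_sqr. Qed.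

Let ui : locally_integrable setT u.
Proof.
have := locally_integrableMr dRi (comp_cont (sd_a_cont SD)).
by congr (locally_integrable _ _); apply/funext => x; rewrite mulrC.
Qed.

Let gi : locally_integrable setT g.
Proof.
have i1 := continuous_locally_integrable (comp_cont (sd_b_cont SD)).
have [_ [_ i2] _] := dRP.
have i3 := locally_integrableMr i2 (comp_cont (sd_c_cont SD)).
have := locally_integrableB i1 i3.
by congr (locally_integrable _ _); apply/funext => x; rewrite /g /= [dR x ^+ 2 * _]mulrC.
Qed.

Let Rinc x y : x <= y -> R y - R x = \int[mu]_(t in `[x, y]) dR t.
Proof.
rewrite le_eqVlt => /predU1P[<-|xy].
  by rewrite subrr set_itv1 Rintegral_set1.
have lp z : lebesgue_pt R z.
  apply: (@continuous_lebesgue_pt _ R z setT) => //.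
  - by split => //; exact: openT.
  - exact: continuous_measurable_fun Rc.
  - exact: Rc.
apply: weak_derivative_increment => //; first exact: continuous_locally_integrable.
move=> phi tphi; have [_ _ /(_ _ tphi) <-] := dRP.
by rewrite /dist_deriv subrr.
Qed.

(** [w] is the continuous representative of the flux: a primitive of the source [g], normalized at
    one Lebesgue point of [u]. The weak equation fixes the increments of [u] between Lebesgue
    points, so [w] agrees with [u] at all of them. *)
Let flux_primitive : exists w : K -> K, [/\ continuous w,
  forall x, lebesgue_pt u x -> u x = w x &
  forall x y, x <= y -> w y - w x = \int[mu]_(t in `[x, y]) g t].
Proof.
have [x1 ux1] := ae_lebesgue_pt_exists ui.
have [P Pc PB] := locally_integrable_primitive gi.
exists (fun x => P x - P x1 + u x1); split.
- move=> x; apply: cvgD; last exact: cvg_cst.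
  by apply: cvgB; [exact: Pc|exact: cvg_cst].
- move=> x ux; have [xx1|xx1|->] := ltgtP x x1; last by ring.
    by have := weak_derivative_increment ui gi weak xx1 ux ux1; rewrite -PB ?ltW//; lra.
  by have := weak_derivative_increment ui gi weak xx1 ux1 ux; rewrite -PB ?ltW//; lra.
- by move=> x y xy; rewrite -PB//; ring.
Qed.

(** Where [a(R) != 0], [dR = w / a(R)] almost everywhere with a continuous right-hand side, so [R]
    and then [w] are classically differentiable. Monotonicity makes the sonic set an interval, and
    excluding plateaus reduces it to one point. *)
Lemma weak_transonic : exists t, transonic a b c Rm Rs Rp R t.
Proof.
have [w [wc uw winc]] := flux_primitive.
have aRc := comp_cont (sd_a_cont SD).
have ae_uw : {ae mu, forall x, u x = w x}.
  move: (lebesgue_differentiation ui); apply: filterS.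
    exact: (ae_filter_ringOfSetsType mu).
  by move=> x; exact: uw.
have loc l r : (forall x, l < x < r -> a (R x) != 0) -> forall z, l < z < r ->
    is_der z R (w z / a (R z)) /\
    is_der z w (b (R z) - c (R z) * (w z / a (R z)) ^+ 2).
  move=> a0 z zI.
  have vc x : l < x < r -> {for x, continuous (fun z => w z / a (R z))}.
    by move=> xI; apply: cvgM; [exact: wc|apply: cvgV; [exact: a0|exact: aRc]].
  have ae_dR : {ae mu, forall x, l < x < r -> dR x = w x / a (R x)}.
    move: ae_uw; apply: filterS; first exact: (ae_filter_ringOfSetsType mu).
    by move=> x <- xI; rewrite /u mulrAC mulfV ?mul1r// a0.
  split.
    apply: (increment_is_der dRi _ vc ae_dR zI).
    by move=> x y _ xy _; exact: Rinc.
  apply: (@increment_is_der _ w g (fun z => b (R z) - c (R z) * (w z / a (R z)) ^+ 2) l r) => //.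
  - by move=> x y _ xy _; exact: winc.
  - move=> x xI; apply: cvgB; first exact: (comp_cont (sd_b_cont SD)).
    apply: cvgM; first exact: (comp_cont (sd_c_cont SD)).
    by rewrite expr2; apply: cvgM; exact: vc.
  - move: ae_dR; apply: filterS; first exact: (ae_filter_ringOfSetsType mu).
    by move=> x E xI; rewrite /g E.
have near_a0 z : a (R z) != 0 -> \forall x \near z, a (R x) != 0.
  by move=> az; apply: (cvgr_neq0 _ (aRc z)).
have cl z : a (R z) != 0 -> is_der z R (w z / a (R z)) /\
    is_der z w (b (R z) - c (R z) * (w z / a (R z)) ^+ 2).
  move=> /near_a0 /nbhs_ballP[e /= e0 He].
  apply: (loc (z - e) (z + e)); last by lra.
  move=> x xI; apply: He; rewrite /ball /= ltr_norml; lra.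
(* On a sonic plateau the flux and [dR] vanish, so the equation would read [b Rs = 0]. *)
have plateau x y : x < y -> R x = Rs -> R y = Rs -> False.
  move=> xy Rx Ry'.
  have RE s : x <= s <= y -> R s = Rs.
    by move=> /andP[xs sy]; apply/le_anti/andP; rewrite -{1}Ry' -Rx; split; exact: Rh.
  have w0 s : x < s < y -> w s = 0.
    move=> sI; have us z : x < z < y -> u z = 0.
      by move=> /andP[xz zy]; rewrite /u RE ?(ltW xz) ?(ltW zy)// (sd_a0 SD) mul0r.
    rewrite -uw ?us//.
    apply: (@continuous_lebesgue_pt _ u s `]x, y[) => //.
    - by have [um _ _] := ui; exact: measurable_funTS.
    - apply: (@is_der_cont _ u s 0); apply: near_eq_der (der_cst 0 s); near=> z.
      by rewrite us//; apply/andP; split; near: z; [apply: lt_nbhsr|apply: lt_nbhsl]; lra.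
  have dR0 : {ae mu, forall s, x < s < y -> dR s = 0}.
    apply: zero_increment_ae0 => // p r xp pr ry.
    by rewrite -Rinc// !RE ?subrr//; lra.
  pose z := (x + y) / 2; have zI : x < z < y by rewrite /z; lra.
  have dw : is_der z w (b Rs).
    apply: (@increment_is_der _ w g (fun=> b Rs) x y) => //.
    - by move=> p r _ pr _; exact: winc.
    - by move=> p _; exact: cvg_cst.
    - move: dR0; apply: filterS; first exact: (ae_filter_ringOfSetsType mu).
      move=> s E sI; rewrite /g E// RE; last by lra.
      by rewrite expr0n mulr0 subr0.
  have : is_der z w 0.
    apply: near_eq_der (der_cst 0 z); near=> s.
    by rewrite w0//; apply/andP; split; near: s; [apply: lt_nbhsr|apply: lt_nbhsl]; lra.
  move=> /is_der_E; rewrite (is_der_E dw) => bs.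
  by have := sd_b_gt0 SD; rewrite bs ltxx.
have /andP[RmRs RsRp] := sd_lt.
have [s0 s0P] : exists s, R s < Rs.
  have : \forall s \near -oo, R s < Rs by exact: (cvgr_lt _ RNy).
  by case=> M [_ HM]; exists (M - 1); apply: HM; lra.
have [s1 s1P] : exists s, Rs < R s.
  have : \forall s \near +oo, Rs < R s by exact: (cvgr_gt _ Ry).
  by case=> M [_ HM]; exists (M + 1); apply: HM; lra.
have s01 : s0 <= s1.
  by rewrite leNgt; apply/negP => /ltW/Rh; lra.
have [||t tI tE] := @IVT _ R s0 s1 Rs s01.
- by apply: within_cont => s _; exact: Rc.
- by rewrite ge_min (ltW s0P) /= le_max (ltW s1P) orbT.
have Rlt s : s < t -> R s < Rs.
  move=> st; rewrite lt_neqAle -{2}tE Rh ?(ltW st)// andbT.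
  by apply/eqP => /plateau -/(_ _ st tE).
have Rgt s : t < s -> Rs < R s.
  move=> st; rewrite lt_neqAle -{2}tE Rh ?(ltW st)// andbT eq_sym.
  by apply/eqP => /(plateau _ _ st tE).
have neq s : s != t -> a (R s) != 0.
  move=> st; apply: sd_a_neq0; first exact: RI.
  by move: st; case: ltgtP => // [/Rlt/lt_eqF->|/Rgt/gt_eqF->].
exists t; split => //.
- by move=> s /neq/cl[/is_der_derivable].
- by move=> s /neq/cl[dRs _]; rewrite (is_der_E dRs); exact: nondecreasing_der_ge0 dRs.
- move=> s /neq as0; have [dRs dws] := cl _ as0.
  rewrite (is_der_E dRs); apply: near_eq_der dws.
  near=> z; have az0 : a (R z) != 0 by near: z; exact: near_a0.
  by have [dRz _] := cl _ az0; rewrite (is_der_E dRz) mulrC divfK.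
Unshelve. all: by end_near. Qed.

End WeakTransonic.
End TransonicProfiles.

(** * Existence and uniqueness of transonic solutions *)

Section TransonicTheory.
Context {K : realType}.
Local Notation mu := (@lebesgue_measure K).
Context (a b c : K -> K) (Rm Rs Rp : K) (SD : sonic_data a b c Rm Rs Rp).

(** For [y(s) = - R(-s)] one has [y'(s) = R'(-s)] and [ra(y) y' = - a(R) R'] at [-s]. The two sign
    changes cancel in the derivative of the flux, so [b] and [c] keep their sign. *)
Let ra (r : K) : K := - a (- r).
Let rb (r : K) : K := b (- r).
Let rc (r : K) : K := c (- r).

Section Halves.
Context (R : K -> K) (t : K) (TS : transonic a b c Rm Rs Rp R t).

Lemma transonic_half_left : half_sol a b c Rm Rs R t.
Proof.
have neq s : s < t -> s != t by move=> /lt_eqF ->.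
split.
- by move=> s st; rewrite (ts_lt TS)//; case/andP: (ts_itv TS s) => ->.
- by move=> s /neq; exact: (ts_der TS).
- by move=> s /neq; exact: (ts_ge0 TS).
- by move=> s /neq; exact: (ts_flux TS).
- exact: (ts_Ny TS).
- by rewrite -(ts_sonic TS); apply: cvg_at_left_filter; exact: (ts_cont TS).
Qed.

Lemma reflect_der s : s != - t ->
  is_der s (fun z => - R (- z)) (derive1 R (- s)).
Proof.
move=> st; have d : is_der (- s) R (derive1 R (- s)).
  by apply/derivable_is_der/(ts_der TS); rewrite eqr_oppLR.
apply: der_eq; first by apply: derN; apply: der_comp d _; der.
by rewrite /=; ring.
Qed.

Lemma transonic_half_right : half_sol ra rb rc (- Rp) (- Rs) (fun s => - R (- s)) (- t).
Proof.
have neq s : s < - t -> s != - t by move=> /lt_eqF ->.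
have gt s : s < - t -> t < - s by rewrite ltrNr.
have dE s : s != - t -> derive1 (fun z => - R (- z)) s = derive1 R (- s).
  by move=> /reflect_der/is_der_E.
split.
- move=> s st; rewrite lerN2 ltrN2 (ts_gt TS) ?gt//.
  by case/andP: (ts_itv TS (- s)) => _ ->.
- by move=> s /neq/reflect_der/is_der_derivable.
- move=> s /neq st; rewrite dE//; apply: (ts_ge0 TS).
  by rewrite eqr_oppLR.
- move=> s st; rewrite (dE _ (neq _ st)) /rb /rc !opprK.
  have nst : - s != t by rewrite gt_eqF// gt.
  have d : is_der s (fun z => - (a (R (- z)) * derive1 R (- z)))
      (b (R (- s)) - c (R (- s)) * derive1 R (- s) ^+ 2).
    apply: der_eq.
      apply: derN; apply: (@der_comp _ (fun z => a (R z) * derive1 R z)); last by der.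
      exact: (ts_flux TS nst).
    by rewrite /=; ring.
  apply: near_eq_der d; near=> z; rewrite /ra opprK mulNr dE// neq//.
  by near: z; exact: lt_nbhsl.
- by apply: cvgN; apply/cvgNy_compNP; apply: cvg_trans (ts_y TS); apply: near_eq_cvg;
    near=> z; rewrite /= opprK.
- rewrite -(ts_sonic TS) -{2}(opprK t); apply: cvg_at_left_filter.
  apply: (@cvgN _ _ _ _ _ (fun s => R (- s)) (R (- - t))).
  by apply: (@continuous_comp _ _ _ -%R R (- t)); [exact: oppr_continuous|exact: (ts_cont TS)].
Unshelve. all: by end_near. Qed.

End Halves.

Theorem transonic_exists : exists R, transonic a b c Rm Rs Rp R 0.
Proof.
have [l0 Hl] := sd_left SD; have [l1 Hr] := sd_right SD.
have [x Sx] := half_sol_exists Hl; have [y Sy] := half_sol_exists Hr.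
have /andP[RmRs RsRp] := sd_lt SD.
(* At the junction only continuity is to be checked, since [transonic] asks for no derivative
   there. *)
pose R s := if s < 0 then x s else if s == 0 then Rs else - y (- s).
have RE0 : R 0 = Rs by rewrite /R ltxx eqxx.
have REl (s : K) : s < 0 -> R s = x s by rewrite /R => ->.
have REr (s : K) : 0 < s -> R s = - y (- s) by move=> s0; rewrite /R ltNge ltW//= gt_eqF.
have near_l (s : K) : s < 0 -> \forall z \near s, x z = R z.
  by move=> s0; near=> z; rewrite REl//; near: z; exact: lt_nbhsl.
have near_r (s : K) : 0 < s -> \forall z \near s, - y (- z) = R z.
  by move=> s0; near=> z; rewrite REr//; near: z; exact: lt_nbhsr.
have dRl (s : K) : s < 0 -> is_der s R (derive1 x s).
  move=> s0; apply: near_eq_der (near_l _ s0) _.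
  exact/derivable_is_der/(hs_der Sx).
have dRr (s : K) : 0 < s -> is_der s R (derive1 y (- s)).
  move=> s0; apply: near_eq_der (near_r _ s0) _.
  have s0' : - s < 0 by rewrite oppr_lt0.
  have d := derivable_is_der (hs_der Sy s0').
  apply: der_eq; first by apply: derN; apply: der_comp d _; der.
  by rewrite /=; ring.
have yI (s : K) : 0 < s -> Rs < - y (- s) <= Rp.
  by move=> s0; have := hs_itv Sy (s := - s); rewrite oppr_lt0 s0 => /(_ isT); lra.
exists R; split => //.
- move=> s; case: (ltgtP s 0) => [s0|s0|->].
  + exact: is_der_cont (dRl _ s0).
  + exact: is_der_cont (dRr _ s0).
  + apply/left_right_continuousP; rewrite RE0; split.
      apply: cvg_trans (hs_left Sx); apply: near_eq_cvg; near=> z.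
      by rewrite REl//; near: z; exact: nbhs_left_lt.
    apply/cvgrPdist_lt => e e0.
    have := hs_left Sy => /cvgrPdist_lt /(_ _ e0) [d /= d0 Hd].
    near=> z; have z0 : 0 < z by near: z; exact: nbhs_right_gt.
    have zd : z < d by near: z; exact: nbhs_right_lt.
    have := Hd (- z); rewrite /ball_ /= sub0r opprK gtr0_norm// oppr_lt0 z0 => /(_ zd isT).
    by rewrite REr// -normrN; congr (_ < _); congr (`|_|); ring.
- move=> s; case: (ltgtP s 0) => [s0|s0|->].
  + by rewrite REl//; have := hs_itv Sx s0; lra.
  + by rewrite REr//; have := yI _ s0; lra.
  + by rewrite RE0 ltW// ltW.
- by move=> s s0; rewrite REl//; case/andP: (hs_itv Sx s0).
- by move=> s s0; rewrite REr//; case/andP: (yI _ s0).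
- by move=> s; case: (ltgtP s 0) => // [/dRl|/dRr] /is_der_derivable.
- move=> s; case: (ltgtP s 0) => // s0 _.
    by rewrite (is_der_E (dRl _ s0)) (hs_ge0 Sx).
  by rewrite (is_der_E (dRr _ s0)) (hs_ge0 Sy)// oppr_lt0.
- move=> s; case: (ltgtP s 0) => // s0 _.
    rewrite REl// (is_der_E (dRl _ s0)); apply: near_eq_der (hs_flux Sx s0).
    near=> z; have z0 : z < 0 by near: z; exact: lt_nbhsl.
    by rewrite REl// (is_der_E (dRl _ z0)).
  rewrite REr// (is_der_E (dRr _ s0)).
  have s0' : - s < 0 by rewrite oppr_lt0.
  apply: (@near_eq_der _ (fun z => - (ra (y (- z)) * derive1 y (- z)))).
    near=> z; have z0 : 0 < z by near: z; exact: lt_nbhsr.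
    by rewrite REr// (is_der_E (dRr _ z0)) /ra mulNr opprK.
  apply: der_eq.
    apply: derN; apply: (@der_comp _ (fun z => ra (y z) * derive1 y z)); last by der.
    exact: (hs_flux Sy s0').
  by rewrite /=; ring.
- apply: cvg_trans (hs_Ny Sx); apply: near_eq_cvg; near=> z.
  by rewrite REl//; near: z; apply: nbhs_ninfty_lt; exact: num_real.
- rewrite -(opprK Rp); apply/cvgy_compNP.
  apply: cvg_trans (cvgN (hs_Ny Sy)); apply: near_eq_cvg; near=> z.
  rewrite /= REr ?opprK// oppr_gt0.
  by near: z; apply: nbhs_ninfty_lt; exact: num_real.
Unshelve. all: by end_near. Qed.

(** The two sides are compared separately, each through its own injective [T], after aligning the
    crossings. *)
Theorem transonic_unique R1 R2 t1 t2 :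
  transonic a b c Rm Rs Rp R1 t1 -> transonic a b c Rm Rs Rp R2 t2 ->
  forall s, R2 s = R1 (s - (t2 - t1)).
Proof.
move=> S1 S2 s.
have [l0 Hl] := sd_left SD; have [l1 Hr] := sd_right SD.
have inj (T : K -> K) lo hi : (forall r s, lo < r -> r < s -> s < hi -> T r < T s) ->
    forall p q, lo < p < hi -> lo < q < hi -> T p = T q -> p = q.
  move=> Tlt p q /andP[lp ph] /andP[lq qh] pq; case: (ltgtP p q) => // h.
    by have := Tlt _ _ lp h qh; rewrite pq ltxx.
  by have := Tlt _ _ lq h ph; rewrite pq ltxx.
have [st|st|->] := ltgtP s t2; last first.
- by rewrite opprB addrC subrK (ts_sonic S1) (ts_sonic S2).
- have [T [Tlt TP]] := half_sol_unique Hr.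
  have [P1 _] := TP _ _ (transonic_half_right S1).
  have [P2 _] := TP _ _ (transonic_half_right S2).
  have h2 : - s < - t2 by rewrite ltrN2.
  have h1 : - (s - (t2 - t1)) < - t1 by lra.
  have [l2' _ E2] := P2 _ h2; have [l1' _ E1] := P1 _ h1.
  apply: oppr_inj; rewrite -[s in LHS]opprK -[X in R1 X]opprK.
  apply: (inj T _ _ Tlt).
  + by rewrite l2'; case/andP: (hs_itv (transonic_half_right S2) h2).
  + by rewrite l1'; case/andP: (hs_itv (transonic_half_right S1) h1).
  + by rewrite E1 E2; ring.
- have [T [Tlt TP]] := half_sol_unique Hl.
  have [P1 _] := TP _ _ (transonic_half_left S1).
  have [P2 _] := TP _ _ (transonic_half_left S2).
  have h1 : s - (t2 - t1) < t1 by lra.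
  have [l2' _ E2] := P2 _ st; have [l1' _ E1] := P1 _ h1.
  apply: (inj T _ _ Tlt).
  + by rewrite l2'; case/andP: (hs_itv (transonic_half_left S2) st).
  + by rewrite l1'; case/andP: (hs_itv (transonic_half_left S1) h1).
  + by rewrite E1 E2; ring.
Qed.

Section TransonicWeak.
Context (R : K -> K) (t : K) (TS : transonic a b c Rm Rs Rp R t).

Let comp_cont (h : K -> K) : (forall r, Rm <= r <= Rp -> {for r, continuous h}) ->
  continuous (fun x => h (R x)).
Proof. by move=> hc x; apply: continuous_comp; [exact: (ts_cont TS)|exact/hc/(ts_itv TS)]. Qed.

Lemma transonic_der s : s != t -> is_der s R (derive1 R s).
Proof. by move=> /(ts_der TS)/derivable_is_der. Qed.

Lemma transonic_der_gt0 s : s != t -> 0 < derive1 R s.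
Proof.
have [l0 Hl] := sd_left SD; have [l1 Hr] := sd_right SD.
case: (ltgtP s t) => // st _.
  have [T [_ TP]] := half_sol_unique Hl.
  by have [P1 _] := TP _ _ (transonic_half_left TS); have [] := P1 _ st.
have [T [_ TP]] := half_sol_unique Hr.
have [P1 _] := TP _ _ (transonic_half_right TS).
have st' : - s < - t by rewrite ltrN2.
have [_ + _] := P1 _ st'; rewrite (is_der_E (reflect_der TS _)) ?opprK//.
by rewrite lt_eqF.
Qed.

Lemma transonic_lt x y : x < y -> R x < R y.
Proof.
have half l r : (forall s, l < s < r -> s != t) -> l < r -> R l < R r.
  move=> neq lr; have [||z zI zE] := @der_mvt _ R (derive1 R) l r lr.
  - by move=> s /neq/transonic_der.
  - by apply: within_cont => s _; exact: (ts_cont TS).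
  by rewrite -subr_gt0 zE mulr_gt0 ?subr_gt0// transonic_der_gt0// neq.
move=> xy; have [xt|tx] := ltP x t; have [ty|yt] := ltP t y.
- apply: (@lt_trans _ _ (R t)); apply: half => // s /andP[h1 h2].
    by rewrite lt_eqF.
  by rewrite gt_eqF.
- by apply: half => // s /andP[h1 h2]; rewrite lt_eqF// (lt_le_trans h2).
- by apply: half => // s /andP[h1 h2]; rewrite gt_eqF// (le_lt_trans tx).
- by apply: half => // s /andP[h1 h2]; rewrite gt_eqF// (le_lt_trans tx).
Qed.

(** At [t] the factor [a Rs = 0] kills the junk value of [derive1 R t], and both one-sided limits of
    the flux are 0. *)
Lemma transonic_flux_cont : continuous (fun z => a (R z) * derive1 R z).
Proof.
have [l0 Hl] := sd_left SD; have [l1 Hr] := sd_right SD.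
move=> s; have [->|st] := eqVneq s t; last exact: is_der_cont (ts_flux TS st).
apply/left_right_continuousP; rewrite (ts_sonic TS) (sd_a0 SD) mul0r; split.
  have [T [_ TP]] := half_sol_unique Hl.
  by have [_] := TP _ _ (transonic_half_left TS).
have [T [_ TP]] := half_sol_unique Hr.
have [_ cv] := TP _ _ (transonic_half_right TS).
apply/cvgrPdist_lt => e e0; have := cv => /cvgrPdist_lt /(_ _ e0) [d /= d0 Hd].
near=> z; have z0 : t < z by near: z; exact: nbhs_right_gt.
have zd : z < t + d by near: z; apply: nbhs_right_lt; lra.
have := Hd (- z); rewrite /ball_ /= opprK addrC gtr0_norm ?subr_gt0// ltrN2 z0.
have -> : z - t < d by lra.
move=> /(_ isT isT); rewrite (is_der_E (reflect_der TS _)); last by rewrite lt_eqF// ltrN2.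
by rewrite opprK /ra opprK mulNr opprK add0r => h; rewrite sub0r normrN.
Unshelve. all: by end_near. Qed.

End TransonicWeak.
End TransonicTheory.

(** * Transonic solutions are weak solutions *)

Section ClassicalToWeak.
Context {K : realType}.
Local Notation mu := (@lebesgue_measure K).

Lemma integrable_itv_cat (f : K -> K) (x y z : K) : x <= y -> y <= z ->
  mu.-integrable `[x, y] (EFin \o f) -> mu.-integrable `[y, z] (EFin \o f) ->
  mu.-integrable `[x, z] (EFin \o f).
Proof.
move=> xy yz i1 i2.
have i3 : mu.-integrable `]y, z] (EFin \o f).
  by apply: integrableS i2 => //; apply: subset_itv; rewrite bnd_simp.
have E : `[x, z] = `[x, y] `|` `]y, z] :> set K.
  by rewrite -itv_bndbnd_setU// bnd_simp.
have mf : measurable_fun (`[x, y] `|` `]y, z]) (EFin \o f).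
  by apply/measurable_funU => //; split; [case/integrableP: i1|case/integrableP: i3].
rewrite E; apply/integrableP; split => //.
rewrite ge0_integral_setU//.
- by apply: lte_add_pinfty; [case/integrableP: i1|case/integrableP: i3].
- exact: measurableT_comp.
- apply/disj_setPS => w [] /=; rewrite !in_itv /= => /andP[_ wy] /andP[yw _].
  by move: wy; rewrite leNgt yw.
Qed.

Lemma measurable_off_point (f : K -> K) (t : K) : (forall s, s != t -> {for s, continuous f}) ->
  measurable_fun setT f.
Proof.
move=> fc.
have E : [set: K] = `]-oo, t[ `|` `[t, t] `|` `]t, +oo[.
  apply/seteqP; split => // s _ /=; rewrite !in_itv /= andbT.
  by case: (ltgtP s t) => h; [left; left|right|left; right].
have m1 : measurable_fun (`]-oo, t[ `|` `[t, t]) f.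
  apply/measurable_funU => //; split.
    apply: open_continuous_measurable_fun; first exact: interval_open.
    by move=> s; rewrite inE /= in_itv /= => st; apply: fc; rewrite lt_eqF.
  rewrite set_itv1; exact: measurable_fun_set1.
have m2 : measurable_fun `]t, +oo[ f.
  apply: open_continuous_measurable_fun; first exact: interval_open.
  by move=> s; rewrite inE /= in_itv /= andbT => st; apply: fc; rewrite gt_eqF.
by rewrite E; apply/measurable_funU => //; exact: measurableU.
Qed.

Lemma continuous_sqr (f : K -> K) (x : K) : {for x, continuous f} ->
  {for x, continuous (fun y => f y ^+ 2)}.
Proof. by move=> fc; apply: continuous_comp fc (@exprn_continuous _ 2 _). Qed.

Context (a b c : K -> K) (Rm Rs Rp : K) (SD : sonic_data a b c Rm Rs Rp).
Context (R : K -> K) (t : K) (TS : transonic a b c Rm Rs Rp R t).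

Lemma transonic_comp_cont (h : K -> K) : (forall r, Rm <= r <= Rp -> {for r, continuous h}) ->
  continuous (fun x => h (R x)).
Proof. by move=> hc x; apply: continuous_comp; [exact: (ts_cont TS)|exact/hc/(ts_itv TS)]. Qed.

Lemma transonic_neq_sonic s : s != t -> R s != Rs.
Proof.
case: (ltgtP s t) => // st _; first by rewrite lt_eqF// (ts_lt TS).
by rewrite gt_eqF// (ts_gt TS).
Qed.

Lemma transonic_a_neq0 s : s != t -> a (R s) != 0.
Proof. by move=> /transonic_neq_sonic; apply: (sd_a_neq0 SD); exact: (ts_itv TS). Qed.

(** Off the crossing [R'] is the continuous flux divided by [a(R)]. *)
Lemma transonic_der_cont s : s != t -> {for s, continuous (derive1 R)}.
Proof.
move=> st.
have qc : {for s, continuous (fun z => a (R z) * derive1 R z / a (R z))}.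
  apply: cvgM; first exact: (transonic_flux_cont SD TS).
  apply: cvgV; first exact: transonic_a_neq0.
  exact: (transonic_comp_cont (sd_a_cont SD)).
have qE z : z != t -> a (R z) * derive1 R z / a (R z) = derive1 R z.
  by move=> zt; rewrite mulrAC mulfV ?mul1r// transonic_a_neq0.
rewrite /prop_for /continuous_at -(qE s st).
apply: cvg_trans qc; apply: near_eq_cvg.
case: (ltgtP s t) st => // h _; near=> z; apply: qE.
  by rewrite lt_eqF//; near: z; exact: lt_nbhsl.
by rewrite gt_eqF//; near: z; exact: lt_nbhsr.
Unshelve. all: by end_near. Qed.

Lemma transonic_der_measurable : measurable_fun setT (derive1 R).
Proof. by apply: (@measurable_off_point _ t) => s; exact: transonic_der_cont. Qed.

(* [c(R) R'^2 = b(R) - (a(R) R')'] is a nonnegative derivative of a function that is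
   continuous up to the crossing, where [R'] may blow up; hence it is integrable. *)
Lemma transonic_der_sqr : locally_integrable setT (fun s => derive1 R s ^+ 2).
Proof.
have bc := transonic_comp_cont (sd_b_cont SD).
have [||||B dB] := @continuous_primitive _ (fun s => b (R s)) setT 0 => //.
- exact: openT.
- by move=> x _; exact: bc.
pose F s := B s - a (R s) * derive1 R s.
pose f s := c (R s) * derive1 R s ^+ 2.
have Fc : continuous F.
  by move=> s; apply: cvgB; [exact: is_der_cont (dB s I)|exact: (transonic_flux_cont SD TS)].
have dF s : s != t -> is_der s F (f s).
  move=> st; have := ts_flux TS st; have := dB s I => dBs dw.
  by apply: der_eq; [exact: derD dBs (derN dw)|rewrite /f; ring].
have fc s : s != t -> {for s, continuous f}.
  move=> st; apply: cvgM; first exact: (transonic_comp_cont (sd_c_cont SD)).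
  by apply: continuous_sqr; exact: transonic_der_cont.
have f0 s : 0 <= f s by rewrite mulr_ge0 ?sqr_ge0 ?ltW// (sd_c_gt0 SD)// (ts_itv TS).
have fi : locally_integrable setT f.
  apply: itv_locally_integrable.
    by apply: (@measurable_off_point _ t).
  move=> N N0; pose N' := Num.max N (`|t| + 1).
  have tN : `|t| < N' by rewrite lt_max ltrDl ltr01 orbT.
  have NN : N <= N' by rewrite le_max lexx.
  move: (tN); rewrite ltr_norml => /andP[tl tr].
  apply: (@integrable_itvS _ f (- N') N'); rewrite ?lerN2//.
  apply: (integrable_itv_cat (ltW tl) (ltW tr)).
    apply: (@ge0_derivative_integrable _ f F) => //.
    - by apply: within_cont => s _; exact: Fc.
    - by move=> s /andP[_ st]; apply: dF; rewrite lt_eqF.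
    - by move=> s /andP[_ st]; apply: fc; rewrite lt_eqF.
  apply: (@ge0_derivative_integrable _ f F) => //.
  - by apply: within_cont => s _; exact: Fc.
  - by move=> s /andP[st _]; apply: dF; rewrite gt_eqF.
  - by move=> s /andP[st _]; apply: fc; rewrite gt_eqF.
have icc : continuous (fun s => (c (R s))^-1).
  move=> s; apply: cvgV; last exact: (transonic_comp_cont (sd_c_cont SD)).
  by rewrite gt_eqF// (sd_c_gt0 SD)// (ts_itv TS).
have := locally_integrableMr fi icc.
congr (locally_integrable _ _); apply/funext => s.
by rewrite /f mulrAC mulfV ?mul1r// gt_eqF// (sd_c_gt0 SD)// (ts_itv TS).
Qed.

Lemma continuous_L2_loc (f : K -> K) : continuous f -> L2_loc f.
Proof.
move=> fc; split; first exact: continuous_measurable_fun.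
by apply: continuous_locally_integrable => x; exact/continuous_sqr/fc.
Qed.

(** Serves [R], [U] and [S] alike, which are all [C^1] functions of the density. *)
Lemma transonic_W12 (h h' : K -> K) :
  (forall r, Rm <= r <= Rp -> is_der r h (h' r)) ->
  (forall r, Rm <= r <= Rp -> {for r, continuous h'}) ->
  W12_loc_deriv (fun s => h (R s)) (fun s => h' (R s) * derive1 R s).
Proof.
move=> dh h'c.
have hc : continuous (fun s => h (R s)).
  by apply: transonic_comp_cont => r rI; exact: is_der_cont (dh _ rI).
have h'Rc := transonic_comp_cont h'c.
have mg : measurable_fun setT (fun s => h' (R s) * derive1 R s).
  apply: measurable_funM; last exact: transonic_der_measurable.
  exact: continuous_measurable_fun.
have g2 : locally_integrable setT (fun s => (h' (R s) * derive1 R s) ^+ 2).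
  have h2c : continuous (fun s => h' (R s) ^+ 2).
    by move=> s; exact/continuous_sqr/h'Rc.
  have := locally_integrableMr transonic_der_sqr h2c.
  by congr (locally_integrable _ _); apply/funext => s; rewrite exprMn mulrC.
split; [exact: continuous_L2_loc|by []|].
move=> phi tphi; apply: (integration_by_parts_test (x0 := t) hc) => //.
- move=> s st; apply: der_comp; first exact/dh/(ts_itv TS).
  exact/derivable_is_der/(ts_der TS).
- by move=> s st; apply: cvgM; [exact: h'Rc|exact: transonic_der_cont].
- exact: locally_integrable_sqr.
Qed.

Lemma transonic_source_integrable :
  locally_integrable setT (fun s => b (R s) - c (R s) * derive1 R s ^+ 2).
Proof.
have i1 := continuous_locally_integrable (transonic_comp_cont (sd_b_cont SD)).
have i2 := locally_integrableMr transonic_der_sqr (transonic_comp_cont (sd_c_cont SD)).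
have := locally_integrableB i1 i2.
by congr (locally_integrable _ _); apply/funext => s /=; rewrite [_ ^+ 2 * _]mulrC.
Qed.

Lemma transonic_weak phi : test_function phi ->
  \int[mu]_x (a (R x) * derive1 R x * derive1 phi x)
  + \int[mu]_x ((b (R x) - c (R x) * derive1 R x ^+ 2) * phi x) = 0.
Proof.
move=> tphi; rewrite -(@integration_by_parts_test _ (fun x => a (R x) * derive1 R x)
  (fun x => b (R x) - c (R x) * derive1 R x ^+ 2) phi t) //.
- by rewrite /dist_deriv subrr.
- exact: (transonic_flux_cont SD TS).
- exact: (ts_flux TS).
- move=> s st; apply: cvgB; first exact: (transonic_comp_cont (sd_b_cont SD)).
  apply: cvgM; first exact: (transonic_comp_cont (sd_c_cont SD)).
  by apply: continuous_sqr; exact: transonic_der_cont.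
- exact: transonic_source_integrable.
Qed.

End ClassicalToWeak.

(** * The reduced pressure law *)

Section Regularity.
Context {K : realType}.
Context (a b c : K -> K) (Rm Rs Rp : K) (SD : sonic_data a b c Rm Rs Rp).
Context (R : K -> K) (t : K) (TS : transonic a b c Rm Rs Rp R t).

Lemma transonic_C2 (a' : K -> K) :
  (forall r, Rm <= r <= Rp -> is_der r a (a' r)) ->
  (forall r, Rm <= r <= Rp -> {for r, continuous a'}) ->
  C2_on (`]-oo, t[ `|` `]t, +oo[) R.
Proof.
move=> da a'c.
(* The equation [(a(R) R')' = b - c R'^2] solved for [R'']. *)
pose R2 s := (b (R s) - c (R s) * derive1 R s ^+ 2 - a' (R s) * derive1 R s ^+ 2) / a (R s).
have dR2 s : s != t -> is_der s (derive1 R) (R2 s).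
  move=> st; have as0 := transonic_a_neq0 SD TS st.
  have dRs := derivable_is_der (ts_der TS st).
  have daR : is_der s (fun z => a (R z)) (a' (R s) * derive1 R s).
    by apply: der_comp dRs; exact/da/(ts_itv TS).
  have d := derM (ts_flux TS st) (derV as0 daR).
  have {}d : is_der s (fun z => a (R z) * derive1 R z * (a (R z))^-1) (R2 s).
    by apply: der_eq d _; rewrite /R2; field.
  apply: near_eq_der d; case: (ltgtP s t) st => // st _; near=> z.
    rewrite mulrAC mulfV ?mul1r// (transonic_a_neq0 SD TS)// lt_eqF//.
    by near: z; exact: lt_nbhsl.
  rewrite mulrAC mulfV ?mul1r// (transonic_a_neq0 SD TS)// gt_eqF//.
  by near: z; exact: lt_nbhsr.
have R2c s : s != t -> {for s, continuous R2}.
  move=> st; have vc := continuous_sqr (transonic_der_cont SD TS st).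
  apply: cvgM; last first.
    apply: cvgV; first exact: (transonic_a_neq0 SD TS st).
    exact: (transonic_comp_cont TS (sd_a_cont SD)).
  apply: cvgB; last by apply: cvgM; [exact: (transonic_comp_cont TS a'c)|exact: vc].
  apply: cvgB; first exact: (transonic_comp_cont TS (sd_b_cont SD)).
  by apply: cvgM; [exact: (transonic_comp_cont TS (sd_c_cont SD))|exact: vc].
move=> s sD; have st : s != t.
  by case: sD => /=; rewrite in_itv /= ?andbT => h; [rewrite lt_eqF|rewrite gt_eqF].
split; first exact: (ts_der TS).
  exact: is_der_derivable (dR2 _ st).
rewrite /prop_for /continuous_at (is_der_E (dR2 _ st)).
apply: cvg_trans (R2c _ st); apply: near_eq_cvg.
case: (ltgtP s t) st => // st _; near=> z; apply/esym/is_der_E/dR2.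
  by rewrite lt_eqF//; near: z; exact: lt_nbhsl.
by rewrite gt_eqF//; near: z; exact: lt_nbhsr.
Unshelve. all: by end_near. Qed.

End Regularity.

(** * Balance laws and the coefficients of the profile equation *)

Section Physical.
Context {K : realType}.
Local Notation mu := (@lebesgue_measure K).

Lemma Rintegral_test_derive1 (phi : K -> K) : test_function phi ->
  \int[mu]_x derive1 phi x = 0.
Proof.
move=> tphi.
have h := @integration_by_parts_test K (fun=> 1) (fun=> 0) phi 0
  (fun x => cvg_cst _) (fun x _ => der_cst 1 x) (fun x _ => cvg_cst _)
  (continuous_locally_integrable (fun x => cvg_cst _)) tphi.
have E0 : \int[mu]_x (0 * phi x) = 0.
  by under eq_Rintegral do rewrite mul0r; rewrite /Rintegral integral0.
have E1 : \int[mu]_x (1 * derive1 phi x) = \int[mu]_x derive1 phi x.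
  by apply: eq_Rintegral => x _; rewrite mul1r.
by apply: oppr_inj; rewrite oppr0 -E1 -[RHS]E0; exact: h.
Qed.

(** The three conservation laws reduce to this case: each flux is [c] times its density plus a
    constant, and constants have zero distributional derivative. *)
Lemma dist_balance_cst (v : K) (f g : K -> K) (l : K) : continuous f ->
  (forall x, g x = v * f x + l) -> dist_balance v f g.
Proof.
move=> fc gE; have fi := continuous_locally_integrable fc.
have gc : continuous g.
  rewrite (_ : g = fun x => v * f x + l); last exact/funext.
  by move=> x; apply: cvgD; [apply: cvgM; [exact: cvg_cst|exact: fc]|exact: cvg_cst].
split => //; first exact: continuous_locally_integrable.
move=> phi tphi; have [_ _ dphic] := test_function_der tphi.
have [N _ HN] := test_function_support tphi.
have i1 : mu.-integrable setT (EFin \o (fun x => f x * derive1 phi x)).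
  by apply: (integrable_test fi dphic (N := N)) => x /HN[].
have i2 : mu.-integrable setT (EFin \o derive1 phi).
  apply: (@integrable_support _ _ N) => [x /HN[]//|].
  by apply: continuous_itv_integrable => x _; exact: dphic.
rewrite /dist_deriv.
have -> : \int[mu]_x (g x * derive1 phi x) =
    v * \int[mu]_x (f x * derive1 phi x) + l * \int[mu]_x derive1 phi x.
  rewrite -!RintegralZl// -RintegralD//.
  - by apply: eq_Rintegral => x _; rewrite gE; ring.
  - by apply: (integrableZl _ v i1).
  - by apply: (integrableZl _ l i2).
by rewrite Rintegral_test_derive1//; ring.
Qed.

Context (alpha : K) (pt : K -> K -> K) (c m q k : K) (Rm Rp Rs : K).
Let p := pressure_red pt c m q k.
Let Sr := Sred pt c m q k.
Context (alpha_gt0 : 0 < alpha) (m_neq0 : m != 0) (Rm_gt0 : 0 < Rm).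
Context (Rs_itv : Rm < Rs < Rp) (p_C2 : C2_on `]0, +oo[ p).
Context (ddp_ge0 : forall r, 0 < r -> 0 <= derive1 (derive1 p) r).
Context (SrRm : Sr Rm = 0) (SrRp : Sr Rp = 0) (Rs_sonic : derive1 Sr Rs = 0).

Let S1 r := m ^+ 2 / r ^+ 2 - derive1 p r.
Let S2 r := - (2 * m ^+ 2 / r ^+ 3) - derive1 (derive1 p) r.

Let m2 : 0 < m ^+ 2. Proof. by rewrite exprn_even_gt0. Qed.
Let Rs_gt0 : 0 < Rs. Proof. by case/andP: Rs_itv => /(lt_trans Rm_gt0). Qed.

Let pP r : 0 < r -> [/\ is_der r p (derive1 p r), is_der r (derive1 p) (derive1 (derive1 p) r)
  & {for r, continuous (derive1 (derive1 p))}].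
Proof.
move=> r0; have [|d1 d2 c2] := p_C2 (x := r); first by rewrite /= in_itv /= r0.
by split; [exact: (derivable_is_der d1)|exact: (derivable_is_der d2)|exact: c2].
Qed.

Lemma Sred_der r : 0 < r -> is_der r Sr (S1 r).
Proof.
move=> r0; have [dp _ _] := pP r0; have rn0 := lt0r_neq0 r0.
have dV : is_der r (fun y => y^-1) (- 1 / r ^+ 2) by apply: derV; [|exact: der_id].
have -> : Sr = fun y => q - m * c - m ^+ 2 * y^-1 - p y by [].
by apply: der_eq; [der|rewrite /S1 /=; field].
Qed.

Lemma Sred_der1 r : 0 < r -> is_der r (derive1 Sr) (S2 r).
Proof.
move=> r0; have [_ d2p _] := pP r0; have rn0 := lt0r_neq0 r0.
have dV : is_der r (fun y => (y ^+ 2)^-1) (- (2 * r) / r ^+ 2 ^+ 2).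
  apply: der_eq; first by apply: derV; [rewrite expf_neq0|apply: derX; exact: der_id].
  by rewrite /=; field.
apply: (@near_eq_der _ S1).
  by near=> y; rewrite (is_der_E (Sred_der _))//; near: y; exact: lt_nbhsr.
have -> : S1 = fun y => m ^+ 2 * (y ^+ 2)^-1 - derive1 p y by [].
by apply: der_eq; [der|rewrite /S2 /=; field].
Unshelve. all: by end_near. Qed.

Lemma Sred_der2_cont r : 0 < r -> {for r, continuous S2}.
Proof.
move=> r0; have [_ _ d2c] := pP r0; apply: cvgB; last exact: d2c.
have dV := derV (f := fun y => y ^+ 3) (expf_neq0 3 (lt0r_neq0 r0)) (derX 3 (der_id r)).
exact: is_der_cont (derN (derM (der_cst (2 * m ^+ 2) r) dV)).
Qed.

(** Strictness comes from [m != 0]; [p''] may vanish. *)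
Lemma Sred_der2_lt0 r : 0 < r -> S2 r < 0.
Proof.
move=> r0; rewrite /S2; have := ddp_ge0 r0.
have : 0 < 2 * m ^+ 2 / r ^+ 3 by rewrite divr_gt0 ?exprn_gt0// mulr_gt0.
lra.
Qed.

Lemma Sred_der1_lt r s : 0 < r -> r < s -> derive1 Sr s < derive1 Sr r.
Proof.
move=> r0 rs; rewrite -ltrN2.
apply: (@der_gt0_lt _ (fun r => - derive1 Sr r) (fun r => - S2 r) _ _ rs) => x /andP[rx xs].
  by apply/derN/Sred_der1/(lt_le_trans r0).
by rewrite oppr_gt0 Sred_der2_lt0// (lt_trans r0).
Qed.

Definition igr_a r := alpha * (derive1 Sr r / r).
Definition igr_b r := Sr r / r.
(** Since [U' = - m R' / R^2], this is the coefficient of [R'^2] in [2 alpha U'^2]. *)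
Definition igr_c (r : K) := 2 * alpha * (m ^+ 2 / r ^+ 4).

Definition igr_a' r := alpha * (S2 r / r - derive1 Sr r / r ^+ 2).

Lemma igr_a_der r : 0 < r -> is_der r igr_a (igr_a' r).
Proof.
move=> r0; have d1 := Sred_der1 r0; have rn0 := lt0r_neq0 r0.
have dV : is_der r (fun y => y^-1) (- 1 / r ^+ 2) by apply: derV; [|exact: der_id].
by rewrite /igr_a; apply: der_eq; [der|rewrite /igr_a' /=; field].
Qed.

Lemma igr_a'_cont r : 0 < r -> {for r, continuous igr_a'}.
Proof.
move=> r0; have d1 := Sred_der1 r0; have rn0 := lt0r_neq0 r0.
have dV : is_der r (fun y => y^-1) (- 1 / r ^+ 2) by apply: derV; [|exact: der_id].
apply: cvgM; first exact: cvg_cst.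
apply: cvgB.
  by apply: cvgM; [exact: Sred_der2_cont|exact: is_der_cont dV].
have dV2 := derV (f := fun y => y ^+ 2) (expf_neq0 2 rn0) (derX 2 (der_id r)).
exact: is_der_cont (derM d1 dV2).
Qed.

Lemma igr_b_cont r : 0 < r -> {for r, continuous igr_b}.
Proof.
move=> r0; have dV := derV (f := id) (lt0r_neq0 r0) (der_id r).
exact: is_der_cont (derM (Sred_der r0) dV).
Qed.

Lemma igr_c_cont r : 0 < r -> {for r, continuous igr_c}.
Proof.
move=> r0; have dV := derV (f := fun y => y ^+ 4) (expf_neq0 4 (lt0r_neq0 r0)) (derX 4 (der_id r)).
exact: is_der_cont (derM (der_cst (2 * alpha) r) (derM (der_cst (m ^+ 2) r) dV)).
Qed.

Lemma igr_c_gt0 r : 0 < r -> 0 < igr_c r.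
Proof.
move=> r0; apply: mulr_gt0; first exact: mulr_gt0.
by apply: divr_gt0; [exact: m2|exact: exprn_gt0].
Qed.

Lemma igr_c_le r s : 0 < r -> r <= s -> igr_c s <= igr_c r.
Proof.
move=> r0 rs; have s0 := lt_le_trans r0 rs.
rewrite /igr_c ler_pM2l ?mulr_gt0// ler_pM2l// lef_pV2 ?posrE ?exprn_gt0//.
by rewrite lerXn2r// nnegrE ltW.
Qed.

Lemma Sred_der1_sign r : 0 < r -> (r < Rs -> 0 < derive1 Sr r) /\ (Rs < r -> derive1 Sr r < 0).
Proof.
move=> r0; split=> rs; rewrite -Rs_sonic; exact: Sred_der1_lt.
Qed.

(** By concavity [S] increases from 0 up to [Rs] and then decreases back to 0. *)
Lemma Sred_gt0 r : Rm < r < Rp -> 0 < Sr r.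
Proof.
move=> /andP[mr rp]; have r0 := lt_trans Rm_gt0 mr.
have [rs|sr] := leP r Rs.
  rewrite -SrRm; apply: (@der_gt0_lt _ Sr (derive1 Sr) _ _ mr) => x /andP[mx xr].
    have x0 := lt_le_trans Rm_gt0 mx.
    by rewrite (is_der_E (Sred_der x0)); exact: Sred_der.
  by apply: (Sred_der1_sign (lt_trans Rm_gt0 mx)).1; rewrite (lt_le_trans xr).
rewrite -ltrN2 oppr0 -[0]oppr0 -SrRp.
apply: (@der_gt0_lt _ (fun r => - Sr r) (fun r => - derive1 Sr r) _ _ rp) => x /andP[mx xr].
  have x0 := lt_le_trans r0 mx.
  by apply: derN; rewrite (is_der_E (Sred_der x0)); exact: Sred_der.
by rewrite oppr_gt0; apply: (Sred_der1_sign (lt_trans r0 mx)).2; rewrite (lt_trans sr).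
Qed.

Lemma lipschitz_C1 (f f' : K -> K) (x y : K) : x <= y ->
  (forall r, x <= r <= y -> is_der r f (f' r)) ->
  (forall r, x <= r <= y -> {for r, continuous f'}) ->
  exists2 M : K, 0 < M & forall r s, x <= r -> r <= s -> s <= y -> `|f s - f r| <= M * (s - r).
Proof.
move=> xy df fc.
have [M M0 MP] := @cont_bound _ (fun z => `|f' z|) x y xy
  (fun r rI => continuous_comp (fc r rI) (@norm_continuous _ K _)).
exists M => // r s xr; rewrite le_eqVlt => /predU1P[->|rs] sy.
  by rewrite !subrr normr0 mulr0.
have [||z /andP[rz zs] ->] := @der_mvt _ f f' r s rs.
- by move=> z /andP[rz zs]; apply: df; lra.
- by apply: within_cont => z /andP[rz zs]; apply: is_der_cont (df _ _); lra.
have sr : 0 < s - r by rewrite subr_gt0.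
by rewrite normrM (gtr0_norm sr) ler_pM2r//; apply: MP; lra.
Qed.

(** The linear bounds on [a] and [b] are Lipschitz bounds for [S'] at [Rs] and for [S] at its zeros
    [Rm] and [Rp], divided by [r >= Rm]. *)
Lemma igr_sonic_data : sonic_data igr_a igr_b igr_c Rm Rs Rp.
Proof.
have /andP[RmRs RsRp] := Rs_itv; have Rp_gt0 := lt_trans Rs_gt0 RsRp.
have RmRp := lt_trans RmRs RsRp.
have pos r : Rm <= r <= Rp -> 0 < r by move=> /andP[/(lt_le_trans Rm_gt0)].
have dS r : 0 < r -> is_der r Sr (derive1 Sr r).
  by move=> r0; rewrite (is_der_E (Sred_der r0)); exact: Sred_der.
have [L L0 SL] := @lipschitz_C1 Sr (derive1 Sr) Rm Rp (ltW RmRp)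
  (fun r rI => dS r (pos r rI)) (fun r rI => is_der_cont (Sred_der1 (pos r rI))).
have [L1 L10 SL1] := @lipschitz_C1 (derive1 Sr) S2 Rm Rp (ltW RmRp)
  (fun r rI => Sred_der1 (pos r rI)) (fun r rI => Sred_der2_cont (pos r rI)).
have divB r x y : Rm <= r -> 0 <= y -> x <= y -> x / r <= y / Rm.
  move=> mr y0 xy; have r0 := lt_le_trans Rm_gt0 mr.
  apply: (@le_trans _ _ (y / r)); first by rewrite ler_pM2r ?invr_gt0.
  by rewrite ler_wpM2l// lef_pV2 ?posrE.
(* The [2 alpha m^2/r^4] in [igr_c] cancels against the one coming from [S'']; only terms in [p'']
   and [S'] remain. *)
have acE r : 0 < r -> igr_a' r + igr_c r =
    - (alpha * (derive1 (derive1 p) r / r)) - alpha * (derive1 Sr r / r ^+ 2).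
  by move=> r0; rewrite /igr_a' /igr_c /S2; field; rewrite gt_eqF.
have dp0 r : 0 < r -> 0 <= alpha * (derive1 (derive1 p) r / r).
  by move=> r0; rewrite mulr_ge0 ?divr_ge0 ?ddp_ge0 ?ltW.
split.
- exists 0; split; [exact: Rm_gt0|exact: RmRs|..].
  + move=> r /andP[r0 rs]; rewrite /igr_a mulr_gt0 ?divr_gt0//.
    exact: (Sred_der1_sign r0).1.
  + by move=> r /andP[r0 _]; exact: is_der_derivable (igr_a_der r0).
  + by move=> r /andP[r0 _]; exact: igr_b_cont.
  + by move=> r /andP[r0 _]; exact: igr_c_cont.
  + move=> r /andP[mr rs]; rewrite /igr_b divr_gt0 ?(lt_trans Rm_gt0 mr)//.
    by rewrite Sred_gt0// mr (lt_trans rs).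
  + exists (L / Rm) => [|r /andP[mr rs]]; first by rewrite divr_gt0.
    have := SL Rm r (lexx _) mr (ltW (lt_trans rs RsRp)); rewrite SrRm subr0.
    move=> /(le_trans (ler_norm _)) h; rewrite /igr_b mulrAC; apply: divB => //.
    by apply: mulr_ge0; [exact: ltW|rewrite subr_ge0].
  + exists (igr_c Rs) => [|r /andP[mr rs]]; first exact: igr_c_gt0.
    by apply: igr_c_le; [exact: lt_trans mr|exact: ltW].
  + exists (alpha * (L1 / Rm)) => [|r /andP[mr rs]]; first by rewrite mulr_gt0 ?divr_gt0.
    have := SL1 r Rs (ltW mr) (ltW rs) (ltW RsRp); rewrite Rs_sonic sub0r normrN.
    move=> /(le_trans (ler_norm _)) h; rewrite /igr_a -mulrA ler_pM2l// mulrAC.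
    by apply: divB => //; [exact: ltW|apply: mulr_ge0; [exact: ltW|rewrite subr_ge0; exact: ltW]].
  (* Left of [Rs] both remaining terms are nonpositive. *)
  + exists 0 => // r /andP[mr rs]; have r0 := lt_trans Rm_gt0 mr.
    rewrite (is_der_E (igr_a_der r0)) acE// mul0r.
    have := dp0 r r0; have : 0 < alpha * (derive1 Sr r / r ^+ 2).
      by rewrite mulr_gt0 ?divr_gt0 ?exprn_gt0//; exact: (Sred_der1_sign r0).1.
    lra.
- have opos r : r < - Rs -> 0 < - r /\ Rs < - r.
    by rewrite ltrNr => h; rewrite h (lt_trans Rs_gt0).
  have dra r : r < - Rs -> is_der r (fun s => - igr_a (- s)) (igr_a' (- r)).
    move=> /opos[r0 _]; have d := igr_a_der r0.
    apply: der_eq; first by apply: derN; apply: der_comp d _; der.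
    by rewrite /=; ring.
  have ocont (h : K -> K) r : {for - r, continuous h} -> {for r, continuous (fun s => h (- s))}.
    by move=> hc; apply: continuous_comp; [exact: oppr_continuous|exact: hc].
  have itv r : - Rp < r -> r < - Rs -> - r < Rp by move=> h _; rewrite ltrNl.
  (* Any number below [- Rp] would do, since the coefficients are regular beyond [Rp]. *)
  exists (- Rp - 1); split.
  + by rewrite gtrBl.
  + by rewrite ltrN2.
  + move=> r /andP[_ /opos[r0 rs]]; rewrite oppr_gt0 /igr_a.
    by rewrite pmulr_rlt0// pmulr_llt0 ?invr_gt0// (Sred_der1_sign r0).2.
  + by move=> r /andP[_ /dra/is_der_derivable].
  + by move=> r /andP[_ /opos[r0 _]]; apply: ocont; exact: igr_b_cont.
  + by move=> r /andP[_ /opos[r0 _]]; apply: ocont; exact: igr_c_cont.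
  + move=> r /andP[pr rs']; have [r0 rs] := opos _ rs'.
    by rewrite /igr_b divr_gt0// Sred_gt0// (lt_trans RmRs rs) itv.
  + exists (L / Rm) => [|r /andP[pr rs']]; first by rewrite divr_gt0.
    have [r0 rs] := opos _ rs'; have rp : - r <= Rp by rewrite lerNl.
    have mr := ltW (lt_trans RmRs rs).
    have := SL (- r) Rp mr rp (lexx _); rewrite SrRp sub0r normrN.
    move=> /(le_trans (ler_norm _)) h.
    have -> : r - - Rp = Rp - - r by ring.
    rewrite /igr_b mulrAC.
    by apply: divB => //; apply: mulr_ge0; [exact: ltW|lra].
  + exists (igr_c Rp) => [|r /andP[pr rs']]; first exact: igr_c_gt0.
    have [r0 rs] := opos _ rs'; apply: igr_c_le => //.
    by rewrite ltW// itv.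
  + exists (alpha * (L1 / Rm)) => [|r /andP[pr rs']]; first by rewrite mulr_gt0 ?divr_gt0.
    have [r0 rs] := opos _ rs'; have rp := ltW (itv _ pr rs').
    have := SL1 Rs (- r) (ltW RmRs) (ltW rs) rp; rewrite Rs_sonic subr0.
    rewrite -normrN => /(le_trans (ler_norm _)) h.
    have -> : - Rs - r = - r - Rs by ring.
    rewrite /igr_a -mulrN -mulNr -mulrA ler_pM2l// mulrAC.
    by apply: divB => //; [exact: ltW (lt_trans RmRs rs)|apply: mulr_ge0; [exact: ltW|lra]].
  (* Right of [Rs] the term in [S'] is positive; it equals [- a / r] at the reflected point, where
     [1/r <= 1/Rs]. *)
  + exists Rs^-1 => [|r /andP[pr rs']]; first by rewrite invr_ge0 ltW.
    have [r0 rs] := opos _ rs'.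
    rewrite (is_der_E (dra _ rs')) acE//.
    have h1 := dp0 _ r0.
    have S0 := (Sred_der1_sign r0).2 rs.
    have h2 : - (alpha * (derive1 Sr (- r) / (- r) ^+ 2)) <= Rs^-1 * - igr_a (- r).
      have -> : - (alpha * (derive1 Sr (- r) / (- r) ^+ 2)) = (- r)^-1 * - igr_a (- r).
        by rewrite /igr_a; field; rewrite -oppr_eq0 gt_eqF.
      apply: ler_wpM2r.
        by rewrite oppr_ge0 ltW// /igr_a pmulr_rlt0// pmulr_llt0 ?invr_gt0.
      by rewrite lef_pV2 ?posrE// ltW.
    lra.
- by rewrite /igr_a Rs_sonic mul0r mulr0.
- by move=> r /pos/igr_a_der/is_der_cont.
- by move=> r /pos/igr_b_cont.
- by move=> r /pos/igr_c_cont.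
- by rewrite /igr_b divr_gt0// Sred_gt0.
- by move=> r /pos/igr_c_gt0.
Qed.

End Physical.

(** The constants of [energy_e] are those for which it returns the internal energy of the end state,
    so the reduced pressure there is the pressure in the jump relations. *)
Lemma rankine_hugoniot_Sred (K : realType) (pt : K -> K -> K) (c m q k R0 U0 En0 : K) :
  m != 0 -> 0 < R0 -> rankine_hugoniot pt c m q k R0 U0 En0 -> Sred pt c m q k R0 = 0.
Proof.
move=> m0 R00 []; set p0 := pt _ _ => Hm Hq Hk; have Rn0 : R0 != 0 by rewrite gt_eqF.
have EU : U0 = c + m / R0 by rewrite -Hm; field.
have Ep : p0 = q - m * U0 by rewrite -Hq; ring.
have EE : energy_e c m q k R0 = En0 / R0 - U0 ^+ 2 / 2.
  have Ek : k = En0 * (m / R0) + p0 * U0 by rewrite -Hk EU; ring.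
  by rewrite /energy_e Ek Ep EU; field; rewrite m0 Rn0.
by rewrite /Sred /pressure_red EE -/p0 Ep EU; field.
Qed.

Theorem theorem2p3 (K : realType) (alpha : K) (pt : K -> K -> K)
    (c m q k Rm Rp Um Up Em Ep Rs : K)
    (p := pressure_red pt c m q k) (Sr := Sred pt c m q k)
    (alpha_gt0 : 0 < alpha)
    (pt_C2 : C2_halfplane pt)
    (m_neq0 : m != 0)
    (Rm_gt0 : 0 < Rm) (Rp_gt0 : 0 < Rp)
    (RHm : rankine_hugoniot pt c m q k Rm Um Em)
    (RHp : rankine_hugoniot pt c m q k Rp Up Ep)
    (Rm_lt_Rp : Rm < Rp)
    (dp_ge0 : 0 <= derive1 p Rm /\ 0 <= derive1 p Rp)
    (lax : c < Um - Num.sqrt (derive1 p Rm) /\ Up - Num.sqrt (derive1 p Rp) < c)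
    (p_C2 : C2_on `]0, +oo[ p)
    (convex :
      (forall r, Rm <= r <= Rp -> convexA pt c m q k r) \/
      (forall r, Rm <= r <= Rp -> convexB pt c m q k r))
    (ddp_ge0 : forall r, 0 < r -> 0 <= derive1 (derive1 p) r)
    (Rs_itv : Rm < Rs < Rp)
    (Rs_sonic : derive1 Sr Rs = 0)
    (Rs_unique : forall r, 0 < r -> derive1 Sr r = 0 -> r = Rs)
    (ddp_lip : exists2 V, nbhs Rs V & [lipschitz derive1 (derive1 p) x | x in V]) :
  let M := admissible alpha pt c m q k Rm Rp in
  [/\ exists R, M R,
      forall R R', M R -> M R' -> exists xi0, forall xi, R' xi = R (xi - xi0)
    & forall R, M R ->
      [/\ exists xis,
            [/\ R xis = Rs, forall xi, R xi = Rs -> xi = xis,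
                {for xis, continuous R}
              & C2_on (`]-oo, xis[ `|` `]xis, +oo[) R],
          {homo R : x y / x < y}
        & exists U e En S,
            [/\ profile_fields pt c m q k R U e En S,
                forall U' e' En' S', profile_fields pt c m q k R U' e' En' S' ->
                  [/\ U' = U, e' = e, En' = En & S' = S]
              & tw_weak_solution alpha pt c R U e En S]]].
Proof.
have SrRm := rankine_hugoniot_Sred m_neq0 Rm_gt0 RHm.
have SrRp := rankine_hugoniot_Sred m_neq0 Rp_gt0 RHp.
have SD := igr_sonic_data alpha_gt0 m_neq0 Rm_gt0 Rs_itv p_C2 ddp_ge0 SrRm SrRp Rs_sonic.
move=> M.
have pos r : Rm <= r <= Rp -> 0 < r by move=> /andP[/(lt_le_trans Rm_gt0)].
have M_ts R : M R -> exists t, transonic (igr_a alpha pt c m q k) (igr_b pt c m q k)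
    (igr_c alpha m) Rm Rs Rp R t.
  move=> [[[Rc RI] RNy Ry [dR [W weak]]] Rh].
  exact: (weak_transonic SD Rc RI RNy Ry Rh W weak).
have W12R R t : transonic (igr_a alpha pt c m q k) (igr_b pt c m q k)
    (igr_c alpha m) Rm Rs Rp R t -> W12_loc_deriv R (derive1 R).
  move=> TS; have E : derive1 R = fun s => 1 * derive1 R s.
    by apply/funext => s; rewrite mul1r.
  rewrite E; exact: (transonic_W12 SD TS (h := id) (h' := fun=> 1)
    (fun r _ => der_id r) (fun r _ => cvg_cst _)).
have ts_M R t : transonic (igr_a alpha pt c m q k) (igr_b pt c m q k)
    (igr_c alpha m) Rm Rs Rp R t -> M R.
  move=> TS; split; last first.
    by move=> x y; rewrite le_eqVlt => /predU1P[->//|/(transonic_lt SD TS)/ltW].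
  split; [by split; [exact: (ts_cont TS)|exact: (ts_itv TS)]|exact: (ts_Ny TS)|exact: (ts_y TS)|].
  exists (derive1 R); split; first exact: (W12R _ _ TS).
  exact: (transonic_weak SD TS).
split.
- by have [R TS] := transonic_exists SD; exists R; exact: ts_M TS.
- move=> R R' /M_ts[t TS] /M_ts[t' TS']; exists (t' - t).
  exact: (transonic_unique SD TS TS').
move=> R /M_ts[t TS]; split.
- exists t; split.
  + exact: (ts_sonic TS).
  + move=> s Rs_s; case: (ltgtP s t) => // st.
      by have := ts_lt TS st; rewrite Rs_s ltxx.
    by have := ts_gt TS st; rewrite Rs_s ltxx.
  + exact: (ts_cont TS).
  + apply: (transonic_C2 SD TS (a' := igr_a' alpha pt c m q k)) => r /pos r0.
      exact: (igr_a_der alpha p_C2 r0).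
    exact: (igr_a'_cont p_C2 r0).
- exact: (transonic_lt SD TS).
have R0 s : 0 < R s by exact/pos/(ts_itv TS).
have Rn0 s : R s != 0 by rewrite gt_eqF.
pose U s := c + m / R s; pose e s := energy_e c m q k (R s).
pose S s := Sred pt c m q k (R s); pose En s := R s * e s + R s * U s ^+ 2 / 2.
have Rc := ts_cont TS.
have Uc : continuous U.
  move=> s; apply: cvgD; first exact: cvg_cst.
  by apply: cvgM; [exact: cvg_cst|apply: cvgV; [exact: Rn0|exact: Rc]].
have ec : continuous e.
  move=> s; apply: cvgD; first apply: cvgD; first exact: cvg_cst.
    by apply: cvgM; [exact: cvg_cst|apply: cvgV; [exact: Rn0|exact: Rc]].
  apply: cvgM; [exact: cvg_cst|apply: cvgV; first by rewrite mulf_neq0// expf_neq0].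
  by apply: cvgM; [exact: cvg_cst|exact/continuous_sqr/Rc].
exists U, e, En, S; split => //.
  move=> U' e' En' S' F; have E s := F s.
  have EU : U' = U by apply/funext => s; have [] := E s.
  have Ee : e' = e by apply/funext => s; have [] := E s.
  split=> //; apply/funext => s; have [_ _ ES EEn] := E s => //.
  by rewrite EEn EU Ee.
split.
(* The constants [m], [q] and [k] are the fluxes of mass, momentum and energy in the frame moving at
   speed [c]. *)
- by apply: (@dist_balance_cst _ _ _ _ m) => // s; rewrite /U; field.
- apply: (@dist_balance_cst _ _ _ _ q).
    by move=> s; apply: cvgM; [exact: Rc|exact: Uc].
  move=> s; rewrite /S /Sred /pressure_red -/(e s) /U; field.
  exact: Rn0.
- apply: (@dist_balance_cst _ _ _ _ k).
    move=> s; apply: cvgD; first by apply: cvgM; [exact: Rc|exact: ec].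
    apply: cvgM; last exact: cvg_cst.
    by apply: cvgM; [exact: Rc|exact/continuous_sqr/Uc].
  move=> s; rewrite /S /Sred /pressure_red -/(e s).
  rewrite (_ : En s + pt (R s) (e s) + _ = En s + q - m * c - m ^+ 2 / R s); last by ring.
  by rewrite /En /e /energy_e /U; field; rewrite m_neq0 Rn0.
(* Chain rule; the value at the crossing is junk but concerns a single point. *)
pose dU s := - m / R s ^+ 2 * derive1 R s.
pose dS s := derive1 (Sred pt c m q k) (R s) * derive1 R s.
have gE s : S s / R s - 2 * alpha * dU s ^+ 2 =
    igr_b pt c m q k (R s) - igr_c alpha m (R s) * derive1 R s ^+ 2.
  by rewrite /S /dU /igr_b /igr_c; field; exact: Rn0.
have fE s : alpha * (dS s / R s) = igr_a alpha pt c m q k (R s) * derive1 R s.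
  by rewrite /dS /igr_a; field; exact: Rn0.
exists dU, dS; split.
- apply: (transonic_W12 SD TS (h := fun r => c + m / r) (h' := fun r => - m / r ^+ 2)) => r /pos r0.
    have rn0 := lt0r_neq0 r0.
    have dV := derV (f := id) rn0 (der_id r).
    by apply: der_eq; [exact: derD (der_cst _ _) (derM (der_cst _ _) dV)|rewrite /=; field].
  apply: cvgM; first exact: cvg_cst.
  have dV := derV (f := fun y => y ^+ 2) (expf_neq0 2 (lt0r_neq0 r0)) (derX 2 (der_id r)).
  exact: is_der_cont dV.
- apply: (transonic_W12 SD TS (h := Sred pt c m q k)) => r /pos r0.
    by rewrite (is_der_E (Sred_der p_C2 r0)); exact: Sred_der.
  exact: is_der_cont (Sred_der1 p_C2 r0).
- by rewrite (funext gE); exact: (transonic_source_integrable SD TS).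
- by rewrite (funext fE); exact: continuous_locally_integrable (transonic_flux_cont SD TS).
- move=> phi tphi; rewrite addrC -[RHS](transonic_weak SD TS tphi).
  by congr (_ + _); apply: eq_Rintegral => s _; rewrite ?fE ?gE.
Qed.
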